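(* Let $\Omega$ be a domain in $\mathbb{C}^n$. Let $(u_k)_k$ be a bounded sequence in $W^{1,2}_*(\Omega)$ converging to a function $u\in W^{1,2}_*(\Omega)$ in the sense of currents (i.e. of distributions). Then $u_k$ converges to $u$ in $L^p_{loc}(\Omega)$ for every $1\le p<+\infty$.
   Context: For a domain $\Omega\subset\mathbb{C}^n$, $W^{1,2}(\Omega)$ is the space of square integrable (real-valued) functions on $\Omega$ whose first order partial derivatives are square integrable on $\Omega$. $W^{1,2}_*(\Omega)$ is the set of $u\in W^{1,2}(\Omega)$ for which there is a closed positive $(1,1)$-current $T$ of bounded mass on $\Omega$ with $i\partial u\wedge\overline\partial u\le T$. Its norm is $\|u\|_*^2:=\|u\|_{L^2}^2+\inf\{\|T\|\}$, the infimum over all such $T$, where $\|T\|$ is the mass of $T$ on $\Omega$. Bounded means bounded for $\|\cdot\|_*$. $L^p_{loc}$ is with respect to the Lebesgue measure. *)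

(* Defs.v *)
From HB Require Import structures.
From mathcomp Require Import all_boot all_order all_algebra complex.
From mathcomp Require Import all_classical all_reals all_analysis.

Set Implicit Arguments.
Unset Strict Implicit.
Unset Printing Implicit Defensive.

Import Order.TTheory GRing.Theory Num.Theory.
Import numFieldNormedType.Exports.

Local Open Scope classical_set_scope.
Local Open Scope ring_scope.

(* R^N carries the sigma-algebra generated by the coordinates, i.e. the Borel
   sigma-algebra. *)
Definition rV_display : measure_display.
Proof. exact: default_measure_display. Qed.

Section measurable_rV.
Context {R : realType} (N : nat).

Let coord (i : 'I_N) (v : 'rV[R]_N) : R := v ord0 i.

Let rV_set0 : g_sigma_preimage coord set0.
Proof. exact: sigma_algebra0. Qed.

Let rV_setC A : g_sigma_preimage coord A -> g_sigma_preimage coord (~` A).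
Proof. exact: sigma_algebraC. Qed.

Let rV_bigcup (F : (set 'rV[R]_N)^nat) :
  (forall i, g_sigma_preimage coord (F i)) ->
  g_sigma_preimage coord (\bigcup_i F i).
Proof. exact: sigma_algebra_bigcup. Qed.

HB.instance Definition _ := @isMeasurable.Build rV_display
  'rV[R]_N (g_sigma_preimage coord) rV_set0 rV_setC rV_bigcup.

End measurable_rV.

Section lebesgue_rV.
Context {R : realType}.

Lemma measurable_coord_rV N (i : 'I_N) :
  measurable_fun [set: 'rV[R]_N] (fun v => v ord0 i).
Proof.
move=> _ Y mY; rewrite setTI; apply: sub_sigma_algebra => /=.
rewrite -bigcup_seq/=; exists i => /=; first by rewrite mem_index_enum.
by exists Y => //; rewrite setTI.
Qed.

Lemma measurable_fun_rVP d (T : measurableType d) N (f : T -> 'rV[R]_N) :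
  (forall i, measurable_fun [set: T] (fun x => f x ord0 i)) ->
  measurable_fun [set: T] f.
Proof.
move=> mf _ A mA; rewrite setTI; move: A mA.
suff : @measurable _ 'rV[R]_N `<=` [set A | measurable (f @^-1` A)] by apply.
apply: smallest_sub.
  split => /=; first by rewrite preimage_set0.
  - by move=> A mA; rewrite setTD preimage_setC; exact: measurableC.
  - by move=> F mF; rewrite preimage_bigcup; exact: bigcup_measurable.
rewrite -bigcup_seq => A [i _ [B mB <-]] /=.
by rewrite setTI -[X in measurable X]setTI; exact: (mf i).
Qed.

Definition rV_cons N (p : measurableTypeR R * 'rV[R]_N) : 'rV[R]_N.+1 :=
  \row_i (if unlift ord0 i is Some j then p.2 ord0 j else p.1).

Definition rV_uncons N (v : 'rV[R]_N.+1) : measurableTypeR R * 'rV[R]_N :=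
  (v ord0 ord0, \row_i v ord0 (lift ord0 i)).

Lemma rV_consK N : cancel (@rV_cons N) (@rV_uncons N).
Proof.
move=> [x v]; rewrite /rV_uncons /rV_cons mxE unlift_none; congr pair.
by apply/rowP => i; rewrite !mxE liftK.
Qed.

Lemma measurable_rV_cons N : measurable_fun [set: _] (@rV_cons N).
Proof.
apply: measurable_fun_rVP => i; rewrite /rV_cons.
under eq_fun do rewrite mxE.
case: unlift => [j|]; last exact: measurable_fst.
exact: (measurableT_comp (measurable_coord_rV j) measurable_snd).
Qed.

Lemma measurable_rV_uncons N : measurable_fun [set: _] (@rV_uncons N).
Proof.
apply: measurable_fun_pair => /=; first exact: measurable_coord_rV.
apply: measurable_fun_rVP => i; under eq_fun do rewrite mxE.
exact: measurable_coord_rV.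
Qed.

Section lebesgue_rVS.
Variables (N : nat) (m : {sigma_finite_measure set 'rV[R]_N -> \bar R}).

Definition lebesgue_rVS : set 'rV[R]_N.+1 -> \bar R :=
  pushforward (lebesgue_measure \x m)%E (@rV_cons N).

Let lebesgue_rVS0 : (lebesgue_rVS set0 = 0)%E.
Proof. by rewrite /lebesgue_rVS /pushforward preimage_set0 measure0. Qed.

Let lebesgue_rVS_ge0 A : (0 <= lebesgue_rVS A)%E.
Proof. by rewrite /lebesgue_rVS /pushforward measure_ge0. Qed.

Let lebesgue_rVS_sigma_additive : semi_sigma_additive lebesgue_rVS.
Proof.
have mpre A : measurable A -> measurable (@rV_cons N @^-1` A).
  by move=> mA; rewrite -[X in measurable X]setTI; exact: measurable_rV_cons.
move=> F mF tF mUF; rewrite /lebesgue_rVS /pushforward preimage_bigcup.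
apply: measure_semi_sigma_additive.
- by move=> k; exact: mpre.
- apply/trivIsetP => /= i j _ _ ij; rewrite -preimage_setI.
  by move/trivIsetP : tF => /(_ _ _ _ _ ij) ->//; rewrite preimage_set0.
- by rewrite -preimage_bigcup; exact: mpre.
Qed.

HB.instance Definition _ := isMeasure.Build _ _ _ lebesgue_rVS
  lebesgue_rVS0 lebesgue_rVS_ge0 lebesgue_rVS_sigma_additive.

Let lebesgue_rVS_sigma_finite : sigma_finite setT lebesgue_rVS.
Proof.
have /sigma_finiteP[F [TF ndF Foo]] := sigma_finiteT (@lebesgue_measure R).
have /sigma_finiteP[G [TG ndG Goo]] := sigma_finiteT m.
exists (fun k => @rV_uncons N @^-1` (F k `*` G k)).
  rewrite -preimage_bigcup (_ : \bigcup_k _ = setT) ?preimage_setT//.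
  rewrite -setXTT TF TG predeqE => -[x y]; split.
    by move=> [k _ []/= ? ?]; split; exists k.
  move=> [/= [k _ Fkx] [l _ Gly]]; exists (maxn k l) => //; split.
  - by move: x Fkx; exact/subsetPset/ndF/leq_maxl.
  - by move: y Gly; exact/subsetPset/ndG/leq_maxr.
move=> k; have [mF Fk] := Foo k; have [mG Gk] := Goo k; split.
  rewrite -[X in measurable X]setTI; apply: measurable_rV_uncons => //.
  exact: measurableX.
rewrite /lebesgue_rVS /pushforward -comp_preimage.
rewrite (_ : _ \o _ = id); last by apply/funext => p /=; rewrite rV_consK.
by rewrite preimage_id product_measure1E// lte_mul_pinfty// ge0_fin_numE.
Qed.

HB.instance Definition _ := Measure_isSigmaFinite.Build _ _ _ lebesgue_rVS
  lebesgue_rVS_sigma_finite.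

End lebesgue_rVS.

(* Lebesgue measure on R^N, as an iterated product; R^0 is a single point of
   measure 1. *)
Fixpoint lebesgue_rV N : {sigma_finite_measure set 'rV[R]_N -> \bar R} :=
  if N is N'.+1 then lebesgue_rVS (lebesgue_rV N') else \d_(0 : 'rV[R]_0).

End lebesgue_rV.

Section test_functions.
Context {R : realType} {N : nat}.
Local Notation V := 'rV[R]_N.

Definition partial (i : 'I_N) (f : V -> R) : V -> R :=
  'D_(delta_mx ord0 i : V) f.

Definition partials (s : seq 'I_N) (f : V -> R) : V -> R := foldr partial f s.

Definition smooth (f : V -> R) :=
  forall s : seq 'I_N, continuous (partials s f) /\
    forall (i : 'I_N) (x : V), derivable (partials s f) x (delta_mx ord0 i : V).

Definition supported_in (K : set V) (f : V -> R) := forall x, ~ K x -> f x = 0.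

Definition test_function (Omega : set V) (f : V -> R) :=
  smooth f /\ exists K, [/\ compact K, K `<=` Omega & supported_in K f].

(* Complex-valued distributions on Omega, given by their values on real test
   functions.  In the continuity estimate, M bounds the C^m-norm of f. *)
Definition distribution_on (Omega : set V) (T : (V -> R) -> R[i]) :=
  (forall (a : R) (f g : V -> R), test_function Omega f ->
     test_function Omega g ->
     T (fun x => a * f x + g x) = (a%:C)%C * T f + T g) /\
  (forall K : set V, compact K -> K `<=` Omega ->
     exists (C : R) (m : nat), forall (f : V -> R) (M : R),
       smooth f -> supported_in K f ->
       (forall (s : seq 'I_N) x, (size s <= m)%N -> `|partials s f x| <= M) ->
       `|T f| <= ((C * M)%:C)%C).

Definition L2 (Omega : set V) (f : V -> R) :=
  measurable_fun Omega f /\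
  (\int[lebesgue_rV N]_(x in Omega) ((f x) ^+ 2)%:E < +oo)%E.

(* g is the gradient of u in the sense of distributions, and it is L^2. *)
Definition L2_gradient (Omega : set V) (u : V -> R) (g : 'I_N -> V -> R) :=
  forall i, L2 Omega (g i) /\
    forall f, test_function Omega f ->
      \int[lebesgue_rV N]_(x in Omega) (u x * partial i f x) =
      - \int[lebesgue_rV N]_(x in Omega) (g i x * f x).

Definition W12 (Omega : set V) (u : V -> R) :=
  L2 Omega u /\ exists g, L2_gradient Omega u g.

Definition domain (Omega : set V) :=
  [/\ open Omega, connected Omega & Omega !=set0].

Definition cvg_distribution (Omega : set V) (u_ : nat -> V -> R) (u : V -> R) :=
  forall f, test_function Omega f ->
    \int[lebesgue_rV N]_(x in Omega) (u_ k x * f x) @[k --> \oo] -->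
    \int[lebesgue_rV N]_(x in Omega) (u x * f x).

(* The L^p-norm on K; u \_ K is u extended by 0 outside K. *)
Definition Lp_norm_on (K : set V) (p : R) (u : V -> R) : \bar R :=
  'N[lebesgue_rV N]_p%:E [EFin \o (u \_ K)]%E.

Definition Lploc (Omega : set V) (p : R) (u : V -> R) :=
  measurable_fun Omega u /\
  forall K, compact K -> K `<=` Omega -> (Lp_norm_on K p u < +oo)%E.

Definition cvg_Lploc (Omega : set V) (p : R) (u_ : nat -> V -> R) (u : V -> R) :=
  [/\ forall k, Lploc Omega p (u_ k), Lploc Omega p u &
      forall K, compact K -> K `<=` Omega ->
        Lp_norm_on K p (u_ k \- u) @[k --> \oo] --> 0%E].

End test_functions.

Section currents.
Context {R : realType} {n : nat}.
(* C^n is identified with R^(2n) by z_j = x_j + i y_j, where (x_1, ..., x_n) are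
   the first n coordinates and (y_1, ..., y_n) the last n. *)
Local Notation Cn := 'rV[R]_(n + n).
Local Notation D := (Cn -> R).

Definition xi (j : 'I_n) : 'I_(n + n) := lshift n j.
Definition yi (j : 'I_n) : 'I_(n + n) := rshift n j.

(* d/dz_j = (d/dx_j - i d/dy_j) / 2 applied to a distribution, by duality;
   dzbar is d/dzbar_j = (d/dx_j + i d/dy_j) / 2. *)
Definition dz (j : 'I_n) (T : D -> R[i]) : D -> R[i] := fun f =>
  - (T (partial (xi j) f) - 'i%C * T (partial (yi j) f)) / 2%:R.

Definition dzbar (j : 'I_n) (T : D -> R[i]) : D -> R[i] := fun f =>
  - (T (partial (xi j) f) + 'i%C * T (partial (yi j) f)) / 2%:R.

(* T stands for the (1,1)-form i * sum_(j, k) T_jk dz_j /\ dzbar_k with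
   distribution coefficients; a coefficient given by a locally integrable
   function is paired with test functions via Lebesgue measure. *)
Definition current11 := 'I_n -> 'I_n -> D -> R[i].

Definition is_current11 (Omega : set Cn) (T : current11) :=
  forall j k, distribution_on Omega (T j k).

(* dT = 0: the two conditions say that the coefficients of the (2,1)-part
   i * sum d_l T_jk dz_l /\ dz_j /\ dzbar_k and of the (1,2)-part of dT
   vanish. *)
Definition closed_current (Omega : set Cn) (T : current11) :=
  forall (j k l : 'I_n) f, test_function Omega f ->
    dz l (T j k) f = dz j (T l k) f /\ dzbar l (T j k) f = dzbar k (T j l) f.

(* T is positive when T /\ (i a_1 /\ abar_1) /\ ... /\ (i a_(n-1) /\ abar_(n-1))
   is a positive distribution for all constant (1,0)-forms a_1, ..., a_(n-1):
   up to a positive factor it is sum_(j, k) c_j cbar_k T_jk, where c is the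
   vector of maximal minors (with signs) of a_1, ..., a_(n-1), and every c != 0
   in C^n is proportional to such a vector.
   In R[i], 0 <= z means that z is real and nonnegative. *)
Definition positive_current (Omega : set Cn) (T : current11) :=
  forall (f : D) (c : 'I_n -> R[i]), test_function Omega f ->
    (forall x, 0 <= f x) ->
    0 <= \sum_j \sum_k c j * (c k)^*%C * T j k f.

(* For T positive, the mass is that of the positive measure
   T /\ w^(n-1) / (n-1)!, where w = (i/2) sum_j dz_j /\ dzbar_j, which is
   2 sum_j T_jj times Lebesgue measure; it is obtained by testing against cut-off
   functions. *)
Definition mass (Omega : set Cn) (T : current11) : \bar R :=
  ereal_sup [set (2 * \sum_j complex.Re (T j j f))%:E | f in
    [set f | test_function Omega f /\ forall x, 0 <= f x <= 1]].

(* The current i du /\ dbar u when g is the gradient of the real function u: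
   the coefficient of i dz_j /\ dzbar_k is (du/dz_j) (du/dzbar_k). *)
Definition grad_z (g : 'I_(n + n) -> D) (j : 'I_n) (x : Cn) : R[i] :=
  (g (xi j) x -i* g (yi j) x)%C / 2%:R.

Definition dudbaru (Omega : set Cn) (g : 'I_(n + n) -> D) : current11 :=
  fun j k f =>
    let h x := grad_z g j x * (grad_z g k x)^*%C in
    ((\int[lebesgue_rV (n + n)]_(x in Omega) (complex.Re (h x) * f x)) +i*
     (\int[lebesgue_rV (n + n)]_(x in Omega) (complex.Im (h x) * f x)))%C.

(* The closed positive currents T of bounded mass with i du /\ dbar u <= T. *)
Definition dominating (Omega : set Cn) (u : D) : set current11 :=
  [set T | [/\ is_current11 Omega T, closed_current Omega T,
     positive_current Omega T, (mass Omega T < +oo)%E &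
     exists2 g, L2_gradient Omega u g &
       positive_current Omega (fun j k f => T j k f - dudbaru Omega g j k f)]].

Definition W12star (Omega : set Cn) (u : D) :=
  W12 Omega u /\ dominating Omega u !=set0.

Definition star_norm (Omega : set Cn) (u : D) : \bar R :=
  sqrte (\int[lebesgue_rV (n + n)]_(x in Omega) ((u x) ^+ 2)%:E +
         ereal_inf [set mass Omega T | T in dominating Omega u])%E.

Definition star_bounded (Omega : set Cn) (u_ : nat -> D) :=
  exists M : R, forall k, (star_norm Omega (u_ k) <= M%:E)%E.

End currents.

(* Main.v *)
Require Import Defs.
From HB Require Import structures.
From mathcomp Require Import all_boot all_order all_algebra complex.
From mathcomp Require Import all_classical all_reals all_analysis.
From mathcomp Require Import measurable_realfun.
From mathcomp Require Import ring lra.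

Set Implicit Arguments.
Unset Strict Implicit.
Unset Printing Implicit Defensive.

Import Order.TTheory GRing.Theory Num.Theory.
Import numFieldNormedType.Exports.

Local Open Scope classical_set_scope.
Local Open Scope ring_scope.

(* If T is a closed positive (1,1)-current of mass at most M, then by Lelong's
   monotonicity its mass on a cube of side r is O(r^(2n-2)), with a constant
   that depends only on M. So i du /\ dbar u <= T gives the Morrey estimate
   int_(cube x r) |grad u|^2 <= C r^(2n-2).
   Let M_j u be the mollification of u at scale r_j = r_0 / 2^j.  Then
   |M_(j+1) u - M_j u| <= A_j, where A_j x = c r_j^(1-2n) int_(cube x r_j) |grad u|.
   By the Morrey estimate A_j is bounded independently of j, and by Tonelli its
   integral is O(r_j).  Since M_j u -> u a.e.,
   |u - M_J u|^m <= c sum_(j >= J) (j+1)^(m-1) A_j, so that M_J u -> u in L^m_loc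
   uniformly on bounded subsets of W^{1,2}_*.  For fixed J, weak convergence
   u_k -> u gives bounded pointwise convergence M_J u_k -> M_J u. *)

(** * Smooth functions *)

(** Two obstacles shape the proof. First, positivity of [T] is given only against constant vectors,
    while Lelong's inequality needs it for the coefficients z_j conj(z_k); a convexity argument adds
    one affine term at a time, so that [T] stays a matrix of distributions throughout. The
    inequality is then tested with a cut-off of (|z - a|^2 + b)^(1-n), a regularization of the
    critical power: the defect caused by [b] is exactly a quantity that controls the mass near [a].
    Second, the bound on each A_j alone would let the sum of the A_j diverge, and their integrals
    alone would only give L^1. In the m-th power of the sum, m - 1 factors are estimated by the
    uniform bound, which costs the weight (j+1)^(m-1), and the last one by its integral, whose
    factor 2^-j beats the weight. The kernel is a product of one-dimensional bumps with an explicit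
    primitive, so that the difference of two scales is a divergence of functions with one factor 1/r
    fewer. The same sums show that M_j u has a limit almost everywhere; integration over boxes
    identifies it with u. *)

Section flat.
Context {R : realType}.
Implicit Types (k : nat) (x : R).

(* Up to linear combination, this family is closed under derivation. *)
Definition flat k x : R := if 0 < x then x^-1 ^+ k * expR (- x^-1) else 0.

Lemma flat_gt0 k x : 0 < x -> 0 < flat k x.
Proof. by move=> x0; rewrite /flat x0 mulr_gt0 ?expR_gt0// exprn_gt0 ?invr_gt0. Qed.

Lemma flat_ge0 k x : 0 <= flat k x.
Proof.
have [x0|x0] := ltP 0 x; first exact/ltW/flat_gt0.
by rewrite /flat ltNge x0.
Qed.

Lemma flat_le0 k x : x <= 0 -> flat k x = 0.
Proof. by move=> x0; rewrite /flat ltNge x0. Qed.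

(** One term of the exponential series at [x^-1] is at most its sum. The bound serves again to
    dominate the derivative of a cut-off and to compare powers with geometric sequences. *)
Lemma flatS_le k x : flat k.+1 x <= k.+1`!%:R.
Proof.
rewrite /flat; case: ifPn => // x0; rewrite expRN ler_pdivrMr ?expR_gt0//.
have xV0 : 0 <= x^-1 by rewrite invr_ge0 ltW.
have := expR_ge1Dxn k xV0; set e := expR _; set y := x^-1 ^+ _.
have f0 : 0 < (k.+1)`!%:R :> R by rewrite ltr0n fact_gt0.
by rewrite -ler_pdivrMl// mulrC => h; apply: le_trans h; rewrite lerDr.
Qed.

Lemma flatM k x : flat k x = flat k.+1 x * x.
Proof.
rewrite /flat; case: ifPn => x0; last by rewrite mul0r.
by rewrite exprSr -!mulrA [_ * x]mulrC mulKf// gt_eqF.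
Qed.

Lemma norm_flat_le k x : `|flat k x| <= k.+1`!%:R * `|x|.
Proof.
by rewrite flatM normrM ler_wpM2r// ger0_norm ?flat_ge0// flatS_le.
Qed.

Lemma cvg_flat0 k : flat k x @[x --> 0] --> 0.
Proof.
have h : k.+1`!%:R * `|x| @[x --> (0 : R)] --> 0.
  have : k.+1`!%:R * `|x| @[x --> (0 : R)] --> k.+1`!%:R * `|0 : R|.
    by apply: cvgM; [exact: cvg_cst|exact: norm_continuous].
  by rewrite normr0 mulr0.
apply/norm_cvg0P; apply: squeeze_cvgr h; last exact: cvg_cst.
by near=> x; rewrite normr_ge0 norm_flat_le.
Unshelve. all: by end_near. Qed.

Lemma is_derive_flat k x :
  is_derive x 1 (flat k) (- k%:R * flat k.+1 x + flat k.+2 x).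
Proof.
have [x0|x0|->] := ltgtP x 0.
- rewrite !flat_le0 ?ltW// mulr0 addr0.
  apply: (near_eq_is_derive (f := cst 0)).
  by near=> y; rewrite flat_le0//; apply: ltW; near: y; exact: lt_nbhsl.
- have -> : - k%:R * flat k.+1 x + flat k.+2 x =
     - (k%:R * x^-1 ^+ k.+1) * expR (- x^-1) + x^-1 ^+ k * (x^-1 ^+ 2 * expR (- x^-1)).
    by rewrite /flat x0 mulrA mulrA -exprD addn2 mulNr.
  apply: (near_eq_is_derive (f := fun y : R => y^-1 ^+ k * expR (- y^-1))).
    by near=> y; rewrite /flat ifT//; near: y; exact: lt_nbhsr.
  have dV : is_derive x 1 (fun y : R => y^-1) (- x ^- 2).
    have := @is_deriveV R id x 1 1; rewrite /= scaler1; apply; first by rewrite gt_eqF.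
  have dN : is_derive x 1 (fun y : R => - y^-1) (x ^- 2).
    by apply: is_derive_eq; rewrite opprK.
  have dE := @is_derive1_comp R expR (fun y => - y^-1) x _ _ (is_derive_expR (- x^-1)) dN.
  have dX := is_deriveX k dV.
  have dM := is_deriveM dX dE.
  have -> : (fun y : R => y^-1 ^+ k * expR (- y^-1)) =
      ([eta GRing.inv] ^+ k * (expR \o (fun y : R => - y^-1))).
    by apply/funext => y /=; rewrite !fctE.
  apply: (is_derive_eq dM).
  rewrite !fctE /= /GRing.scale /=; set E := expR _.
  rewrite -!exprVn; set y := x^-1.
  by case: (k) => [|j]; rewrite ?expr0 ?exprS /=; ring.
- rewrite !flat_le0// mulr0 addr0.
  (* By [flatM], the difference quotient of [flat k] at 0 is [flat k.+1], which tends to 0. *)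
  have fl : (fun h : R => h^-1 *: (flat k (h *: 1 + 0) - flat k 0)) @ 0^' --> (0 : R).
    apply: (@cvg_trans _ (flat k.+1 @ 0^')); last first.
      apply: cvg_trans (cvg_flat0 k.+1); apply: cvg_app; exact: nbhs_dnbhs.
    apply: near_eq_cvg; near=> h; rewrite (flat_le0 k (lexx 0)) subr0 addr0.
    rewrite [h%:A]mulr1 (flatM k) /GRing.scale /= mulrCA mulVf ?mulr1//.
    by near: h; exact: nbhs_dnbhs_neq.
  apply: DeriveDef; first by apply/cvg_ex; exists 0.
  exact: cvg_lim fl.
Unshelve. all: by end_near. Qed.
End flat.

Section smooth.
Context {R : realType} {N : nat}.
Local Notation V := 'rV[R]_N.
Local Notation e_ i := (delta_mx ord0 i : V).

(* Closed under partial derivatives, hence equivalent to [smooth]; smoothness of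
   an expression then follows from its shape. *)
Inductive smooth_fun : (V -> R) -> Prop :=
| SmoothFun f : smooth f -> smooth_fun f
| smooth_cst c : smooth_fun (fun=> c)
| smooth_coord i : smooth_fun (fun x => x ord0 i)
| smoothD f g : smooth_fun f -> smooth_fun g ->
    smooth_fun (fun x => f x + g x)
| smoothM f g : smooth_fun f -> smooth_fun g ->
    smooth_fun (fun x => f x * g x)
| smoothV f : smooth_fun f -> (forall x, f x != 0) ->
    smooth_fun (fun x => (f x)^-1)
| smooth_flat k f : smooth_fun f -> smooth_fun (fun x => flat k (f x)).

Lemma is_derive_smooth (f : V -> R) i x : smooth f ->
  is_derive x (e_ i) f (partial i f x).
Proof. by move=> sf; have [_ /(_ i x) d] := sf [::]; exact: derivableP. Qed.

Lemma smooth_partial (f : V -> R) i : smooth f -> smooth (partial i f).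
Proof.
move=> sf s; have := sf (rcons s i); by rewrite /partials foldr_rcons.
Qed.

Lemma is_derive_coord i j (x : V) :
  is_derive x (e_ i) (fun x => x ord0 j) (i == j)%:R.
Proof.
have h : (fun h : R => h^-1 *: (((fun x : V => x ord0 j) \o shift x) (h *: e_ i)
    - x ord0 j)) @ 0^' --> ((i == j)%:R : R).
  apply: cvg_near_cst; near=> h.
  rewrite /= !mxE addrK eqxx /= eq_sym /GRing.scale /= mulKf//.
  by near: h; exact: nbhs_dnbhs_neq.
apply: DeriveDef; first by apply/cvg_ex; exists (i == j)%:R.
exact: cvg_lim h.
Unshelve. all: by end_near. Qed.

(** Only directional derivatives are at hand, so the chain rule is reduced to one variable by
    restriction to the line [h *: v + x]. *)
Lemma is_derive_comp1 (g : R -> R) (f : V -> R) x v a b :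
  is_derive x v f a -> is_derive (f x) 1 g b ->
  is_derive x v (fun y => g (f y)) (b * a).
Proof.
move=> [df <-] dg.
have E (F : V -> R) : (fun h => h^-1 *: ((F \o shift x) (h *: v) - F x)) =
  (fun h => h^-1 *: (((fun h : R => F (h *: v + x)) \o shift 0) (h *: (1 : R)) - F (0 *: v + x))).
  by apply/funext => h; rewrite /= addr0 scale0r add0r [h *: 1]mulr1.
have dL : is_derive (0 : R) (1 : R) (fun h : R => f (h *: v + x)) ('D_v f x).
  apply: DeriveDef; first exact: (derivable1P f x v).1.
  by rewrite /derive (E f).
have dg' : is_derive (f (0 *: v + x)) 1 g b by rewrite scale0r add0r.
have [dc dcE] := @is_derive1_comp R g (fun h : R => f (h *: v + x)) 0 _ _ dg' dL.
apply: DeriveDef; first exact: (derivable1P _ x v).2 dc.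
by rewrite -dcE /derive (E (fun y => g (f y))).
Qed.

(** Differentiating once stays inside the inductive class, and [smooth_funP] iterates this. The
    derivatives are exhibited as [df] because membership is read off their expression. *)
Lemma smooth_fun_step f : smooth_fun f -> continuous f /\
  exists df : 'I_N -> V -> R, forall i, smooth_fun (df i) /\
    forall x, is_derive x (e_ i) f (df i x).
Proof.
elim=> {f} [f sf|c|j|f g ef [cf [df dfP]] eg [cg [dg dgP]]
  |f g ef [cf [df dfP]] eg [cg [dg dgP]]|f ef [cf [df dfP]] f0|k f ef [cf [df dfP]]].
- split; first by have [] := sf [::].
  exists (fun i => partial i f) => i; split.
    exact/SmoothFun/smooth_partial.
  by move=> x; exact: is_derive_smooth.
- split; first exact: cst_continuous.
  exists (fun=> fun=> 0) => i; split; first exact: smooth_cst.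
  by move=> x; exact: is_derive_cst.
- split; first exact: coord_continuous.
  exists (fun i => fun=> (i == j)%:R) => i; split; first exact: smooth_cst.
  by move=> x; exact: is_derive_coord.
- split; first by move=> x; exact: (cvgD (cf x) (cg x)).
  exists (fun i x => df i x + dg i x) => i.
  have [? ?] := dfP i; have [? ?] := dgP i.
  by split; [exact: smoothD|move=> x; exact: is_deriveD].
- split; first by move=> x; exact: (cvgM (cf x) (cg x)).
  exists (fun i x => f x * dg i x + g x * df i x) => i.
  have [? ?] := dfP i; have [? ?] := dgP i.
  split; first by apply: smoothD; exact: smoothM.
  by move=> x; exact: is_deriveM.
- split; first by move=> x; exact: (cvgV (f0 x) (cf x)).
  exists (fun i x => -1 * (((f x)^-1 * (f x)^-1) * df i x)) => i.
  have [? d] := dfP i.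
  split.
    by do 2?apply: smoothM => //; [exact: smooth_cst
       |apply: smoothM; exact: smoothV].
  move=> x; have [fx fE] := d x; apply: DeriveDef; first exact: derivableV.
  by rewrite deriveV// fE scaleNr mulN1r -invfM expr2.
- split.
    move=> x; apply: continuous_comp; first exact: cf.
    apply: differentiable_continuous; apply/derivable1_diffP.
    by have [] := is_derive_flat k (f x).
  exists (fun i x => (- k%:R * flat k.+1 (f x) + flat k.+2 (f x)) * df i x) => i.
  have [? d] := dfP i; split.
    apply: smoothM => //; apply: smoothD; last exact: smooth_flat.
    by apply: smoothM; [exact: smooth_cst|exact: smooth_flat].
  by move=> x; apply: is_derive_comp1 (d x) _; exact: is_derive_flat.
Qed.

Lemma smooth_funP f : smooth f <-> smooth_fun f.
Proof.
split; first exact: SmoothFun.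
(* [partials] applies the last index of the list first, hence the induction from the right with [f]
   generalized. *)
move=> ef s; elim/last_ind: s f ef => [|s i IH] f ef.
  have [cf [df dfP]] := smooth_fun_step ef; split => // i x.
  by have [_ /(_ x) []] := dfP i.
rewrite /partials foldr_rcons; apply: IH.
have [_ [df /(_ i) [edf dfP]]] := smooth_fun_step ef.
suff -> : partial i f = df i by [].
by apply/funext => x; have [_] := dfP x.
Qed.

Lemma smoothN (f : V -> R) : smooth_fun f -> smooth_fun (fun x => - f x).
Proof.
move=> sf; have := smoothM (smooth_cst (-1)) sf.
by under [X in smooth_fun X -> _]eq_fun do rewrite mulN1r.
Qed.

Lemma smoothB (f g : V -> R) :
  smooth_fun f -> smooth_fun g -> smooth_fun (fun x => f x - g x).
Proof. by move=> sf sg; apply: smoothD => //; exact: smoothN. Qed.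

Lemma smoothX m (f : V -> R) : smooth_fun f -> smooth_fun (fun x => f x ^+ m).
Proof.
move=> sf; elim: m => [|m IH]; first exact: smooth_cst.
by under [X in smooth_fun X]eq_fun do rewrite exprS; exact: smoothM.
Qed.

Lemma smooth_sum (I : Type) (r : seq I) (P : pred I) (f : I -> V -> R) :
  (forall i, smooth_fun (f i)) -> smooth_fun (fun x => \sum_(i <- r | P i) f i x).
Proof.
move=> sf; elim: r => [|i r IH].
  by under eq_fun do rewrite big_nil; exact: smooth_cst.
under eq_fun do rewrite big_cons.
by case: (P i) => //; exact: smoothD.
Qed.

Lemma smooth_prod (I : Type) (r : seq I) (P : pred I) (f : I -> V -> R) :
  (forall i, smooth_fun (f i)) -> smooth_fun (fun x => \prod_(i <- r | P i) f i x).
Proof.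
move=> sf; elim: r => [|i r IH].
  by under eq_fun do rewrite big_nil; exact: smooth_cst.
under eq_fun do rewrite big_cons.
by case: (P i) => //; exact: smoothM.
Qed.

Lemma smooth_continuous (f : V -> R) : smooth_fun f -> continuous f.
Proof. by move=> /smooth_fun_step []. Qed.

Lemma partialE i (f df : V -> R) :
  (forall x, is_derive x (e_ i) f (df x)) -> partial i f = df.
Proof. by move=> h; apply/funext => x; have [] := h x. Qed.

End smooth.

Section rV_norm.
Context {R : realType} {N : nat}.

Lemma ler_coord_norm (x : 'rV[R]_N) i : `|x ord0 i| <= `|x|.
Proof.
rewrite [leRHS]/Num.Def.normr/= mx_normrE.
by apply/bigmax_geP; right => /=; exists (ord0, i).
Qed.

Lemma rV_norm_le (x : 'rV[R]_N) r : 0 <= r ->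
  (`|x| <= r) <-> (forall i, `|x ord0 i| <= r).
Proof.
move=> r0; split=> [xr i|xr]; first exact: le_trans (ler_coord_norm _ _) xr.
rewrite [leLHS]/Num.Def.normr/= mx_normrE; apply/bigmax_leP; split => // -[i j] _ /=.
by rewrite ord1.
Qed.

End rV_norm.

Section test_functions_theory.
Context {R : realType} {N : nat}.
Local Notation V := 'rV[R]_N.
Variable Omega : set V.

Variant test_fun (f : V -> R) : Prop := TestFun of smooth_fun f &
  exists K, [/\ compact K, K `<=` Omega & supported_in K f].

Lemma test_funP f : test_function Omega f <-> test_fun f.
Proof.
split; first by move=> [sf hK]; split => //; exact/smooth_funP.
by move=> [sf hK]; split => //; exact/smooth_funP.
Qed.

Lemma test_funM (f g : V -> R) : test_fun f -> smooth_fun g ->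
  test_fun (fun x => f x * g x).
Proof.
move=> [sf [K [cK KO fK]]] sg; split; first exact: smoothM.
by exists K; split => // x Kx; rewrite fK// mul0r.
Qed.

Lemma test_funD (f g : V -> R) : test_fun f ->
  test_fun g -> test_fun (fun x => f x + g x).
Proof.
move=> [sf [K [cK KO fK]]] [sg [L [cL LO gL]]]; split; first exact: smoothD.
exists (K `|` L); split; first exact: compactU.
- by rewrite subUset.
- by move=> x /not_orP[? ?]; rewrite fK ?gL// addr0.
Qed.

Lemma test_funMl (f g : V -> R) : test_fun f -> smooth_fun g ->
  test_fun (fun x => g x * f x).
Proof.
by move=> tf sg; under eq_fun do rewrite mulrC; exact: test_funM.
Qed.

Lemma test_funN (f : V -> R) : test_fun f ->
  test_fun (fun x => - f x).
Proof.
move=> tf; under eq_fun do rewrite -mulN1r.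
by apply: test_funMl => //; exact: smooth_cst.
Qed.

Lemma test_fun0 : test_fun (fun=> 0).
Proof.
split; first exact: smooth_cst.
by exists set0; split => //; exact: compact0.
Qed.

End test_functions_theory.

Section linear_on_test_functions.
Context {R : realType} {N : nat} (Omega : set 'rV[R]_N).
Local Notation D := ('rV[R]_N -> R).
Local Notation test := (test_fun Omega).
Local Notation Re := complex.Re.
Local Notation Im := complex.Im.

Definition linear_on_test (L : D -> R[i]) := forall (a : R) (f g : D),
  test f -> test g -> L (fun x => a * f x + g x) = (a%:C)%C * L f + L g.

Variables (L : D -> R[i]) (linL : linear_on_test L).

Lemma linear_on_testD f g : test f -> test g ->
  L (fun x => f x + g x) = L f + L g.
Proof.
move=> tf tg; rewrite -[L f]mul1r -linL//; congr L.
by apply/funext => x; rewrite mul1r.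
Qed.

Lemma linear_on_test0 : L (fun=> 0) = 0.
Proof.
have := linear_on_testD (test_fun0 Omega) (test_fun0 Omega).
under eq_fun do rewrite addr0.
by move/eqP; rewrite -subr_eq0 opprD addNKr oppr_eq0 => /eqP.
Qed.

Lemma linear_on_testZ a f : test f -> L (fun x => a * f x) = (a%:C)%C * L f.
Proof.
move=> tf; rewrite -[RHS]addr0 -[X in _ = _ + X]linear_on_test0 -linL//.
  by congr L; apply/funext => x; rewrite addr0.
exact: test_fun0.
Qed.

Lemma linear_on_testN f : test f -> L (fun x => - f x) = - L f.
Proof.
move=> tf; rewrite -mulN1r (_ : -1 = (-1)%:C%C); last by rewrite rmorphN1.
by rewrite -linear_on_testZ//; congr L; apply/funext => x; rewrite mulN1r.
Qed.

Definition complex_test (F : 'rV[R]_N -> R[i]) :=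
  test (fun x => Re (F x)) /\ test (fun x => Im (F x)).

(** The C-linear extension of [L]: currents are paired with real test functions, whereas Lelong's
    identity produces the complex functions z_l conj(z_k) kappa. *)
Definition complex_ext (F : 'rV[R]_N -> R[i]) : R[i] :=
  L (fun x => Re (F x)) + 'i%C * L (fun x => Im (F x)).

Lemma complex_extD F G : complex_test F -> complex_test G ->
  complex_ext (fun x => F x + G x) = complex_ext F + complex_ext G.
Proof.
move=> [rF iF] [rG iG]; rewrite /complex_ext.
under [X in L X + _]eq_fun do rewrite raddfD.
under [X in _ + _ * L X]eq_fun do rewrite raddfD.
rewrite !linear_on_testD// mulrDr; ring.
Qed.

Lemma complex_extZ c F : complex_test F ->
  complex_ext (fun x => c * F x) = c * complex_ext F.
Proof.
move=> [rF iF]; rewrite /complex_ext.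
have ReM (z w : R[i]) : Re (z * w) = Re z * Re w + - Im z * Im w.
  by case: z => a b; case: w => a' b' /=; rewrite mulNr.
have ImM (z w : R[i]) : Im (z * w) = Re z * Im w + Im z * Re w.
  by case: z => a b; case: w => a' b' /=.
under [X in L X + _]eq_fun do rewrite ReM.
under [X in _ + _ * L X]eq_fun do rewrite ImM.
have t a f : test f -> test (fun x => a * f x).
  by move=> tf; apply: test_funMl => //; exact: smooth_cst.
rewrite !linear_on_testD; [|exact: t..].
rewrite !linear_on_testZ// [c in RHS]complexE rmorphN.
have := sqr_i R; rewrite expr2 => ii.
rewrite -[_ (Im c)]/(Im c)%:C%C; set p := (Re c)%:C%C; set q := (Im c)%:C%C.
by ring: ii.
Qed.

Lemma complex_ext_real f : test f -> complex_ext (fun x => (f x)%:C%C) = L f.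
Proof.
by move=> tf; rewrite /complex_ext/= linear_on_test0 mulr0 addr0.
Qed.

End linear_on_test_functions.

(** * Positive forms with affine coefficients *)

Lemma conjcM (R : realType) (z w : R[i]) : (z * w)^*%C = z^*%C * w^*%C.
Proof. exact: rmorphM. Qed.

Lemma conjcD (R : realType) (z w : R[i]) : (z + w)^*%C = z^*%C + w^*%C.
Proof. exact: rmorphD. Qed.

Lemma realcM (R : realType) (x y : R) : (x * y)%:C%C = x%:C%C * y%:C%C.
Proof. exact: rmorphM. Qed.

Lemma realcB (R : realType) (x y : R) : (x - y)%:C%C = x%:C%C - y%:C%C.
Proof. exact: rmorphB. Qed.

Lemma realcN (R : realType) (x : R) : (- x)%:C%C = - x%:C%C.
Proof. exact: rmorphN. Qed.

Lemma realc_nat (R : realType) m : (m%:R : R)%:C%C = m%:R.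
Proof. exact: rmorph_nat. Qed.

Lemma realc1 (R : realType) : (1 : R)%:C%C = 1. Proof. by []. Qed.

Section positivity.
Context {R : realType} {n : nat} (Omega : set 'rV[R]_(n + n)).
Local Notation V := 'rV[R]_(n + n).
Local Notation test := (test_fun Omega).
Local Notation Re := complex.Re.
Local Notation Im := complex.Im.

Variable T : @current11 R n.
Hypothesis linT : forall j k, linear_on_test Omega (T j k).
Hypothesis posT : positive_current Omega T.

(** The pairing of sum c_j conj(c_k) T_jk with [f] for nonconstant [c], the coefficients being moved
    onto the test function; [positive_current] speaks of constant [c] only. *)
Definition hermitian (c : 'I_n -> V -> R[i]) (f : V -> R) : R[i] :=
  \sum_j \sum_k complex_ext (T j k)
    (fun x => c j x * (c k x)^*%C * (f x)%:C%C).

Definition complex_smooth (c : V -> R[i]) :=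
  smooth_fun (fun x => Re (c x)) /\ smooth_fun (fun x => Im (c x)).

Lemma complex_smooth_cst c : complex_smooth (fun=> c).
Proof. by split; exact: smooth_cst. Qed.

Lemma complex_smooth_real f : smooth_fun f -> complex_smooth (fun x => (f x)%:C%C).
Proof. by move=> sf; split => //; exact: smooth_cst. Qed.

Lemma complex_smoothD c d : complex_smooth c -> complex_smooth d ->
  complex_smooth (fun x => c x + d x).
Proof.
move=> [rc ic] [rd jd]; split.
  by under eq_fun do rewrite raddfD; exact: smoothD.
by under eq_fun do rewrite raddfD; exact: smoothD.
Qed.

Lemma complex_smoothM c d : complex_smooth c -> complex_smooth d ->
  complex_smooth (fun x => c x * d x).
Proof.
move=> [rc ic] [rd jd]; split.
  rewrite (_ : (fun x => _) = (fun x => Re (c x) * Re (d x) - Im (c x) * Im (d x))).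
    by apply: smoothB; exact: smoothM.
  by apply/funext => x; case: (c x) => ? ?; case: (d x).
rewrite (_ : (fun x => _) = (fun x => Re (c x) * Im (d x) + Im (c x) * Re (d x))).
  by apply: smoothD; exact: smoothM.
by apply/funext => x; case: (c x) => ? ?; case: (d x).
Qed.

Lemma complex_testM c f : complex_smooth c -> test f ->
  complex_test Omega (fun x => c x * (f x)%:C%C).
Proof.
move=> [rc ic] tf; split.
  rewrite (_ : (fun x => _) = (fun x => Re (c x) * f x)).
    exact: test_funMl.
  by apply/funext => x; case: (c x) => ? ? /=; rewrite mulr0 subr0.
rewrite (_ : (fun x => _) = (fun x => Im (c x) * f x)).
  exact: test_funMl.
by apply/funext => x; case: (c x) => ? ? /=; rewrite mulr0 add0r.
Qed.

Lemma complex_smoothJ c : complex_smooth c -> complex_smooth (fun x => (c x)^*%C).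
Proof.
move=> [rc ic]; split.
  rewrite (_ : (fun x => _) = (fun x => Re (c x)))//.
  by apply/funext => x; case: (c x).
rewrite (_ : (fun x => _) = (fun x => - Im (c x))); first exact: smoothN.
by apply/funext => x; case: (c x).
Qed.

Lemma hermitian_test (c : 'I_n -> V -> R[i]) f (j k : 'I_n) :
  (forall j, complex_smooth (c j)) -> test f ->
  complex_test Omega (fun x => c j x * (c k x)^*%C * (f x)%:C%C).
Proof.
move=> sc tf; apply: complex_testM => //.
by apply: complex_smoothM => //; exact: complex_smoothJ.
Qed.

Lemma hermitianZ a (c : 'I_n -> V -> R[i]) f : (forall j, complex_smooth (c j)) -> test f ->
  hermitian (fun j x => a%:C%C * c j x) f = (a%:C%C) ^+ 2 * hermitian c f.
Proof.
move=> sc tf; rewrite /hermitian mulr_sumr; apply: eq_bigr => j _.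
rewrite mulr_sumr; apply: eq_bigr => k _.
rewrite -(complex_extZ (linT j k)); last exact: hermitian_test.
congr complex_ext; apply/funext => x; rewrite conjcM conjc_real; ring.
Qed.

Lemma hermitian_ge0 (c : 'I_n -> R[i]) f : test f -> (forall x, 0 <= f x) ->
  0 <= Re (hermitian (fun j _ => c j) f).
Proof.
move=> tf f0; have /(_ f0) := posT c ((test_funP _ _).2 tf).
rewrite lecE => /andP[_]; congr (_ <= Re _).
apply: eq_bigr => j _; apply: eq_bigr => k _.
rewrite (complex_extZ (linT j k)) ?(complex_ext_real (linT j k) tf)//.
by split => //; exact: test_fun0.
Qed.

(* With [A] the old coefficients, [t |A + b|^2 + (1 - t) |A|^2 =
   |A + t b|^2 + t (1 - t) |b|^2]. *)
Lemma hermitian_split (A : 'I_n -> V -> R[i]) (b : 'I_n -> R[i]) (t f : V -> R) :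
  (forall j, complex_smooth (A j)) -> smooth_fun t -> test f ->
  hermitian (fun j x => A j x + b j) (fun x => f x * t x) +
  hermitian A (fun x => f x * (1 - t x)) =
  hermitian (fun j x => A j x + b j * (t x)%:C%C) f +
  hermitian (fun j _ => b j) (fun x => f x * (t x * (1 - t x))).
Proof.
move=> sA st tf; rewrite /hermitian -!big_split; apply: eq_bigr => j _.
rewrite -!big_split; apply: eq_bigr => k _ /=.
have s1t : smooth_fun (fun x => 1 - t x) by apply: smoothB => //; exact: smooth_cst.
have sb i : complex_smooth (fun=> b i) by exact: complex_smooth_cst.
have h1 := @hermitian_test (fun j x => A j x + b j) (fun x => f x * t x) j k
  (fun j => complex_smoothD (sA j) (sb j)) (test_funM tf st).
have h2 := @hermitian_test A (fun x => f x * (1 - t x)) j k sA (test_funM tf s1t).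
have h3 := @hermitian_test (fun j x => A j x + b j * (t x)%:C%C) f j k
  (fun j => complex_smoothD (sA j) (complex_smoothM (sb j) (complex_smooth_real st))) tf.
have h4 := @hermitian_test (fun j _ => b j) _ j k sb (test_funM tf (smoothM st s1t)).
rewrite -!(complex_extD (linT j k))//; congr complex_ext; apply/funext => x.
rewrite !conjcD !conjcM !realcM realcB realc1 conjc_real; ring.
Qed.

(* Stability under the constants [g] is what makes the induction on the affine
   terms work: [g] absorbs the translation that puts a coordinate in [0, 1]. *)
Definition weakly_positive (c : 'I_n -> V -> R[i]) :=
  (forall j, complex_smooth (c j)) /\
  forall (g : 'I_n -> R[i]) f, test f -> (forall x, 0 <= f x) ->
    0 <= Re (hermitian (fun j x => c j x + g j) f).

(* Induction on [m]: apply the hypothesis to [f * t] and [f * (1 - t)], whose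
   coefficients differ by [b], and recombine with [hermitian_split]. *)
Lemma hermitian_binomial c (b : 'I_n -> R[i]) (t : V -> R) m :
  weakly_positive c -> smooth_fun t -> forall (g : 'I_n -> R[i]) f, test f ->
  (forall x, 0 <= f x) -> (forall x, f x != 0 -> 0 <= t x <= 1) ->
  0 <= Re (hermitian (fun j x => c j x + g j + m%:R * b j * (t x)%:C%C) f) +
    m%:R * Re (hermitian (fun j _ => b j) (fun x => f x * (t x * (1 - t x)))).
Proof.
move=> [sc pc] st; elim: m => [|m IH] g f tf f0 ft.
  rewrite mul0r addr0; rewrite [X in hermitian X](_ : _ = (fun j x => c j x + g j)).
    exact: pc.
  by apply/funext => j; apply/funext => x; rewrite !mul0r addr0.
have s1t : smooth_fun (fun x => 1 - t x) by apply: smoothB => //; exact: smooth_cst.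
have sb i : complex_smooth (fun=> b i) by exact: complex_smooth_cst.
have tf1 := test_funM tf st; have tf2 := test_funM tf s1t.
have tft x : f x = 0 \/ 0 <= t x <= 1.
  by have [|/ft] := eqVneq (f x) 0; [left|right].
have {}IH1 := IH (fun j => g j + b j) _ tf1.
have {}IH2 := IH g _ tf2.
have h1 : 0 <= Re (hermitian (fun j x => c j x + (g j + b j) +
    m%:R * b j * (t x)%:C%C) (fun x => f x * t x)) +
    m%:R * Re (hermitian (fun j _ => b j) (fun x => f x * t x * (t x * (1 - t x)))).
  apply: IH1 => x.
    by case: (tft x) => [->|/andP[? _]]; rewrite ?mul0r// mulr_ge0.
  by rewrite mulf_eq0 negb_or => /andP[/ft].
have h2 : 0 <= Re (hermitian (fun j x => c j x + g j +
    m%:R * b j * (t x)%:C%C) (fun x => f x * (1 - t x))) +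
    m%:R * Re (hermitian (fun j _ => b j) (fun x => f x * (1 - t x) * (t x * (1 - t x)))).
  apply: IH2 => x.
    by case: (tft x) => [->|/andP[_ ?]]; rewrite ?mul0r// mulr_ge0// subr_ge0.
  by rewrite mulf_eq0 negb_or => /andP[/ft].
have := addr_ge0 h1 h2; rewrite addrACA -mulrDr -!raddfD.
set A := fun j x => c j x + g j + m%:R * b j * (t x)%:C%C.
have sA j : complex_smooth (A j).
  apply: complex_smoothD; first by apply: complex_smoothD => //; exact: complex_smooth_cst.
  by apply: complex_smoothM; [exact: complex_smooth_cst|exact: complex_smooth_real].
rewrite [X in hermitian X _ + hermitian A _](_ : _ = fun j x => A j x + b j); last first.
  by apply/funext => j; apply/funext => x; rewrite /A; ring.
rewrite (hermitian_split b sA st tf)//.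
(* The weights [t] and [1 - t] add up to 1, so the error terms of the two induction hypotheses merge
   into one; [hermitian_split] adds one more, which makes [m.+1]. *)
have -> : hermitian (fun j _ => b j) (fun x => f x * t x * (t x * (1 - t x))) +
    hermitian (fun j _ => b j) (fun x => f x * (1 - t x) * (t x * (1 - t x))) =
    hermitian (fun j _ => b j) (fun x => f x * (t x * (1 - t x))).
  rewrite /hermitian -!big_split; apply: eq_bigr => j _.
  rewrite -!big_split; apply: eq_bigr => k _ /=.
  have u1 := @hermitian_test (fun j _ => b j) _ j k sb (test_funM tf1 (smoothM st s1t)).
  have u2 := @hermitian_test (fun j _ => b j) _ j k sb (test_funM tf2 (smoothM st s1t)).
  rewrite -!(complex_extD (linT j k))//; congr complex_ext; apply/funext => x.
  by rewrite !realcM realcB realc1; ring.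
rewrite raddfD -addrA -[X in _ + (X + _)]mul1r -mulrDl -natr1 addrC [1 + _]addrC.
rewrite addrC; congr (_ <= Re (hermitian _ _) + _).
by apply/funext => j; apply/funext => x; rewrite /A; ring.
by rewrite natr1.
Qed.

(* With [b / m] in place of [b], the error term of [hermitian_binomial] is
   [O(1 / m)]. *)
Lemma weakly_positive_coord c (b : 'I_n -> R[i]) (a : 'I_(n + n)) :
  weakly_positive c -> weakly_positive (fun j x => c j x + b j * (x ord0 a)%:C%C).
Proof.
move=> pc; have [sc _] := pc; split.
  move=> j; apply: complex_smoothD => //; apply: complex_smoothM.
    exact: complex_smooth_cst.
  exact/complex_smooth_real/smooth_coord.
move=> g f tf f0; have [sf [K [cK KO fK]]] := tf.
have [M M0 HM] : exists2 M : R, 0 < M & forall x, K x -> `|x| <= M.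
  have [M [Mr HM]] := compact_bounded cK.
  exists (`|M| + 1) => [|x Kx]; first by rewrite ltr_wpDl.
  by apply: HM => //; rewrite (le_lt_trans (ler_norm _))// ltrDl.
(* Sends the coordinate [a] affinely into [0, 1] over the support of [f]. The translation is
   absorbed by [g'], the length [2 * M] by [b']. *)
pose t (x : V) := (x ord0 a + M) / (2 * M).
have st : smooth_fun t.
  apply: smoothM; last exact: smooth_cst.
  by apply: smoothD; [exact: smooth_coord|exact: smooth_cst].
have ft x : f x != 0 -> 0 <= t x <= 1.
  move=> fx0; have Kx : K x by apply: contrapT => /fK fx; rewrite fx eqxx in fx0.
  have : `|x ord0 a| <= M.
    exact: le_trans (ler_coord_norm _ _) (HM _ Kx).
  rewrite ler_norml => /andP[h1 h2].
  rewrite /t divr_ge0 ?ler_pdivrMr ?mulr_gt0//; last 2 first.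
    by rewrite -lerBlDr sub0r.
    by rewrite mulr_ge0// ltW.
  by rewrite /= mul1r mulr2n mulrDl !mul1r lerD2r.
pose q x := f x * (t x * (1 - t x)).
pose g' j := g j - b j * M%:C%C.
pose b' (m : nat) j := (2 * M / m%:R)%:C%C * b j.
pose P := Re (hermitian (fun j x => c j x + b j * (x ord0 a)%:C%C + g j) f).
pose Q := (2 * M) ^+ 2 * Re (hermitian (fun j _ => b j) q).
have tq : test q.
  apply: test_funM => //; apply: smoothM => //.
  by apply: smoothB => //; exact: smooth_cst.
(* [m.+1] steps of size [b' m.+1] restore the coefficient [b], while the error, quadratic in the
   step, adds up to [Q / m.+1]. *)
have key m : 0 <= P + Q / m.+1%:R.
  have := hermitian_binomial (b' m.+1) m.+1 pc st g' tf f0 ft.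
  congr (_ <= _ + _).
    rewrite /P; congr (Re (hermitian _ _)).
    apply/funext => j; apply/funext => x; rewrite /g' /b' /t.
    have m0 : m.+1%:R != 0 :> R by rewrite pnatr_eq0.
    have -> : m.+1%:R * ((2 * M / m.+1%:R)%:C%C * b j) * ((x ord0 a + M) / (2 * M))%:C%C
      = b j * ((2 * M / m.+1%:R) * m.+1%:R * ((x ord0 a + M) / (2 * M)))%:C%C.
      by rewrite !realcM realc_nat; ring.
    have -> : (2 * M / m.+1%:R) * m.+1%:R * ((x ord0 a + M) / (2 * M)) = x ord0 a + M.
      by field; rewrite ?m0 ?gt_eqF.
    have -> : (x ord0 a + M)%:C%C = (x ord0 a)%:C%C + M%:C%C by exact: rmorphD.
    by ring.
  rewrite (@hermitianZ _ (fun j _ => b j))//; last by move=> j; exact: complex_smooth_cst.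
  rewrite /Q -/q; case: hermitian => u v /=.
  have m0 : m.+1%:R != 0 :> R by rewrite pnatr_eq0.
  by rewrite !mul0r !mulr0 !subr0; field.
rewrite -/P leNgt; apply/negP => P0.
have Q0 : 0 < Q.
  by have := key 0; rewrite divr1 => ?; rewrite -(ltrD2l P) addr0 (lt_le_trans P0).
have P0' : 0 < - P by rewrite oppr_gt0.
have := archi_boundP (ltW (divr_gt0 Q0 P0')); set m := Num.bound _ => hm.
have := key m; apply/negP; rewrite -ltNge.
rewrite -ltrBrDl sub0r ltr_pdivrMr// -ltr_pdivrMl// mulrC (lt_trans hm)//.
by rewrite ltr_nat.
Qed.

Lemma weakly_positive_cst (c : 'I_n -> R[i]) : weakly_positive (fun j _ => c j).
Proof.
split=> [j|g f tf f0]; first exact: complex_smooth_cst.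
exact: (hermitian_ge0 (fun j => c j + g j)).
Qed.

Lemma weakly_positive_affine (s : seq 'I_(n + n)) (b : 'I_(n + n) -> 'I_n -> R[i])
    (c : 'I_n -> R[i]) :
  weakly_positive (fun j x => c j + \sum_(a <- s) b a j * (x ord0 a)%:C%C).
Proof.
elim: s => [|a s IH].
  under [X in weakly_positive X]eq_fun do under eq_fun do rewrite big_nil addr0.
  exact: weakly_positive_cst.
rewrite [X in weakly_positive X](_ : _ = (fun j (x : V) =>
  (c j + \sum_(a <- s) b a j * (x ord0 a)%:C%C) + b a j * (x ord0 a)%:C%C)).
  exact: weakly_positive_coord.
by apply/funext => j; apply/funext => x; rewrite big_cons addrAC addrA.
Qed.

Definition zcoord (a : V) (j : 'I_n) (x : V) : R[i] :=
  ((x ord0 (xi j) - a ord0 (xi j)) +i* (x ord0 (yi j) - a ord0 (yi j)))%C.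

(** The coordinates z_j - a_j are affine in the 2n real coordinates; the centre [a] enters through
    the constants [g] of [weakly_positive]. *)
Lemma hermitian_zcoord_ge0 a f : test f -> (forall x, 0 <= f x) ->
  0 <= Re (hermitian (zcoord a) f).
Proof.
move=> tf f0.
pose b (i : 'I_(n + n)) (j : 'I_n) : R[i] :=
  (i == xi j)%:R + 'i%C * (i == yi j)%:R.
have [_ /(_ (fun j => - zcoord 0 j a))] := weakly_positive_affine (index_enum _) b (fun=> 0).
move=> /(_ _ tf f0); congr (_ <= Re (hermitian _ _)).
apply/funext => j; apply/funext => x; rewrite add0r.
have -> : \sum_(i <- index_enum 'I_(n + n)) b i j * (x ord0 i)%:C%C =
    (x ord0 (xi j) +i* x ord0 (yi j))%C.
  rewrite /b; under eq_bigr do rewrite mulrDl.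
  rewrite big_split/= (bigD1 (xi j))//= eqxx mul1r big1 ?addr0; last first.
    by move=> i /negPf ->; rewrite mul0r.
  rewrite (bigD1 (yi j))//= eqxx mulr1 big1 ?addr0; last first.
    by move=> i /negPf ->; rewrite mulr0 mul0r.
  by simpc.
by rewrite /zcoord !mxE !subr0; simpc.
Qed.

End positivity.

(** * Lelong's inequality and the Morrey estimate *)

(** The first equation plus i times the second, that is, closedness tested against z_l chi, for
    which d(z_l chi)/dz_l = chi - |z_l|^2 kappa. Here [d] is a Kronecker delta, and [p], [q] are the
    values of T_kk and T_lk at chi. *)
Lemma lelong_algebra (R : realType) (p q d xx xy yy A B C D : R[i]) :
  - (p - 2 * xx - 'i%C * - (2 * xy)) / 2 = - (d * q - 2 * A - 'i%C * - (2 * B)) / 2 ->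
  - (- (2 * xy) - 'i%C * (p - 2 * yy)) / 2 = - (- (2 * C) - 'i%C * (d * q - 2 * D)) / 2 ->
  p - (xx + yy) = d * q - (A + D + 'i%C * (C - B)).
Proof.
have ii : 'i%C * 'i%C = -1 :> R[i] by rewrite -expr2 sqr_i.
have n2 : (2 : R[i]) != 0 by rewrite pnatr_eq0.
move=> /(mulIf (invr_neq0 n2)) e1 /(mulIf (invr_neq0 n2)) e2.
apply: (mulfI n2).
transitivity (- (- (p - 2 * xx - 'i%C * - (2 * xy)) +
  'i%C * (- (- (2 * xy) - 'i%C * (p - 2 * yy))))); first by ring: ii.
by rewrite e1 e2; ring: ii.
Qed.

Lemma linear_on_test_sum (R : realType) N (Omega : set 'rV[R]_N)
    (L : ('rV[R]_N -> R) -> R[i]) (I : Type) (s : seq I) (f : I -> 'rV[R]_N -> R) :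
  linear_on_test Omega L -> (forall i, test_fun Omega (f i)) ->
  L (fun x => \sum_(i <- s) f i x) = \sum_(i <- s) L (f i).
Proof.
move=> linL tf.
suff [] : L (fun x => \sum_(i <- s) f i x) = \sum_(i <- s) L (f i) /\
  test_fun Omega (fun x => \sum_(i <- s) f i x) by [].
elim: s => [|i s [IH tIH]].
  rewrite big_nil -[RHS](linear_on_test0 linL).
  under eq_fun do rewrite big_nil.
  by split => //; exact: test_fun0.
rewrite big_cons; under eq_fun do rewrite big_cons.
rewrite (linear_on_testD linL (tf i) tIH) IH; split => //.
exact: test_funD.
Qed.

Section lelong.
Context {R : realType} {n : nat} (Omega : set 'rV[R]_(n + n)).
Local Notation V := 'rV[R]_(n + n).
Local Notation test := (test_fun Omega).
Local Notation Re := complex.Re.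
Local Notation Im := complex.Im.
Local Notation e_ i := (delta_mx ord0 i : V).

Definition sqdist (a x : V) : R := \sum_i (x ord0 i - a ord0 i) ^+ 2.

Variable T : @current11 R n.
Hypothesis linT : forall j k, linear_on_test Omega (T j k).
Hypothesis posT : positive_current Omega T.
Hypothesis closedT : closed_current Omega T.

Definition trace_current (f : V -> R) : R[i] := \sum_k T k k f.

Variables (a : V) (chi kappa : V -> R).
Hypotheses (tchi : test chi) (tkappa : test kappa).
Hypothesis kappa_ge0 : forall x, 0 <= kappa x.
Hypothesis dchi : forall i x,
  is_derive x (e_ i) chi (-2 * (x ord0 i - a ord0 i) * kappa x).

Let X (i : 'I_(n + n)) (x : V) : R := x ord0 i - a ord0 i.

Let smooth_X i : smooth_fun (X i).
Proof. by apply: smoothB; [exact: smooth_coord|exact: smooth_cst]. Qed.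

Let testX i : test (fun x => X i x * chi x).
Proof. exact: test_funMl. Qed.

Let test2 i l : test (fun x => X i x * X l x * kappa x).
Proof. by apply: test_funMl => //; exact: smoothM. Qed.

Let partialX i l : partial i (fun x => X l x * chi x) =
  fun x => (i == l)%:R * chi x + -2 * (X l x * X i x * kappa x).
Proof.
apply: partialE => x.
have dX : is_derive x (e_ i) (X l) (i == l)%:R.
  rewrite -[X in is_derive _ _ _ X]subr0.
  apply: (@is_deriveB _ _ _ (fun x : V => x ord0 l) (cst (a ord0 l))).
  exact: is_derive_coord.
have d := is_deriveM dX (dchi i x).
by apply: (is_derive_eq d); rewrite /GRing.scale /= -/(X i x); ring.
Qed.

Let TX j k i l : T j k (partial i (fun x => X l x * chi x)) =
  (i == l)%:R * T j k chi - 2 * T j k (fun x => X l x * X i x * kappa x).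
Proof.
rewrite partialX linT//; last first.
  by apply: test_funMl => //; exact: smooth_cst.
rewrite (linear_on_testZ (linT j k))// realc_nat; congr (_ + _).
by rewrite realcN realc_nat mulNr.
Qed.

(* Closedness of [T] tested against [X_l chi] and [Y_l chi]. *)
Lemma lelong_identity l k :
  T k k chi - T k k (fun x => (X (xi l) x ^+ 2 + X (yi l) x ^+ 2) * kappa x) =
  (k == l)%:R * T l k chi -
  complex_ext (T l k) (fun x => zcoord a l x * (zcoord a k x)^*%C * (kappa x)%:C%C).
Proof.
have [cx _] := closedT k k l ((test_funP _ _).2 (testX (xi l))).
have [cy _] := closedT k k l ((test_funP _ _).2 (testX (yi l))).
move: cx cy; rewrite /dz !TX => cx cy.
have xx i j : (xi i == xi j :> 'I_(n + n)) = (i == j) by exact: (inj_eq (@lshift_inj _ _)).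
have yy i j : (yi i == yi j :> 'I_(n + n)) = (i == j) by exact: (inj_eq (@rshift_inj _ _)).
have xy i j : (xi i == yi j :> 'I_(n + n)) = false by exact: eq_lrshift.
have yx i j : (yi i == xi j :> 'I_(n + n)) = false by exact: eq_rlshift.
rewrite !(xx, yy, xy, yx) !eqxx !mul0r !mul1r !sub0r in cx cy.
have -> : T k k (fun x => (X (xi l) x ^+ 2 + X (yi l) x ^+ 2) * kappa x) =
    T k k (fun x => X (xi l) x * X (xi l) x * kappa x) +
    T k k (fun x => X (yi l) x * X (yi l) x * kappa x).
  rewrite -(linear_on_testD (linT k k))//; congr (T _ _ _).
  by apply/funext => x; rewrite mulrDl.
have -> : complex_ext (T l k) (fun x => zcoord a l x * (zcoord a k x)^*%C * (kappa x)%:C%C) =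
    T l k (fun x => X (xi l) x * X (xi k) x * kappa x) +
    T l k (fun x => X (yi l) x * X (yi k) x * kappa x) +
    'i%C * (T l k (fun x => X (yi l) x * X (xi k) x * kappa x) -
      T l k (fun x => X (xi l) x * X (yi k) x * kappa x)).
  rewrite -(linear_on_testN (linT l k))// -!(linear_on_testD (linT l k))//; last first.
    exact: test_funN.
  rewrite /complex_ext; congr (T _ _ _ + _ * T _ _ _).
    by apply/funext => x; rewrite /zcoord -!/(X _ _) /=; ring.
  by apply/funext => x; rewrite /zcoord -!/(X _ _) /=; ring.
have := sqr_i R; rewrite expr2 => ii.
have C : T k k (fun x => X (yi l) x * X (xi l) x * kappa x) =
    T k k (fun x => X (xi l) x * X (yi l) x * kappa x).
  by congr (T _ _ _); apply/funext => x; rewrite [X _ x * X _ x]mulrC.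
rewrite C in cy; exact: lelong_algebra cx cy.
Qed.

(** Summing [lelong_identity] over l and k, the last terms form [hermitian T (zcoord a) kappa],
    which is nonnegative. If chi is a function of rho = |z - a|, then |z - a|^2 kappa is -rho/2
    times its radial derivative: this is the weak form of the monotonicity of rho^(2-2n) times the
    trace mass of the ball of radius rho. *)
Lemma lelong : n%:R * Re (trace_current chi) <= Re (trace_current chi) +
  Re (trace_current (fun x => sqdist a x * kappa x)).
Proof.
have : \sum_l \sum_k (T k k chi - T k k (fun x => (X (xi l) x ^+ 2 + X (yi l) x ^+ 2) * kappa x)) =
    \sum_l \sum_k ((k == l)%:R * T l k chi - complex_ext (T l k)
      (fun x => zcoord a l x * (zcoord a k x)^*%C * (kappa x)%:C%C)).
  by apply: eq_bigr => l _; apply: eq_bigr => k _; exact: lelong_identity.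
have -> : \sum_l \sum_k (T k k chi - T k k (fun x => (X (xi l) x ^+ 2 + X (yi l) x ^+ 2) * kappa x))
    = n%:R * trace_current chi - trace_current (fun x => sqdist a x * kappa x).
  under eq_bigr do rewrite big_split/=.
  rewrite big_split/= sumr_const card_ord -[X in X + _]mulr_natl; congr (_ + _).
  rewrite exchange_big/= /trace_current -sumrN; apply: eq_bigr => k _.
  rewrite sumrN -(linear_on_test_sum _ (linT k k)).
    congr (- T _ _ _); apply/funext => x.
    by rewrite /sqdist big_split_ord/= -big_split/= mulr_suml.
  move=> l; apply: test_funMl => //.
  by apply: smoothD; apply: smoothX; exact: smooth_X.
have -> : \sum_l \sum_k ((k == l)%:R * T l k chi - complex_ext (T l k)
      (fun x => zcoord a l x * (zcoord a k x)^*%C * (kappa x)%:C%C)) =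
    trace_current chi - hermitian T (zcoord a) kappa.
  rewrite /trace_current /hermitian -sumrB; apply: eq_bigr => l _.
  rewrite sumrB (bigD1 l)//= eqxx mul1r big1 ?addr0// => k /negPf ->.
  by rewrite mul0r.
move=> /(congr1 (@complex.Re R)); have := hermitian_zcoord_ge0 linT posT a tkappa kappa_ge0.
rewrite !raddfB/= [n%:R * _]mulr_natl raddfMn -mulr_natl/=; set h := Re (hermitian _ _ _).
by move: h => h; lra.
Qed.

End lelong.

Section cube.
Context {R : realType} {N : nat}.
Local Notation V := 'rV[R]_N.

Definition cube (a : V) (r : R) : set V :=
  [set x | forall i, `|x ord0 i - a ord0 i| <= r].

Lemma cubeE a r : 0 <= r -> cube a r = [set x | `|x - a| <= r].
Proof.
move=> r0; apply/seteqP; split => x /=; rewrite rV_norm_le//.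
  by move=> h i; rewrite !mxE; exact: h.
by move=> h i; have := h i; rewrite !mxE.
Qed.

Lemma cube_compact a r : 0 <= r -> compact (cube a r).
Proof.
move=> r0; rewrite (cubeE a r0); apply: bounded_closed_compact.
  exists (r + `|a|); split; first exact: num_real.
  move=> M rM x /= xr; rewrite -(subrK a x) (le_trans (ler_normD _ _))//.
  by rewrite (le_trans _ (ltW rM))// lerD2r.
rewrite (_ : [set x | _] = closed_ball_ Num.Def.normr a r).
  exact: closed_closed_ball_.
by apply/seteqP; split => x /=; rewrite distrC.
Qed.

Lemma cubeS a r s : r <= s -> cube a r `<=` cube a s.
Proof. by move=> rs x xr i; exact: le_trans (xr i) rs. Qed.

End cube.

Section cutoff.
Context {R : realType} {n : nat}.
Implicit Types a x : 'rV[R]_(n + n).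

Lemma sqdist_ge0 a x : 0 <= sqdist a x.
Proof. by apply: sumr_ge0 => i _; exact: sqr_ge0. Qed.

Lemma smooth_sqdist a : smooth_fun (sqdist a).
Proof.
apply: smooth_sum => i; apply: smoothX.
by apply: smoothB; [exact: smooth_coord|exact: smooth_cst].
Qed.

Lemma sqdist_cube a x r : cube a r x -> sqdist a x <= (n + n)%:R * r ^+ 2.
Proof.
move=> xr; rewrite /sqdist -[X in X%:R]card_ord mulr_natl -sumr_const ler_sum// => i _.
by rewrite -[leLHS]real_normK ?num_real// lerXn2r// nnegrE// (le_trans _ (xr i)).
Qed.

Lemma sqdist_cubeC a x r : 0 <= r -> ~ cube a r x -> r ^+ 2 < sqdist a x.
Proof.
move=> r0 /existsNP[i /negP]; rewrite -ltNge => dx.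
rewrite /sqdist (bigD1 i)//= ltr_wpDr ?sumr_ge0//; first by move=> ? _; exact: sqr_ge0.
by rewrite -[ltRHS]real_normK ?num_real// ltrXn2r// ltW.
Qed.

(** The squared Euclidean distance is smooth at the centre as well. Outside the cube it exceeds d^2,
    so the argument of [flat] is at most 0 there. *)
Lemma cutoff_test (Omega : set 'rV[R]_(n + n)) a d k m (f : 'rV[R]_(n + n) -> R) :
  0 < d -> cube a d `<=` Omega -> smooth_fun f ->
  test_fun Omega (fun x => flat k (1 - (sqdist a x / d ^+ 2) ^+ m) * f x).
Proof.
move=> d0 adO sf; apply: test_funM => //; split.
  apply: smooth_flat; apply: smoothB; first exact: smooth_cst.
  by apply: smoothX; apply: smoothM; [exact: smooth_sqdist|exact: smooth_cst].
exists (cube a d); split => //; first exact/cube_compact/ltW.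
move=> x /(sqdist_cubeC (ltW d0)) sx; rewrite flat_le0// subr_le0 exprn_ege1//.
by rewrite ler_pdivlMr ?mul1r ?exprn_gt0// ltW.
Qed.

End cutoff.

Section lelong_mass.
Context {R : realType} {n : nat} (Omega : set 'rV[R]_(n + n)).
Local Notation V := 'rV[R]_(n + n).
Local Notation test := (test_fun Omega).
Local Notation Re := complex.Re.
Local Notation e_ i := (delta_mx ord0 i : V).
Variable T : @current11 R n.
Hypothesis linT : forall j k, linear_on_test Omega (T j k).
Hypothesis posT : positive_current Omega T.
Hypothesis closedT : closed_current Omega T.
Variables (a : V) (d b M : R).
Hypotheses (d_gt0 : 0 < d) (b_gt0 : 0 < b) (n_gt0 : (0 < n)%N).
Hypothesis adOmega : cube a d `<=` Omega.
Hypothesis massT : (mass Omega T <= M%:E)%E.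

Let m := n.-1.
Let s (x : V) := sqdist a x / d ^+ 2.

Let s_ge0 x : 0 <= s x.
Proof. by rewrite divr_ge0 ?sqdist_ge0// ltW// exprn_gt0. Qed.

Let sb_gt0 x : 0 < s x + b.
Proof. by rewrite ltr_wpDl. Qed.

Let smooth_s : smooth_fun s.
Proof. by apply: smoothM; [exact: smooth_sqdist|exact: smooth_cst]. Qed.

Let smooth_sb : smooth_fun (fun x => (s x + b)^-1).
Proof.
apply: smoothV; first by apply: smoothD => //; exact: smooth_cst.
by move=> x; rewrite gt_eqF.
Qed.

Let testK k (f : V -> R) : smooth_fun f ->
  test (fun x => flat k (1 - s x ^+ n) * f x).
Proof. exact: cutoff_test. Qed.

Let is_derive_s i x : is_derive x (e_ i) s (2 * (x ord0 i - a ord0 i) / d ^+ 2).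
Proof.
have dX (j : 'I_(n + n)) : is_derive x (e_ i) (fun x : V => x ord0 j - a ord0 j) (i == j)%:R.
  rewrite -[X in is_derive _ _ _ X]subr0.
  apply: (@is_deriveB _ _ _ (fun x : V => x ord0 j) (cst (a ord0 j))).
  exact: is_derive_coord.
have dX2 (j : 'I_(n + n)) := is_deriveM (dX j) (dX j).
have dS := is_derive_sum dX2.
have dM := is_deriveM dS (is_derive_cst (d ^+ 2)^-1 x (e_ i)).
have -> : s = (\sum_(j < n + n) (fun x : V => x ord0 j - a ord0 j) *
    (fun x : V => x ord0 j - a ord0 j)) * cst (d ^+ 2)^-1.
  by apply/funext => y; rewrite /s /sqdist fctE; congr (_ * _); rewrite fct_sumE.
apply: (is_derive_eq dM); rewrite scaler0 add0r /GRing.scale/=.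
rewrite [in LHS]mulrC; congr (_ / _).
rewrite (bigD1 i)//= eqxx !mulr1 big1 ?addr0; first by rewrite mulr_natl mulr2n.
by move=> j ji; rewrite eq_sym (negPf ji) !mulr0 addr0.
Qed.

(* [lelong] is applied to [chi = flat 0 (1 - s^n) / (s + b)^(n-1)]; [Psi] comes from
   differentiating the power and [Phi] from differentiating the cut-off. *)
Let Psi (x : V) := flat 0 (1 - s x ^+ n) * (s x + b)^-1 ^+ n.
Let Phi (x : V) := flat 2 (1 - s x ^+ n) * (s x ^+ n * (s x + b)^-1 ^+ m).

(** For the critical power s^(1-n) both sides of [lelong] would agree up to the cut-off. With
    [s + b] in place of [s] there remains the defect [m * b * Psi], which is therefore bounded by
    the cut-off term. Since [Psi] is of order b^-n on the set where s <= b, the mass there is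
    O(b^(n-1)). *)
Lemma lelong_mass :
  m%:R * b * Re (trace_current T (fun x => flat 0 (1 - s x ^+ n) * (s x + b)^-1 ^+ n)) <= n%:R * M.
Proof.
(* The power [s ^+ n] in the cut-off is chosen for its derivative: the factor s^(n-1) turns (s +
   b)^(1-n) into (s / (s + b))^(n-1), so that [Phi] is bounded independently of [b]. *)
pose chi x := flat 0 (1 - s x ^+ n) * (s x + b)^-1 ^+ m.
pose kappa x := (d ^+ 2)^-1 * (n%:R * (flat 2 (1 - s x ^+ n) * (s x ^+ m * (s x + b)^-1 ^+ m))
   + m%:R * Psi x).
have tchi : test chi by apply: testK; exact: smoothX.
have tPsi : test Psi by apply: testK; exact: smoothX.
have tPhi : test Phi by apply: testK; apply: smoothM; exact: smoothX.
have tkappa : test kappa.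
  apply: test_funMl; last exact: smooth_cst.
  apply: test_funD; apply: test_funMl; try exact: smooth_cst; last by [].
  by apply: testK; apply: smoothM; exact: smoothX.
have kappa_ge0 x : 0 <= kappa x.
  have sb0 : 0 <= (s x + b)^-1 by rewrite invr_ge0 ltW.
  apply: mulr_ge0; first by rewrite invr_ge0 exprn_ge0// ltW.
  apply: addr_ge0; apply: mulr_ge0 => //.
    by rewrite mulr_ge0 ?flat_ge0// mulr_ge0// exprn_ge0.
  by rewrite mulr_ge0 ?flat_ge0// exprn_ge0.
have dchi i x : is_derive x (e_ i) chi (-2 * (x ord0 i - a ord0 i) * kappa x).
  have dg t : 0 < t + b -> is_derive t 1
      (fun t : R => flat 0 (1 - t ^+ n) * (t + b)^-1 ^+ m)
      (- (n%:R * (flat 2 (1 - t ^+ n) * (t ^+ m * (t + b)^-1 ^+ m)) +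
        m%:R * (flat 0 (1 - t ^+ n) * (t + b)^-1 ^+ n))).
    move=> tb0.
    have dX : is_derive t 1 (fun t : R => 1 - t ^+ n) (- (n%:R * t ^+ m)).
      have d1 := is_deriveB (is_derive_cst (1 : R) t 1) (is_deriveX n (is_derive_id t 1)).
      have -> : (fun t : R => 1 - t ^+ n) = cst 1 - id ^+ n.
        by apply/funext => y; rewrite !fctE.
      by apply: (is_derive_eq d1); rewrite sub0r /GRing.scale/= mulr1.
    have dF := @is_derive1_comp R (flat 0) (fun t => 1 - t ^+ n) t _ _ (is_derive_flat 0 (1 - t ^+ n)) dX.
    have dD : is_derive t 1 (fun t : R => t + b) 1.
      rewrite -[X in is_derive _ _ _ X]addr0.
      exact: (is_deriveD (is_derive_id t 1) (is_derive_cst b t 1)).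
    have dV := @is_deriveV R (fun t => t + b) t 1 1 (lt0r_neq0 tb0) dD.
    have dVX := is_deriveX m dV.
    have dM := is_deriveM dF dVX.
    have -> : (fun t : R => flat 0 (1 - t ^+ n) * (t + b)^-1 ^+ m) =
      ((flat 0 \o (fun t : R => 1 - t ^+ n)) * ((fun t : R => (t + b)^-1) ^+ m)).
      by apply/funext => y /=; rewrite !fctE.
    apply: (is_derive_eq dM); rewrite !fctE /GRing.scale/= !mulr1 oppr0 mul0r add0r.
    rewrite -exprVn -/m; set q := (t + b)^-1; rewrite -(prednK n_gt0) -/m.
    case: (m) => [|k]; first by rewrite !mul0r !mulr0 !addr0; ring.
    by rewrite /= !exprS; ring.
  apply: (is_derive_eq (is_derive_comp1 (is_derive_s i x) (dg _ (sb_gt0 x)))).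
  by rewrite /kappa /Psi; ring.
have L := lelong linT posT closedT tchi tkappa kappa_ge0 dchi.
have trD f g : test f -> test g -> trace_current T (fun x => f x + g x) =
    trace_current T f + trace_current T g.
  move=> tf tg; rewrite /trace_current -big_split; apply: eq_bigr => k _.
  exact: (linear_on_testD (linT k k)).
have trZ c f : test f -> trace_current T (fun x => c * f x) =
    c%:C%C * trace_current T f.
  move=> tf; rewrite /trace_current mulr_sumr; apply: eq_bigr => k _.
  exact: (linear_on_testZ (linT k k)).
have ReZ (c : R) z : Re (c%:C%C * z) = c * Re z.
  by case: z => ? ? /=; rewrite mul0r subr0.
have tsPsi : test (fun x => s x * Psi x) by exact: test_funMl.
have E1 : trace_current T chi = trace_current T (fun x => s x * Psi x) +
    b%:C%C * trace_current T Psi.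
  rewrite -trZ// -trD//; last by apply: test_funMl => //; exact: smooth_cst.
  congr trace_current; apply/funext => x; rewrite -mulrDl /chi /Psi mulrCA; congr (_ * _).
  by rewrite -[in RHS](prednK n_gt0) exprS mulrA divff ?mul1r// gt_eqF.
have E2 : trace_current T (fun x => sqdist a x * kappa x) =
    n%:R%:C%C * trace_current T Phi + m%:R%:C%C * trace_current T (fun x => s x * Psi x).
  rewrite -!trZ// -trD//; try by apply: test_funMl => //; exact: smooth_cst.
  congr trace_current; apply/funext => x; rewrite /kappa /Phi [LHS]mulrA -/(s x).
  have -> : s x ^+ n = s x * s x ^+ m by rewrite -exprS /m prednK.
  by ring.
move: L; rewrite E2 E1 !raddfD /= !ReZ -/Psi.
have PhiM : Re (trace_current T Phi) <= M.
  (* [flat 2] is at most 2! by [flatS_le], and the other factor is at most 1 where the cut-off does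
     not vanish. So [Phi / 2] is admissible in [mass], whose factor 2 restores [Phi]. *)
  have : ((2 * \sum_j Re (T j j (fun x => 2^-1 * Phi x)))%:E <= M%:E)%E.
    apply: le_trans massT; apply: ereal_sup_ubound.
    exists (fun x => 2^-1 * Phi x) => //; split.
      by apply/test_funP; apply: test_funMl => //; exact: smooth_cst.
    move=> x; have sb0 : 0 <= (s x + b)^-1 by rewrite invr_ge0 ltW.
    have Phi0 : 0 <= Phi x.
      by rewrite mulr_ge0 ?flat_ge0// mulr_ge0// exprn_ge0.
    rewrite mulr_ge0// ?ler_pdivrMl ?mulr1//=.
    have [s1|s1] := leP (1 - s x ^+ n) 0; first by rewrite /Phi flat_le0// mul0r.
    rewrite /Phi -[leRHS]mulr1 ler_pM ?flat_ge0//.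
    - by rewrite mulr_ge0// exprn_ge0.
    - exact: flatS_le.
    - rewrite -[X in _ ^+ X * _](prednK n_gt0) exprS -mulrA -exprMn.
      have sq1 : s x * (s x + b)^-1 <= 1 by rewrite ler_pdivrMr// mul1r lerDl ltW.
      have s1' : s x <= 1.
        by rewrite -(@ler_pXn2r _ n) ?nnegrE//= expr1n; rewrite subr_gt0 in s1; exact: ltW.
      have sq0 : 0 <= s x * (s x + b)^-1 by rewrite mulr_ge0.
      by apply: mulr_ile1 => //; [exact: exprn_ge0|exact: exprn_ile1].
  rewrite lee_fin; congr (_ <= _).
  rewrite mulr_sumr /trace_current raddf_sum; apply: eq_bigr => k _.
  by rewrite (linear_on_testZ (linT k k))// ReZ mulrA divff ?mul1r.
have n1 : n%:R = 1 + m%:R :> R by rewrite -(prednK n_gt0) -/m -natr1 addrC.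
set A := Re _; set B := Re _; set C := Re _ in PhiM *.
have : n%:R * C <= n%:R * M by rewrite ler_wpM2l.
rewrite !n1; lra.
Qed.

End lelong_mass.

(** * Lebesgue measure on R^N *)

Section measurable_rV.
Context {R : realType} {N : nat}.
Local Notation V := 'rV[R]_N.

Let rat_box (p : 'rV[rat]_N * nat) : set V :=
  [set x | forall i, `|x ord0 i - ratr (p.1 ord0 i)| < p.2.+1%:R^-1].

Lemma measurable_coordwise (P : 'I_N -> set R) :
  (forall i, measurable (P i)) -> measurable [set x : V | forall i, P i (x ord0 i)].
Proof.
move=> mP.
rewrite (_ : [set _ | _] = \bigcap_(i in [set: 'I_N]) ((fun x : V => x ord0 i) @^-1` P i)).
  apply: fin_bigcap_measurable => // i _.
  by rewrite -[X in measurable X]setTI; exact: measurable_coord_rV.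
by apply/seteqP; split => x /= h => [i _|i]; exact: h.
Qed.

(** The sigma-algebra is generated by the coordinates; an open set is the union of the rational
    boxes inside it, enumerated through [unpickle]. *)
Lemma measurable_open_rV (U : set V) : open U -> measurable U.
Proof.
move=> oU.
pose F (m : nat) : set V := if @unpickle ('rV[rat]_N * nat)%type m is Some p then
  if `[< rat_box p `<=` U >] then rat_box p else set0 else set0.
have -> : U = \bigcup_m F m.
  apply/seteqP; split => [x Ux|x [m _]]; last first.
    by rewrite /F; case: unpickle => // p; case: asboolP => // h /h.
  have [e /= e0 xeU] : exists2 e : R, 0 < e & forall y : V, (forall i, `|x ord0 i - y ord0 i| < e) -> U y.
    have /nbhs_ballP[e /= e0 xe] := open_nbhs_nbhs (conj oU Ux).
    by exists e => // y xy; apply: xe; split => // i j; rewrite ord1; exact: xy.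
  (* Twice the radius, because both [x] and an arbitrary point of the box are compared with its
     rational centre. *)
  have [k ke] : exists k : nat, k.+1%:R^-1 + k.+1%:R^-1 < e.
    have := archi_boundP (divr_ge0 (ler0n R 2) (ltW e0)).
    set k := Num.bound _ => ke; exists k.
    have -> : k.+1%:R^-1 + k.+1%:R^-1 = 2 / k.+1%:R :> R by ring.
    rewrite ltr_pdivrMr// mulrC -ltr_pdivrMr// (lt_trans ke)//.
    by rewrite ltr_nat.
  have H i : exists q : rat, `|x ord0 i - ratr q| < k.+1%:R^-1.
    have k0 : (0 : R) < k.+1%:R^-1 by rewrite invr_gt0.
    have /rat_in_itvoo[q] : x ord0 i - k.+1%:R^-1 < x ord0 i + k.+1%:R^-1.
      by rewrite ltrBlDr -addrA ltrDl addr_gt0.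
    by rewrite in_itv/= => qx; exists q; rewrite distrC ltr_distl.
  have [q qP] := choice H.
  exists (pickle (\row_i q i, k)) => //; rewrite /F pickleK.
  case: asboolP => [_ i /=|]; first by rewrite mxE.
  case=> y yP; apply: xeU => i; have := yP i; rewrite /= mxE => h.
  rewrite (_ : _ - _ = (x ord0 i - ratr (q i)) - (y ord0 i - ratr (q i))); last by ring.
  by rewrite (le_lt_trans (ler_normB _ _))// (lt_trans _ ke)// ltrD.
apply: bigcup_measurable => m _; rewrite /F; case: unpickle => // p.
case: asboolP => // _; rewrite /rat_box.
apply: (measurable_coordwise (P := fun i => [set y | `|y - ratr (p.1 ord0 i)| < p.2.+1%:R^-1])) => i.
rewrite (_ : [set _ | _] = `](ratr (p.1 ord0 i) - p.2.+1%:R^-1), (ratr (p.1 ord0 i) + p.2.+1%:R^-1)[%classic).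
  exact: measurable_itv.
by apply/seteqP; split => y /=; rewrite in_itv/= ltr_distl.
Qed.

Lemma measurable_closed_rV (A : set V) : closed A -> measurable A.
Proof.
by move=> /closed_openC/measurable_open_rV/measurableC; rewrite setCK.
Qed.

Lemma measurable_compact_rV (A : set V) : compact A -> measurable A.
Proof.
move=> cA; apply: measurable_closed_rV.
by apply: compact_closed cA; exact: norm_hausdorff.
Qed.

Lemma continuous_measurable_rV (f : V -> R) : continuous f -> measurable_fun setT f.
Proof.
move=> cf; apply: (measurability _ (RGenOpens.measurableE R)).
move=> _ [_ [a [b ->] <-]]; rewrite setTI.
apply: measurable_open_rV; apply: open_comp; last exact: interval_open.
by move=> x _; exact: cf.
Qed.

Lemma smooth_measurable (f : V -> R) : smooth_fun f -> measurable_fun setT f.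
Proof. by move=> /smooth_continuous; exact: continuous_measurable_rV. Qed.

Lemma measurable_cube (a : V) r : measurable (cube a r).
Proof.
apply: (measurable_coordwise (P := fun i => [set y | `|y - a ord0 i| <= r])) => i.
rewrite (_ : [set _ | _] = `[(a ord0 i - r), (a ord0 i + r)]%classic).
  exact: measurable_itv.
by apply/seteqP; split => y /=; rewrite in_itv/= ler_distl.
Qed.

End measurable_rV.

Lemma measurable_prod_rV (R : realType) N (f : 'I_N -> R -> R) :
  (forall i, measurable_fun setT (f i)) ->
  measurable_fun setT (fun x : 'rV[R]_N => \prod_i f i (x ord0 i)).
Proof.
move=> mf; apply: measurable_prod => i _.
exact: measurableT_comp (mf i) (measurable_coord_rV i).
Qed.

Section integral_rV.
Context {R : realType}.
Local Open Scope ereal_scope.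

Lemma ge0_integral_rVS N (f : 'rV[R]_N.+1 -> \bar R) :
  measurable_fun setT f -> (forall x, 0 <= f x) ->
  \int[lebesgue_rV N.+1]_x f x =
  \int[lebesgue_measure]_t \int[lebesgue_rV N]_y f (rV_cons (t, y)).
Proof.
move=> mf f0.
transitivity (\int[pushforward (lebesgue_measure \x lebesgue_rV N) (@rV_cons R N)]_x f x).
  by [].
rewrite ge0_integral_pushforward//; last exact: measurable_rV_cons.
rewrite preimage_setT fubini_tonelli1//; last by move=> x; exact: f0.
by apply: measurableT_comp => //; exact: measurable_rV_cons.
Qed.

Lemma integral_prod_rV N (f : 'I_N -> R -> R) (c : 'I_N -> R) :
  (forall i, measurable_fun setT (f i)) -> (forall i t, (0 <= f i t)%R) ->
  (forall i, \int[lebesgue_measure]_t (f i t)%:E = (c i)%:E) ->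
  \int[lebesgue_rV N]_x (\prod_i f i (x ord0 i))%:E = (\prod_i c i)%:E.
Proof.
elim: N f c => [|N IH] f c mf f0 fc.
  transitivity (\int[\d_((0 : 'rV[R]_0)%R)]_x (\prod_i f i (x ord0 i))%:E) => //.
  rewrite integral_dirac//= ?diracT ?mul1e ?big_ord0//.
  by under eq_fun do rewrite big_ord0; exact: measurable_cst.
rewrite ge0_integral_rVS; last 2 first.
- by apply/measurable_EFinP; exact: measurable_prod_rV.
- by move=> x; rewrite lee_fin prodr_ge0.
transitivity (\int[lebesgue_measure]_t ((f ord0 t)%:E * (\prod_i c (lift ord0 i))%:E)).
  apply: eq_integral => t _.
  rewrite -(IH (fun i => f (lift ord0 i)))//.
  rewrite -ge0_integralZl//=; last 3 first.
  - apply/measurable_EFinP.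
    exact: (measurable_prod_rV (f := fun i => f (lift ord0 i))).
  - by move=> x _; rewrite lee_fin prodr_ge0.
  - by rewrite lee_fin.
  apply: eq_integral => y _; rewrite -EFinM big_ord_recl; congr (_ * _)%:E.
    by rewrite /rV_cons mxE unlift_none.
  by apply: eq_bigr => i _; rewrite /rV_cons mxE liftK.
rewrite ge0_integralZr//=; last 3 first.
- by apply/measurable_EFinP; exact: mf.
- by move=> t _; rewrite lee_fin.
- rewrite lee_fin prodr_ge0// => i _.
  by rewrite -lee_fin -fc integral_ge0// => t _; rewrite lee_fin.
by rewrite fc big_ord_recl EFinM.
Qed.

Lemma lebesgue_cube N (a : 'rV[R]_N) r : (0 <= r)%R ->
  lebesgue_rV N (cube a r) = ((2 * r) ^+ N)%:E.
Proof.
move=> r0.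
have mI i : measurable `[(a ord0 i - r)%R, (a ord0 i + r)%R]%classic by exact: measurable_itv.
have := @integral_prod_rV N (fun i => \1_(`[(a ord0 i - r)%R, (a ord0 i + r)%R]%classic)) (fun=> 2 * r)%R.
rewrite prodr_const card_ord => <-.
- rewrite -(setIT (cube a r)) -integral_indic//; last exact: measurable_cube.
  apply: eq_integral => x _; congr EFin.
  rewrite indicE; have [xa|xa] := boolP (x \in cube a r).
    rewrite big1// => i _; rewrite indicE mem_set//= in_itv/= -ler_distl.
    by move: xa; rewrite inE; exact.
  have /existsNP[i xi] : ~ cube a r x by move/mem_set; exact/negP.
  rewrite (bigD1 i)//= indicE memNset ?mul0r//= in_itv/= -ler_distl; exact: xi.
- by move=> i; exact: measurable_indic.
- by move=> i t; rewrite indicE.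
- move=> i; rewrite integral_indic// setIT [LHS]lebesgue_measure_itv/= lte_fin.
  case: ifPn => h; first by rewrite -EFinB; congr EFin; ring.
  by congr EFin; move: h; rewrite -leNgt; lra.
Qed.

End integral_rV.

Section morrey.
Context {R : realType} {n : nat} (Omega : set 'rV[R]_(n + n)).
Local Notation V := 'rV[R]_(n + n).
Local Notation test := (test_fun Omega).
Local Notation Re := complex.Re.
Local Notation Im := complex.Im.
Local Notation mu := (lebesgue_rV (n + n)).

Lemma test_fun_bounded N (U : set 'rV[R]_N) (f : 'rV[R]_N -> R) : test_fun U f ->
  exists2 B : R, 0 <= B & forall x, `|f x| <= B.
Proof.
move=> [sf [K [cK KU fK]]].
have : compact (f @` K).
  by apply: continuous_compact => //; apply: continuous_subspaceT; exact: smooth_continuous.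
move=> /compact_bounded[B [Br fB]].
exists (`|B| + 1) => [|x]; first by rewrite addr_ge0.
have [Kx|Kx] := pselect (K x); last by rewrite fK// normr0 addr_ge0.
apply: fB; last by exists x.
by rewrite (le_lt_trans (ler_norm _))// ltrDl.
Qed.

Variables (u : V -> R) (T : @current11 R n) (g : 'I_(n + n) -> V -> R).
Hypothesis openOmega : open Omega.
Hypothesis curT : is_current11 Omega T.
Hypothesis posT : positive_current Omega T.
Hypothesis closedT : closed_current Omega T.
Hypothesis gu : L2_gradient Omega u g.
Hypothesis domT : positive_current Omega (fun j k f => T j k f - dudbaru Omega g j k f).

Let linT j k : linear_on_test Omega (T j k).
Proof.
by move=> a f h /test_funP tf /test_funP th; have [+ _] := curT j k; exact.
Qed.

Let mOmega : measurable Omega. Proof. exact: measurable_open_rV. Qed.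

Let mg i : measurable_fun Omega (g i). Proof. by have [[]] := gu i. Qed.

(** Domination is tested with the basis vectors: |du/dz_j|^2 is a quarter of the sum of the squares
    of the derivatives in x_j and y_j, whence the factor 4. *)
Lemma energy_le f : test f -> (forall x, 0 <= f x) ->
  (\int[mu]_(x in Omega) ((\sum_i g i x ^+ 2) * f x)%:E <=
    (4 * Re (trace_current T f))%:E)%E.
Proof.
move=> tf f0.
have [B B0 fB] := test_fun_bounded tf.
have mf : measurable_fun Omega f.
  by apply: measurable_funTS; apply: smooth_measurable; case: tf.
have mgf i : measurable_fun Omega (fun x => (g i x ^+ 2 * f x)%:E).
  by apply/measurable_EFinP; apply: measurable_funM => //; exact: measurable_funX.
have gf0 i x : Omega x -> (0 <= (g i x ^+ 2 * f x)%:E)%E.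
  by move=> _; rewrite lee_fin mulr_ge0// sqr_ge0.
(* Finiteness matters: [dudbaru] is defined by real-valued integrals, which are 0 by convention when
   the extended integral is infinite. *)
have gfoo i : (\int[mu]_(x in Omega) (g i x ^+ 2 * f x)%:E < +oo)%E.
  have [[_ goo] _] := gu i.
  apply: (@le_lt_trans _ _ (\int[mu]_(x in Omega) (B%:E * (g i x ^+ 2)%:E))%E).
    apply: ge0_le_integral => //.
    - exact: gf0.
    - apply: measurable_funeM; apply/measurable_EFinP; exact: measurable_funX.
    - move=> x _; rewrite -EFinM lee_fin mulrC ler_wpM2r ?sqr_ge0//.
      by rewrite (le_trans (ler_norm _)).
  rewrite ge0_integralZl ?lte_mul_pinfty//.
  - by apply/measurable_EFinP; exact: measurable_funX.
  - by move=> x _; rewrite lee_fin sqr_ge0.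
have key j : (\int[mu]_(x in Omega) (g (xi j) x ^+ 2 * f x)%:E +
    \int[mu]_(x in Omega) (g (yi j) x ^+ 2 * f x)%:E <= (4 * Re (T j j f))%:E)%E.
  pose c k : R[i] := (k == j)%:R.
  have := domT c ((test_funP _ _).2 tf) f0.
  rewrite (bigD1 j)//= [X in _ <= _ + X]big1 ?addr0; last first.
    by move=> i /negPf ij; rewrite big1// => k _; rewrite /c ij !mul0r.
  rewrite (bigD1 j)//= big1 ?addr0; last first.
    by move=> k /negPf kj; rewrite /c kj conjc0 mulr0 mul0r.
  rewrite /c eqxx mul1r conjc1 mul1r subr_ge0 lecE => /andP[_].
  move=> h.
  have hE x : complex.Re (grad_z g j x * (grad_z g j x)^*%C) * f x =
      4^-1 * (g (xi j) x ^+ 2 * f x + g (yi j) x ^+ 2 * f x).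
    rewrite /grad_z; set p := g _ _; set q := g _ _.
    have -> : (2%:R : R[i])^-1 = (2^-1 : R)%:C%C by rewrite -realc_nat fmorphV.
    by simpc; rewrite /=; field.
  rewrite -ge0_integralD//; [|exact: gf0..].
  have I : (\int[mu]_(x in Omega) (g (xi j) x ^+ 2 * f x + g (yi j) x ^+ 2 * f x)%:E =
     (4 * Re (dudbaru Omega g j j f))%:E)%E.
    have fin : (\int[mu]_(x in Omega) (g (xi j) x ^+ 2 * f x + g (yi j) x ^+ 2 * f x)%:E)%E \is a fin_num.
      rewrite ge0_fin_numE; last first.
        by apply: integral_ge0 => x Ox; rewrite EFinD adde_ge0// gf0.
      under eq_integral do rewrite EFinD.
      rewrite ge0_integralD//; [exact: lte_add_pinfty|exact: gf0..].
    rewrite /dudbaru/= /Rintegral; under [in RHS]eq_integral do rewrite hE EFinM.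
    rewrite ge0_integralZl//; last 2 first.
    - by under eq_fun do rewrite EFinD; apply: emeasurable_funD; exact: mgf.
    - by move=> x Ox; rewrite EFinD adde_ge0// gf0.
    by rewrite fineM//= mulrA mulfV// mul1r fineK.
  under eq_integral do rewrite -EFinD.
  by rewrite I lee_fin ler_pM2l.
rewrite [X in (_ <= X)%E](_ : _ = (\sum_j (4 * Re (T j j f))%:E)%E); last first.
  by rewrite sumEFin -mulr_sumr /trace_current raddf_sum.
apply: le_trans (lee_sum _ (fun j _ => key j)).
rewrite le_eqVlt; apply/orP; left; apply/eqP.
transitivity (\int[mu]_(x in Omega) (\sum_i (g i x ^+ 2 * f x)%:E))%E.
  by apply: eq_integral => x _; rewrite sumEFin mulr_suml.
rewrite ge0_integral_sum// big_split_ord/= -big_split/=.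
by apply: eq_bigr => i _; rewrite /xi /yi.
Qed.

Lemma flat0_le1 (t : R) : flat 0 t <= 1.
Proof.
rewrite /flat; case: ifP => // t0.
by rewrite expr0 mul1r expR_le1 oppr_le0 invr_ge0 ltW.
Qed.

Lemma morrey (a : V) (d r M : R) : (0 < n)%N -> 0 < d -> 0 < r ->
  (n + n)%:R * r ^+ 2 <= d ^+ 2 / 2 -> cube a d `<=` Omega ->
  (mass Omega T <= M%:E)%E ->
  (\int[mu]_(x in cube a r) (\sum_i g i x ^+ 2)%:E <=
   (8 * M * expR 2 * 2 ^+ n * ((n + n)%:R * r ^+ 2 / d ^+ 2) ^+ n.-1)%:E)%E.
Proof.
move=> n0 d0 r0 rd adO massT.
(* On the cube, |x - a|^2 <= 2n r^2, so [b] bounds [s] there. The hypothesis on [r] gives b <= 1/2,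
   which keeps the cut-off above exp(-2). *)
set b := (n + n)%:R * r ^+ 2 / d ^+ 2.
have d20 : 0 < d ^+ 2 by rewrite exprn_gt0.
have b0 : 0 < b by rewrite divr_gt0// mulr_gt0// ?exprn_gt0// ltr0n addn_gt0 n0.
have b2 : b <= 2^-1 by rewrite /b ler_pdivrMr// [leRHS]mulrC.
pose s x := sqdist a x / d ^+ 2.
have sb x : cube a r x -> s x <= b.
  by move=> /sqdist_cube h; rewrite ler_pM2r ?invr_gt0.
have s0 x : 0 <= s x.
  by rewrite divr_ge0 ?sqdist_ge0// ltW.
have e0 x : cube a r x -> expR (- 2) <= flat 0 (1 - s x ^+ n).
  move=> /sb sxb.
  have sn : s x ^+ n <= 2^-1.
    rewrite -(prednK n0) exprS (le_trans _ (le_trans sxb b2))// ler_piMr//.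
    by apply: exprn_ile1 => //; move: sxb b2; lra.
  have s1 : 2^-1 <= 1 - s x ^+ n by lra.
  have s1' : 0 < 1 - s x ^+ n by lra.
  rewrite /flat s1' expr0 mul1r ler_expR lerN2.
  by rewrite -[leRHS]invrK lef_pV2// posrE invr_gt0.
have cO : cube a r `<=` Omega.
  apply: subset_trans adO; apply: cubeS; rewrite -(@ler_pXn2r _ 2)// ?nnegrE ?ltW//.
  have n1 : 1 <= (n + n)%:R :> R by rewrite ler1n addn_gt0 n0.
  have : r ^+ 2 <= (n + n)%:R * r ^+ 2 by rewrite ler_peMl// sqr_ge0.
  by have := ltW d20; lra.
have low f c : test f -> (forall x, 0 <= f x) -> 0 < c ->
    (forall x, cube a r x -> c <= f x) ->
    (\int[mu]_(x in cube a r) (\sum_i g i x ^+ 2)%:E <= (c^-1 * (4 * Re (trace_current T f)))%:E)%E.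
  move=> tf f0 c0 cf.
  have mS : measurable_fun (cube a r) (fun x => (\sum_i g i x ^+ 2)%:E).
    apply/measurable_EFinP; apply: measurable_sum => i; apply: measurable_funX.
    exact: measurable_funS (mg i).
  have mf (D : set V) : D `<=` Omega -> measurable_fun D f.
    by move=> _; apply: measurable_funTS; apply: smooth_measurable; case: tf.
  have mSf (D : set V) : D `<=` Omega -> measurable_fun D (fun x => ((\sum_i g i x ^+ 2) * f x)%:E).
    move=> DO; apply/measurable_EFinP; apply: measurable_funM; last exact: mf.
    by apply: measurable_sum => i; apply: measurable_funX; exact: measurable_funS (mg i).
  have S0 x : 0 <= \sum_i g i x ^+ 2 by apply: sumr_ge0 => i _; exact: sqr_ge0.
  apply: (@le_trans _ _ ((c^-1)%:E * \int[mu]_(x in Omega) ((\sum_i g i x ^+ 2) * f x)%:E)%E); last first.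
    by rewrite EFinM lee_pmul2l ?lte_fin ?invr_gt0//; exact: energy_le.
  apply: (@le_trans _ _ ((c^-1)%:E * \int[mu]_(x in cube a r) ((\sum_i g i x ^+ 2) * f x)%:E)%E); last first.
    rewrite lee_pmul2l ?lte_fin ?invr_gt0//; apply: ge0_subset_integral => //.
    - exact: measurable_cube.
    - exact: mSf.
    - by move=> x _; rewrite lee_fin mulr_ge0.
  rewrite -ge0_integralZl//; last 4 first.
  - exact: measurable_cube.
  - exact: mSf.
  - by move=> x _; rewrite lee_fin mulr_ge0.
  - by rewrite lee_fin invr_ge0 ltW.
  apply: ge0_le_integral => //.
  - exact: measurable_cube.
  - by move=> x _; rewrite lee_fin.
  - by apply: measurable_funeM; exact: mSf.
  - move=> x ax; rewrite -EFinM lee_fin ler_pdivlMl// mulrC ler_wpM2l//.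
    exact: cf.
have massf f : test f -> (forall x, 0 <= f x <= 1) -> 2 * Re (trace_current T f) <= M.
  move=> tf f01; rewrite -lee_fin; apply: le_trans massT; apply: ereal_sup_ubound.
  exists f; first by split => //; apply/test_funP.
  by rewrite /trace_current raddf_sum.
have M0 : 0 <= M.
  have := massf _ (test_fun0 _) (fun=> _ : 0 <= 0 <= 1); rewrite /trace_current.
  rewrite big1; last by move=> k _; exact: linear_on_test0 (linT k k).
  by rewrite lexx ler01 mulr0; exact.
have e2 : (expR (- 2))^-1 = expR 2 :> R by rewrite expRN invrK.
(* For [n = 1], [lelong_mass] has the factor [n.-1 = 0] and says nothing; but then [b ^+ n.-1 = 1],
   and the bound on the total mass suffices. *)
have [n1|n1] := leqP n 1.
  have {}n1 : n = 1%N by apply/eqP; rewrite eqn_leq n1.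
  pose f x := flat 0 (1 - s x ^+ n) * 1.
  have tf : test f by apply: cutoff_test => //; exact: smooth_cst.
  apply: (le_trans (low f (expR (- 2)) tf _ (expR_gt0 _) _)).
  - by move=> x; rewrite /f mulr1 flat_ge0.
  - by move=> x ax; rewrite /f mulr1 e0.
  have f01 x : 0 <= f x <= 1 by rewrite /f mulr1 flat_ge0 flat0_le1.
  have := massf f tf f01; move=> h.
  have -> : n.-1 = 0%N by rewrite n1.
  have -> : 2 ^+ n = 2 :> R by rewrite n1.
  rewrite e2 lee_fin expr0 mulr1.
  have E0 : 0 <= expR 2 :> R by exact: expR_ge0.
  have : expR 2 * (2 * Re (trace_current T f)) <= expR 2 * M by rewrite ler_wpM2l.
  have : 0 <= expR 2 * M by rewrite mulr_ge0.
  by lra.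
pose f x := flat 0 (1 - s x ^+ n) * (s x + b)^-1 ^+ n.
have sb0 x : 0 < s x + b by rewrite ltr_wpDl.
have tf : test f.
  apply: cutoff_test => //; apply: smoothX; apply: smoothV => [|x]; last by rewrite gt_eqF.
  apply: smoothD; last exact: smooth_cst.
  by apply: smoothM; [exact: smooth_sqdist|exact: smooth_cst].
have c0 : 0 < expR (- 2) * (2 * b)^-1 ^+ n.
  by rewrite mulr_gt0 ?expR_gt0// exprn_gt0// invr_gt0 mulr_gt0.
apply: (le_trans (low f _ tf _ c0 _)).
- by move=> x; rewrite mulr_ge0 ?flat_ge0// exprn_ge0// invr_ge0 ltW.
- move=> x ax; rewrite ler_pM ?expR_ge0 ?e0//.
    by rewrite exprn_ge0// invr_ge0 mulr_ge0// ltW.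
  have b20 : 0 < 2 * b by rewrite mulr_gt0.
  rewrite lerXn2r ?nnegrE ?invr_ge0 ?(ltW (sb0 x)) ?(ltW b20)//.
  by rewrite lef_pV2 ?posrE// mulr2n mulrDl mul1r lerD2r sb.
have := lelong_mass linT posT closedT d0 b0 n0 adO massT; rewrite -/s -/f => L.
rewrite lee_fin invfM e2 exprVn invrK exprMn.
have n20 : (2 : R) <= n%:R by rewrite ler_nat.
have nE : n%:R = n.-1%:R + 1 :> R by rewrite -[in LHS](prednK n0) -natr1.
(* The quotient n / (n - 1) left by [lelong_mass] is at most 2; with the 4 of [energy_le] this makes
   the constant 8. *)
have L2 : b * Re (trace_current T f) <= 2 * M.
  rewrite -(@ler_pM2l _ n.-1%:R); last by rewrite ltr0n -ltnS prednK.
  rewrite mulrA (le_trans L)// mulrCA mulrA ler_wpM2r//.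
  by move: n20; rewrite nE; lra.
have -> : b ^+ n = b * b ^+ n.-1 by rewrite -exprS prednK.
rewrite (_ : _ * (4 * _) = (4 * expR 2 * 2 ^+ n * b ^+ n.-1) * (b * Re (trace_current T f))); last by ring.
rewrite (_ : 8 * M * _ * _ * _ = (4 * expR 2 * 2 ^+ n * b ^+ n.-1) * (2 * M)); last by ring.
by rewrite ler_wpM2l// !mulr_ge0// ?expR_ge0// exprn_ge0//; exact: ltW.
Qed.

End morrey.

(** * Mollification *)

Section step.
Context {R : realType}.
Implicit Types (t r : R).

Lemma continuous_flat k : continuous (flat k : R -> R).
Proof.
move=> x; apply: differentiable_continuous; apply/derivable1_diffP.
by have [] := is_derive_flat k x.
Qed.

(** It never vanishes: [1 + t] and [- t] add up to 1, so one of them is at least 1/2. *)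
Definition step_den t : R := flat 0 (1 + t) + flat 0 (- t).

Definition step t := flat 0 (1 + t) / step_den t.

(** The derivative of [step] in closed form. A kernel with an explicit primitive makes its integrals
    over boxes computable and allows the divergence form in [mixed]. *)
Definition bump t := (flat 2 (1 + t) * flat 0 (- t) +
  flat 0 (1 + t) * flat 2 (- t)) / step_den t ^+ 2.

(** The numerator of [bump] is at most 4, since [flat 2 <= 2] and [flat 0 <= 1]; the denominator is
    at least the square of exp(-2). *)
Definition bump_bound : R := 4 * expR 2 ^+ 2.

Lemma flat0_half t : 2^-1 <= t -> expR (- 2) <= flat 0 t.
Proof.
move=> t2; have t0 : 0 < t by lra.
rewrite /flat t0 expr0 mul1r ler_expR lerN2.
by rewrite -[leRHS]invrK lef_pV2// posrE invr_gt0.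
Qed.

Lemma step_den_ge t : expR (- 2) <= step_den t.
Proof.
have [t2|t2] := leP 2^-1 (1 + t).
  by rewrite (le_trans (flat0_half t2))// lerDl flat_ge0.
have t2' : 2^-1 <= - t by lra.
by rewrite (le_trans (flat0_half t2'))// lerDr flat_ge0.
Qed.

Lemma step_den_gt0 t : 0 < step_den t.
Proof. exact: lt_le_trans (expR_gt0 _) (step_den_ge t). Qed.

Lemma step_le t : t <= -1 -> step t = 0.
Proof. by move=> t1; rewrite /step flat_le0 ?mul0r//; lra. Qed.

Lemma step_ge t : 0 <= t -> step t = 1.
Proof.
move=> t0; have := lt0r_neq0 (step_den_gt0 t).
by rewrite /step /step_den (flat_le0 0 (x := - t)) ?oppr_le0// addr0 => /divff.
Qed.

Lemma step_ge0 t : 0 <= step t.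
Proof. by rewrite divr_ge0 ?flat_ge0// ltW// step_den_gt0. Qed.

Lemma step_le1 t : step t <= 1.
Proof. by rewrite ler_pdivrMr ?step_den_gt0// mul1r lerDl flat_ge0. Qed.

Lemma bump_ge0 t : 0 <= bump t.
Proof.
by rewrite divr_ge0 ?sqr_ge0// addr_ge0// mulr_ge0// flat_ge0.
Qed.

Lemma bump_le t : bump t <= bump_bound.
Proof.
rewrite ler_pdivrMr ?exprn_gt0 ?step_den_gt0//.
have h : 4 <= bump_bound * step_den t ^+ 2.
  have h1 : 1 <= (expR 2 * step_den t) ^+ 2.
    rewrite exprn_ege1//; have := step_den_ge t; rewrite expRN.
    by rewrite -[X in _ -> X <= _](mulfV (lt0r_neq0 (expR_gt0 2))) ler_pM2l// expR_gt0.
  by rewrite /bump_bound -mulrA -exprMn ler_peMr.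
apply: le_trans h; have -> : (4 : R) = 2 * 1 + 1 * 2 by ring.
by apply: lerD; apply: ler_pM; rewrite ?flat_ge0 ?flat0_le1// (flatS_le 1).
Qed.

Lemma bump_out t : (t < -1) || (0 < t) -> bump t = 0.
Proof.
move=> /orP[t1|t0]; rewrite /bump.
  by rewrite !(flat_le0 _ (x := 1 + t)) ?mul0r ?addr0 ?mul0r//; lra.
by rewrite !(flat_le0 _ (x := - t)) ?mulr0 ?addr0 ?mul0r//; lra.
Qed.

Lemma continuous_bump : continuous bump.
Proof.
have c1 k : continuous (fun t => flat k (1 + t)).
  move=> t; apply: (@continuous_comp _ _ _ (fun t => 1 + t) (flat k)).
    by apply: cvgD; [exact: cvg_cst|exact: cvg_id].
  exact: continuous_flat.
have c2 k : continuous (fun t => flat k (- t)).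
  move=> t; apply: (@continuous_comp _ _ _ (fun t => - t) (flat k)).
    exact: oppr_continuous.
  exact: continuous_flat.
have cd : continuous step_den by move=> t; exact: (cvgD (c1 0 t) (c2 0 t)).
move=> t; apply: cvgM.
  exact: (cvgD (cvgM (c1 2 t) (c2 0 t)) (cvgM (c1 0 t) (c2 2 t))).
have d0 : step_den t ^+ 2 != 0 by rewrite expf_neq0// gt_eqF// step_den_gt0.
apply: (cvgV d0); rewrite expr2; exact: (cvgM (cd t) (cd t)).
Qed.

Lemma is_derive_step t : is_derive t 1 step (bump t).
Proof.
have d1 k : is_derive t 1 (fun t => flat k (1 + t)) (- k%:R * flat k.+1 (1 + t) + flat k.+2 (1 + t)).
  have dD : is_derive t 1 (fun t : R => 1 + t) 1.
    rewrite -[X in is_derive _ _ _ X]add0r.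
    exact: (is_deriveD (is_derive_cst (1 : R) t 1) (is_derive_id t 1)).
  have := @is_derive1_comp R (flat k) (fun t => 1 + t) t _ _ (is_derive_flat k (1 + t)) dD.
  by rewrite mulr1.
have d2 k : is_derive t 1 (fun t => flat k (- t)) (- (- k%:R * flat k.+1 (- t) + flat k.+2 (- t))).
  have := @is_derive1_comp R (flat k) (fun t => - t) t _ _ (is_derive_flat k (- t)) (is_deriveNid t 1).
  by rewrite mulrN1.
have dd := is_deriveD (d1 0) (d2 0).
have dn0 : step_den t != 0 by rewrite gt_eqF// step_den_gt0.
have dV := @is_deriveV R step_den t _ _ dn0 dd.
have dM := is_deriveM (d1 0) dV.
apply: (is_derive_eq dM); rewrite /bump /GRing.scale/= -exprVn; set q := (step_den t)^-1.
have qE : q * (flat 0 (1 + t) + flat 0 (- t)) = 1 by rewrite mulVf.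
rewrite oppr0 !mul0r !add0r.
have -> : q * flat 2 (1 + t) = q ^+ 2 * (flat 0 (1 + t) + flat 0 (- t)) * flat 2 (1 + t).
  by rewrite expr2 -[q * q * _]mulrA qE mulr1.
by ring.
Qed.

Definition stepr r t := step (r^-1 * t).

Definition bumpr r t := r^-1 * bump (r^-1 * t).

Lemma bumpr_ge0 r t : 0 <= r -> 0 <= bumpr r t.
Proof. by move=> r0; rewrite mulr_ge0 ?invr_ge0// bump_ge0. Qed.

Lemma bumpr_le r t : 0 <= r -> bumpr r t <= bump_bound / r.
Proof. by move=> r0; rewrite /bumpr mulrC ler_wpM2r ?invr_ge0// bump_le. Qed.

Lemma bumpr_out r t : 0 < r -> r < `|t| -> bumpr r t = 0.
Proof.
move=> r0 rt; rewrite /bumpr bump_out ?mulr0//.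
rewrite mulrC ltr_pdivrMr// pmulr_lgt0 ?invr_gt0// mulN1r.
by move: rt; rewrite ltr_normr => /orP[h|h]; apply/orP; [right|left]; lra.
Qed.

Lemma stepr_ge0 r t : 0 <= stepr r t. Proof. exact: step_ge0. Qed.

Lemma stepr_le1 r t : stepr r t <= 1. Proof. exact: step_le1. Qed.

Lemma stepr_ge r t : 0 < r -> 0 <= t -> stepr r t = 1.
Proof. by move=> r0 t0; rewrite /stepr step_ge// mulr_ge0// invr_ge0 ltW. Qed.

Lemma stepr_le r t : 0 < r -> t <= - r -> stepr r t = 0.
Proof. by move=> r0 tr; rewrite /stepr step_le// mulrC ler_pdivrMr// mulN1r. Qed.

Lemma continuous_bumpr r : continuous (bumpr r).
Proof.
move=> t; apply: cvgM; first exact: cvg_cst.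
apply: (@continuous_comp _ _ _ (fun t => r^-1 * t) bump); last exact: continuous_bump.
exact: mulrl_continuous.
Qed.

Lemma is_derive_stepr r t : is_derive t 1 (stepr r) (bumpr r t).
Proof.
have dZ : is_derive t 1 (fun t : R => r^-1 * t) r^-1.
  have d := is_deriveM (is_derive_cst (r^-1) t (1 : R)) (is_derive_id t 1).
  by apply: (is_derive_eq d); rewrite scaler0 addr0 /GRing.scale/= mulr1.
have := @is_derive1_comp R step (fun t => r^-1 * t) t _ _ (is_derive_step _) dZ.
by rewrite mulrC.
Qed.

Lemma integral_bumpr r a b y : a <= b ->
  (\int[lebesgue_measure]_(x in `]a, b]) (bumpr r (x - y))%:E =
  (stepr r (b - y) - stepr r (a - y))%:E)%E.
Proof.
rewrite le_eqVlt => /orP[/eqP ->|ab].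
  by rewrite subrr set_itvoc0 integral_set0.
have cB : continuous (fun x : R => bumpr r (x - y)).
  move=> x; apply: (@continuous_comp _ _ _ (fun x => x - y) (bumpr r)).
    by apply: cvgB; [exact: cvg_id|exact: cvg_cst].
  exact: continuous_bumpr.
have dS (x : R) : is_derive x 1 (fun x : R => stepr r (x - y)) (bumpr r (x - y)).
  have dB : is_derive x 1 (fun x : R => x - y) 1.
    rewrite -[X in is_derive _ _ _ X]subr0.
    exact: (is_deriveB (is_derive_id x 1) (is_derive_cst y x 1)).
  have := @is_derive1_comp R (stepr r) (fun x => x - y) x _ _ (is_derive_stepr r (x - y)) dB.
  by rewrite mulr1.
have cS : continuous (fun x : R => stepr r (x - y)).
  move=> x; apply: differentiable_continuous; apply/derivable1_diffP.
  by have [] := dS x.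
rewrite integral_itv_obnd_cbnd; last first.
  by apply/measurable_EFinP; apply: measurable_funTS; exact: continuous_measurable_fun.
rewrite (@continuous_FTC2 _ _ (fun x => stepr r (x - y)))//.
- exact: continuous_subspaceT.
- split.
  + by move=> x _; have [] := dS x.
  + by apply: cvg_at_right_filter; exact: cS.
  + by apply: cvg_at_left_filter; exact: cS.
- by move=> x _; rewrite derive1E; have [] := dS x.
Qed.

End step.

(** The factors are replaced one at a time: [P k] is the product after [k] replacements. *)
Lemma prod_telescope (R : comPzRingType) N (a b : 'I_N -> R) :
  \prod_i a i - \prod_i b i =
  \sum_(i < N) (\prod_(l < N | l != i) (if (l < i)%N then a l else b l)) * (a i - b i).
Proof.
pose P k := \prod_(l < N) (if (l < k)%N then a l else b l).
have -> : \prod_i a i = P N by apply: eq_bigr => l _; rewrite ltn_ord.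
have -> : \prod_i b i = P 0%N by apply: eq_bigr.
rewrite -(telescope_sumr P (leq0n N)) big_mkord; apply: eq_bigr => i _.
rewrite /P (bigD1 i)//= ltnSn [in X in _ - X](bigD1 i)//= ltnn mulrBr.
congr (_ - _); rewrite mulrC; congr (_ * _); apply: eq_bigr => l li.
by rewrite ltnS leq_eqVlt (inj_eq val_inj) (negPf li).
Qed.

Section kernel.
Context {R : realType} {N : nat}.
Local Notation V := 'rV[R]_N.
Local Notation e_ i := (delta_mx ord0 i : V).
Implicit Types (x y : V) (r : R).

Lemma is_derive_invariant (f : V -> R) (v : V) y :
  (forall h : R, f (h *: v + y) = f y) -> is_derive y v f 0.
Proof.
move=> fv.
have E : (fun h : R => h^-1 *: ((f \o shift y) (h *: v) - f y)) = cst 0.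
  by apply/funext => h; rewrite /= fv subrr scaler0.
have c : (fun h : R => h^-1 *: ((f \o shift y) (h *: v) - f y)) @ 0^' --> (0 : R).
  by rewrite E; exact: cvg_cst.
apply: DeriveDef; first by apply/cvg_ex; exists 0.
exact: cvg_lim c.
Qed.

Lemma smooth_stepr r (f : V -> R) : smooth_fun f -> smooth_fun (fun y => stepr r (f y)).
Proof.
move=> sf; have sZ : smooth_fun (fun y => r^-1 * f y).
  by apply: smoothM => //; exact: smooth_cst.
have s1 : smooth_fun (fun y => flat 0 (1 + r^-1 * f y)).
  by apply: smooth_flat; apply: smoothD => //; exact: smooth_cst.
have s2 : smooth_fun (fun y => flat 0 (- (r^-1 * f y))).
  by apply: smooth_flat; exact: smoothN.
apply: smoothM => //; apply: smoothV; first exact: smoothD.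
by move=> y; rewrite gt_eqF// (step_den_gt0 (r^-1 * f y)).
Qed.

Lemma smooth_bumpr r (f : V -> R) : smooth_fun f -> smooth_fun (fun y => bumpr r (f y)).
Proof.
move=> sf; have sZ : smooth_fun (fun y => r^-1 * f y).
  by apply: smoothM => //; exact: smooth_cst.
have s1 k : smooth_fun (fun y => flat k (1 + r^-1 * f y)).
  by apply: smooth_flat; apply: smoothD => //; exact: smooth_cst.
have s2 k : smooth_fun (fun y => flat k (- (r^-1 * f y))).
  by apply: smooth_flat; exact: smoothN.
apply: smoothM; first exact: smooth_cst.
apply: smoothM; first by apply: smoothD; exact: smoothM.
apply: smoothV; first by apply: (smoothX 2); exact: smoothD.
by move=> y; rewrite expf_neq0// gt_eqF// (step_den_gt0 (r^-1 * f y)).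
Qed.

Definition kern r x y : R := \prod_i bumpr r (x ord0 i - y ord0 i).

(* [mixed i] interpolates between the kernels at scales [r] and [r / 2]; replacing
   [bumpr] by its primitive in the coordinate [i] turns the difference of the two
   kernels into a divergence. *)
Definition mixed_factor (i : 'I_N) r x y : R := \prod_(l < N | l != i)
  (if (l < i)%N then bumpr (r / 2) (x ord0 l - y ord0 l)
   else bumpr r (x ord0 l - y ord0 l)).

Definition mixed (i : 'I_N) r x y : R := mixed_factor i r x y *
  (stepr (r / 2) (x ord0 i - y ord0 i) - stepr r (x ord0 i - y ord0 i)).

Let smooth_sub x i : smooth_fun (fun y => x ord0 i - y ord0 i).
Proof. by apply: smoothB; [exact: smooth_cst|exact: smooth_coord]. Qed.

Lemma smooth_kern r x : smooth_fun (kern r x).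
Proof. by apply: smooth_prod => i; exact: smooth_bumpr. Qed.

Lemma smooth_mixed i r x : smooth_fun (mixed i r x).
Proof.
apply: smoothM; last by apply: smoothB; exact: smooth_stepr.
by apply: smooth_prod => l; case: (l < i)%N; exact: smooth_bumpr.
Qed.

Lemma kern_ge0 r x y : 0 <= r -> 0 <= kern r x y.
Proof. by move=> r0; apply: prodr_ge0 => i _; exact: bumpr_ge0. Qed.

Lemma kern_le r x y : 0 <= r -> kern r x y <= (bump_bound / r) ^+ N.
Proof.
move=> r0; rewrite -[X in _ ^+ X]card_ord -prodr_const.
by apply: ler_prod => i _; rewrite bumpr_ge0// bumpr_le.
Qed.

Lemma kern_out r x y : 0 < r -> ~ cube x r y -> kern r x y = 0.
Proof.
move=> r0 /existsNP[i /negP]; rewrite -ltNge distrC => ri.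
by rewrite /kern (bigD1 i)//= bumpr_out// mul0r.
Qed.

Lemma mixed_out i r x y : 0 < r -> ~ cube x r y -> mixed i r x y = 0.
Proof.
move=> r0 /existsNP[l /negP]; rewrite -ltNge distrC => rl.
have r2 : 0 < r / 2 by rewrite divr_gt0.
have r2r : r / 2 < r by lra.
(* In the coordinate [i], beyond distance [r], both primitives are 1 or both are 0, because the two
   bumps have the same integral. This is why [mixed] has compact support. *)
have [li|li] := eqVneq l i.
  move: rl; rewrite li /mixed ltr_normr => /orP[h|h].
    by rewrite !stepr_ge ?subrr ?mulr0//; lra.
  by rewrite !stepr_le ?subrr ?mulr0//; lra.
rewrite /mixed /mixed_factor (bigD1 l)//=.
by case: ifP => _; rewrite bumpr_out// ?mul0r//; lra.
Qed.

(** One factor 1/r fewer than in [kern_le], because a primitive stays in [0, 1]; the 2 covers the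
    factors at scale r/2. *)
Lemma mixed_le i r x y : 0 < r ->
  `|mixed i r x y| <= (2 * bump_bound / r) ^+ N.-1.
Proof.
move=> r0; have r2 : 0 < r / 2 by rewrite divr_gt0.
have B0 : 0 <= bump_bound :> R by rewrite mulr_ge0 ?exprn_ge0// expR_ge0.
rewrite normrM -[leRHS]mulr1 ler_pM//; last first.
  rewrite ler_norml; have := stepr_ge0 r (x ord0 i - y ord0 i).
  have := stepr_ge0 (r / 2) (x ord0 i - y ord0 i).
  have := stepr_le1 r (x ord0 i - y ord0 i).
  by have := stepr_le1 (r / 2) (x ord0 i - y ord0 i); lra.
have -> : N.-1 = #|[pred l : 'I_N | l != i]|.
  by have := cardC1 i; rewrite card_ord => <-; apply: eq_card => l; rewrite !inE.
rewrite -prodr_const /mixed_factor normr_prod; apply: ler_prod => l _.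
rewrite normr_ge0/=; case: ifP => _; rewrite ger0_norm ?bumpr_ge0// ?(ltW r2) ?(ltW r0)//.
  rewrite (le_trans (bumpr_le _ (ltW r2)))// invfM invrK.
  by rewrite (_ : _ * (_ * _) = 2 * bump_bound / r)//; ring.
rewrite (le_trans (bumpr_le _ (ltW r0)))// ler_wpM2r ?invr_ge0 ?(ltW r0)//.
by rewrite ler_peMl// ler1n.
Qed.

Lemma test_supported (Omega : set V) r x (f : V -> R) : 0 <= r -> cube x r `<=` Omega ->
  smooth_fun f -> (forall y, ~ cube x r y -> f y = 0) -> test_fun Omega f.
Proof.
move=> r0 xO sf f0; split => //; exists (cube x r); split => //.
exact: cube_compact.
Qed.

Lemma test_kern (Omega : set V) r x : 0 < r -> cube x r `<=` Omega ->
  test_fun Omega (kern r x).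
Proof.
move=> r0 xO; apply: (test_supported (ltW r0) xO (smooth_kern r x)) => y.
exact: kern_out.
Qed.

Lemma test_mixed (Omega : set V) i r x : 0 < r -> cube x r `<=` Omega ->
  test_fun Omega (mixed i r x).
Proof.
move=> r0 xO; apply: (test_supported (ltW r0) xO (smooth_mixed i r x)) => y.
exact: mixed_out.
Qed.

Lemma partial_mixed i r x : partial i (mixed i r x) = fun y =>
  - (mixed_factor i r x y * (bumpr (r / 2) (x ord0 i - y ord0 i) - bumpr r (x ord0 i - y ord0 i))).
Proof.
apply: partialE => y.
have dA : is_derive y (e_ i) (mixed_factor i r x) 0.
  apply: is_derive_invariant => h; apply: eq_bigr => l li.
  by rewrite !mxE eqxx (negPf li) mulr0 add0r.
have dS s : is_derive y (e_ i) (fun y => stepr s (x ord0 i - y ord0 i))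
    (- bumpr s (x ord0 i - y ord0 i)).
  have dB : is_derive y (e_ i) (fun y : V => x ord0 i - y ord0 i) (-1).
    rewrite -[X in is_derive _ _ _ X]sub0r.
    have := is_derive_coord i i y; rewrite eqxx => d.
    exact: (is_deriveB (is_derive_cst (x ord0 i) y (e_ i)) d).
  have := is_derive_comp1 dB (is_derive_stepr s (x ord0 i - y ord0 i)).
  by rewrite mulrN1.
have dM := is_deriveM dA (is_deriveB (dS (r / 2)) (dS r)).
by apply: (is_derive_eq dM); rewrite scaler0 addr0 /GRing.scale/=; ring.
Qed.

Lemma partial_mixed_out i r x y : 0 < r -> ~ cube x r y -> partial i (mixed i r x) y = 0.
Proof.
move=> r0 /existsNP[l /negP]; rewrite -ltNge distrC partial_mixed => rl.
have r2 : 0 < r / 2 by rewrite divr_gt0.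
have r2r : r / 2 < r by lra.
have [li|li] := eqVneq l i.
  by rewrite -li !bumpr_out ?subrr ?mulr0 ?oppr0//; lra.
rewrite /mixed_factor (bigD1 l)//=.
by case: ifP => _; rewrite bumpr_out ?mul0r ?oppr0//; lra.
Qed.

Lemma test_partial_mixed (Omega : set V) i r x : 0 < r -> cube x r `<=` Omega ->
  test_fun Omega (partial i (mixed i r x)).
Proof.
move=> r0 xO; apply: (test_supported (ltW r0) xO) => [|y]; last exact: partial_mixed_out.
by apply/smooth_funP; apply: smooth_partial; apply/smooth_funP; exact: smooth_mixed.
Qed.

Lemma kern_telescope r x y :
  kern (r / 2) x y - kern r x y = - \sum_i partial i (mixed i r x) y.
Proof.
rewrite /kern prod_telescope -sumrN; apply: eq_bigr => i _.
by rewrite partial_mixed opprK.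
Qed.

End kernel.

Lemma Rintegral_sum d (T : measurableType d) (R : realType)
    (mu : {measure set T -> \bar R}) (D : set T) (I : Type) (s : seq I) (f : I -> T -> R) :
  measurable D -> (forall i, mu.-integrable D (EFin \o f i)) ->
  \int[mu]_(x in D) (\sum_(i <- s) f i x) = \sum_(i <- s) \int[mu]_(x in D) f i x.
Proof.
move=> mD fi; elim: s => [|i s IH].
  by under eq_Rintegral do rewrite big_nil; rewrite Rintegral_cst// mul0r big_nil.
under eq_Rintegral do rewrite big_cons.
rewrite RintegralD ?IH ?big_cons//.
rewrite (_ : _ \o _ = fun x => (\sum_(i <- s) (f i x)%:E)%E); first by apply: integrable_sum => // j _; exact: fi.
by apply/funext => x /=; rewrite sumEFin.
Qed.

Section mollification.
Context {R : realType} {N : nat}.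
Local Notation V := 'rV[R]_N.
Local Notation mu := (lebesgue_rV N).
Implicit Types (x y a : V) (r : R) (Omega : set V).

Lemma integral_restrict (D E : set V) (f : V -> \bar R) : E `<=` D ->
  (forall y, D y -> ~ E y -> f y = 0%E) ->
  (\int[mu]_(y in D) f y = \int[mu]_(y in E) f y)%E.
Proof.
move=> ED f0; rewrite integral_mkcond [RHS]integral_mkcond; apply: eq_integral => y _.
rewrite /patch; have [Dy|Dy] := boolP (y \in D); have [Ey|Ey] := boolP (y \in E) => //.
  by apply: f0; [exact/set_mem|move=> /mem_set; exact/negP].
by move: Ey => /set_mem /ED /mem_set; rewrite (negPf Dy).
Qed.

(* Weighted AM-GM: [|h| <= c h^2 + 1 / c]. *)
Lemma L1_cube_le Omega (h : V -> R) x r c :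
  measurable Omega -> measurable_fun Omega h -> 0 <= r -> 0 < c ->
  cube x r `<=` Omega ->
  (\int[mu]_(y in cube x r) `|h y|%:E <=
   c%:E * \int[mu]_(y in cube x r) (h y ^+ 2)%:E + (c^-1 * (2 * r) ^+ N)%:E)%E.
Proof.
move=> mO mh r0 c0 xO; have mQ := measurable_cube x r.
have mhQ : measurable_fun (cube x r) h by exact: measurable_funS mh.
have mh2 : measurable_fun (cube x r) (fun y => (h y ^+ 2)%:E).
  by apply/measurable_EFinP; exact: measurable_funX.
rewrite EFinM -(lebesgue_cube x)// -(integral_cst _ mQ) -ge0_integralZl//; last 2 first.
- by move=> y _; rewrite lee_fin sqr_ge0.
- by rewrite lee_fin ltW.
rewrite -ge0_integralD//; last 3 first.
- by move=> y _; rewrite -EFinM lee_fin mulr_ge0 ?sqr_ge0// ltW.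
- exact: measurable_funeM.
- by move=> y _; rewrite lee_fin invr_ge0 ltW.
apply: ge0_le_integral => //.
- by apply/measurable_EFinP; exact: measurableT_comp.
- by apply: emeasurable_funD; [exact: measurable_funeM|exact: measurable_cst].
- move=> y _; rewrite -EFinM -EFinD lee_fin.
  have h2 : h y ^+ 2 = `|h y| ^+ 2 by rewrite real_normK ?num_real.
  rewrite h2; have h0 := normr_ge0 (h y); move: (`|h y|) h0 => s s0.
  have : 0 <= c * (s - c^-1) ^+ 2 + s by rewrite addr_ge0// mulr_ge0 ?sqr_ge0// ltW.
  rewrite (_ : _ * _ + s = c * s ^+ 2 + c^-1 - s); first by rewrite subr_ge0.
  by field; rewrite gt_eqF.
Qed.

Lemma L1_cube_lty Omega (h : V -> R) x r : L2 Omega h -> measurable Omega -> 0 <= r ->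
  cube x r `<=` Omega -> (\int[mu]_(y in cube x r) `|h y|%:E < +oo)%E.
Proof.
move=> [mh hoo] mO r0 xO; apply: le_lt_trans (L1_cube_le mO mh r0 ltr01 xO) _.
rewrite mul1e lte_add_pinfty ?ltry//; apply: le_lt_trans hoo.
apply: ge0_subset_integral => //; first exact: measurable_cube.
  by apply/measurable_EFinP; exact: measurable_funX.
by move=> y _; rewrite lee_fin sqr_ge0.
Qed.

Lemma integrable_mul_cube Omega (h k : V -> R) x r B : L2 Omega h -> measurable Omega ->
  0 <= r -> cube x r `<=` Omega -> measurable_fun setT k -> (forall y, `|k y| <= B) ->
  (forall y, ~ cube x r y -> k y = 0) ->
  mu.-integrable Omega (fun y => (h y * k y)%:E) /\
  (`|\int[mu]_(y in Omega) (h y * k y)|%:E <=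
    B%:E * \int[mu]_(y in cube x r) `|h y|%:E)%E.
Proof.
move=> L2h mO r0 xO mk kB k0; have [mh _] := L2h.
have B0 : 0 <= B by exact: le_trans (normr_ge0 _) (kB x).
have mhk : measurable_fun Omega (fun y => (h y * k y)%:E).
  by apply/measurable_EFinP; apply: measurable_funM => //; exact: measurable_funTS.
have mhQ : measurable_fun (cube x r) (fun y => `|h y|%:E).
  apply/measurable_EFinP; apply: measurableT_comp => //.
  exact: measurable_funS mh.
have le : (\int[mu]_(y in Omega) `|(h y * k y)%:E| <= B%:E * \int[mu]_(y in cube x r) `|h y|%:E)%E.
  rewrite (integral_restrict xO); last by move=> y _ /k0 ->; rewrite mulr0 abse0.
  rewrite -ge0_integralZl//; last exact: measurable_cube.
  apply: ge0_le_integral => //.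
  - exact: measurable_cube.
  - apply: measurableT_comp => //; exact: measurable_funS mhk.
  - exact: measurable_funeM.
  - by move=> y _; rewrite abse_EFin -EFinM lee_fin normrM mulrC ler_wpM2r.
have int : mu.-integrable Omega (fun y => (h y * k y)%:E).
  apply/integrableP; split => //; apply: le_lt_trans le _.
  by rewrite lte_mul_pinfty//; exact: L1_cube_lty L2h mO r0 xO.
split => //; apply: le_trans le.
rewrite -abse_EFin; rewrite /Rintegral fineK; last exact: integrable_fin_num.
exact: le_abse_integral.
Qed.

Definition mollify Omega (u : V -> R) r x : R :=
  \int[mu]_(y in Omega) (u y * kern r x y).

Lemma measurable_kern r x : measurable_fun setT (kern r x).
Proof. exact: smooth_measurable (smooth_kern r x). Qed.

Lemma measurable_mixed i r x : measurable_fun setT (mixed i r x).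
Proof. exact: smooth_measurable (smooth_mixed i r x). Qed.

Lemma mollify_bound Omega u r x : L2 Omega u -> measurable Omega -> 0 < r ->
  cube x r `<=` Omega ->
  mu.-integrable Omega (fun y => (u y * kern r x y)%:E) /\
  (`|mollify Omega u r x|%:E <=
    ((bump_bound / r) ^+ N)%:E * \int[mu]_(y in cube x r) `|u y|%:E)%E.
Proof.
move=> L2u mO r0 xO; apply: integrable_mul_cube => //; first exact: ltW.
- exact: measurable_kern.
- by move=> y; rewrite ger0_norm ?kern_ge0 ?kern_le// ltW.
- by move=> y; exact: kern_out.
Qed.

(** By [kern_telescope] the difference of the kernels is minus the divergence of the test functions
    [mixed]. The weak gradient absorbs the derivatives, so that the estimate rests on [mixed_le] and
    not on the size of a derivative of the kernel. *)
Lemma mollify_diff Omega u g r x : open Omega -> L2 Omega u -> L2_gradient Omega u g ->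
  0 < r -> cube x r `<=` Omega ->
  (`|mollify Omega u (r / 2) x - mollify Omega u r x|%:E <=
    ((2 * bump_bound / r) ^+ N.-1)%:E * \int[mu]_(y in cube x r) (\sum_i `|g i y|)%:E)%E.
Proof.
move=> oO L2u gu r0 xO; have mO := measurable_open_rV oO.
have r2 : 0 < r / 2 by rewrite divr_gt0.
have xO2 : cube x (r / 2) `<=` Omega.
  by apply: subset_trans xO; apply: cubeS; lra.
have [i2 _] := mollify_bound L2u mO r2 xO2.
have [i1 _] := mollify_bound L2u mO r0 xO.
have mx i := integrable_mul_cube (gu i).1 mO (ltW r0) xO (measurable_mixed i r x)
  (mixed_le i x ^~ r0) (fun y => @mixed_out _ _ i r x y r0).
have tm i := test_mixed i r0 xO.
have E : mollify Omega u (r / 2) x - mollify Omega u r x =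
    \sum_i \int[mu]_(y in Omega) (g i y * mixed i r x y).
  rewrite /mollify -RintegralB//.
  under eq_Rintegral do rewrite -mulrBr kern_telescope mulrN mulr_sumr.
  have ip i : mu.-integrable Omega (fun y => (u y * partial i (mixed i r x) y)%:E).
    have [B B0 pB] := test_fun_bounded (test_partial_mixed i r0 xO).
    have mp : measurable_fun setT (partial i (mixed i r x)).
      by apply: smooth_measurable; case: (test_partial_mixed i r0 xO).
    have [] // := integrable_mul_cube L2u mO (ltW r0) xO mp pB.
    by move=> y; exact: partial_mixed_out.
  under eq_Rintegral do rewrite -mulN1r.
  rewrite RintegralZl//; last first.
    under [X in mu.-integrable _ X]eq_fun do rewrite /= -sumEFin.
    by apply: integrable_sum => // i _; exact: ip.
  rewrite Rintegral_sum// mulr_sumr; apply: eq_bigr => i _.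
  have [_ ->] := gu i; first by rewrite mulN1r opprK.
  exact/test_funP.
rewrite E; apply: (@le_trans _ _ (\sum_i `|\int[mu]_(y in Omega) (g i y * mixed i r x y)|%:E)%E).
  by rewrite sumEFin lee_fin ler_norm_sum.
apply: (@le_trans _ _ (\sum_i ((2 * bump_bound / r) ^+ N.-1)%:E * \int[mu]_(y in cube x r) `|g i y|%:E)%E).
  by apply: lee_sum => i _; have [_] := mx i.
have mgi i : measurable_fun (cube x r) (fun y => `|g i y|%:E).
  apply/measurable_EFinP; apply: measurableT_comp => //.
  by apply: (measurable_funS mO xO); have [[]] := gu i.
have mQ := measurable_cube x r.
rewrite -ge0_sume_distrr; last by move=> i _; exact: integral_ge0.
rewrite -ge0_integral_sum//; under eq_integral do rewrite sumEFin.
exact: lexx.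
Qed.

End mollification.

(** * Integrals over moving cubes *)

Section cube_integral.
Context {R : realType} {N : nat}.
Local Notation V := 'rV[R]_N.
Local Notation mu := (lebesgue_rV N).
Variables (G : V -> R) (D : set V).
Hypotheses (mD : measurable D) (mG : measurable_fun D G) (G0 : forall y, 0 <= G y).

Let near_set (r : R) : set (V * V) := [set p | cube p.1 r p.2].

Lemma measurable_near_set r : measurable (near_set r).
Proof.
pose f (i : 'I_N) (p : V * V) := p.2 ord0 i - p.1 ord0 i.
have mf i : measurable_fun setT (f i).
  apply: measurable_funB.
    exact: measurableT_comp (measurable_coord_rV i) measurable_snd.
  exact: measurableT_comp (measurable_coord_rV i) measurable_fst.
rewrite (_ : near_set r = \bigcap_(i in [set: 'I_N]) (f i @^-1` `[(- r), r]%classic)).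
  apply: fin_bigcap_measurable => // i _.
  by rewrite -[X in measurable X]setTI; apply: mf => //; exact: measurable_itv.
apply/seteqP; split => p /= h => [i _|i]; first by rewrite /= in_itv/= -ler_norml; exact: h.
by have := h i I; rewrite /= in_itv/= -ler_norml.
Qed.

(** Written with the indicator of a measurable subset of [V * V], so that measurability in [x] and
    Tonelli apply; [cube_integralE] recovers the plain integral for cubes inside [D]. *)
Definition cube_integral r x : \bar R :=
  (\int[mu]_y (\1_(near_set r) (x, y) * (G \_ D) y)%:E)%E.

Let GD0 y : 0 <= (G \_ D) y.
Proof. by rewrite /patch; case: ifP. Qed.

Let mGD : measurable_fun setT (G \_ D).
Proof. exact/(measurable_restrictT _ _).1. Qed.

Let F r (p : V * V) : \bar R := (\1_(near_set r) p * (G \_ D) p.2)%:E.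

Let F0 r p : (0 <= F r p)%E.
Proof. by rewrite lee_fin mulr_ge0// indicE. Qed.

Let mF r : measurable_fun setT (F r).
Proof.
apply/measurable_EFinP; apply: measurable_funM.
  exact: measurable_indic (measurable_near_set r).
exact: measurableT_comp mGD measurable_snd.
Qed.

Lemma measurable_cube_integral r : measurable_fun setT (cube_integral r).
Proof.
exact: (@measurable_fun_fubini_tonelli_F _ _ V V R mu (F r) (mF r) (F0 r)).
Qed.

Lemma cube_integral_ge0 r x : (0 <= cube_integral r x)%E.
Proof. by apply: integral_ge0 => y _; rewrite lee_fin mulr_ge0// indicE. Qed.

Lemma cube_integralE r x : cube x r `<=` D ->
  cube_integral r x = (\int[mu]_(y in cube x r) (G y)%:E)%E.
Proof.
move=> xD; rewrite [RHS]integral_mkcond; apply: eq_integral => y _.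
rewrite /patch indicE.
have [xy|xy] := boolP (y \in cube x r).
  have Sxy : (x, y) \in near_set r by apply/mem_set; exact/set_mem.
  by rewrite Sxy mul1r mem_set//; apply: xD; exact: set_mem.
have Sxy : (x, y) \notin near_set r.
  by apply: contra xy => /set_mem xy; exact/mem_set.
by rewrite (negPf Sxy) mul0r.
Qed.

(** Tonelli and symmetry: [y] lies in the cube about [x] exactly when [x] lies in the cube about
    [y], whose volume is (2r)^N. *)
Lemma integral_cube_integral r : 0 <= r ->
  (\int[mu]_x cube_integral r x = ((2 * r) ^+ N)%:E * \int[mu]_(y in D) (G y)%:E)%E.
Proof.
move=> r0; rewrite /cube_integral (@fubini_tonelli _ _ _ _ _ mu mu (F r))//.
have GE : (fun x => (G x)%:E) \_ D = EFin \o (G \_ D) by rewrite restrict_EFin.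
rewrite [in RHS]integral_mkcond GE -ge0_integralZl//; last 3 first.
- exact/measurable_EFinP.
- by move=> y _; rewrite /= lee_fin.
- by rewrite lee_fin exprn_ge0// mulr_ge0.
apply: eq_integral => y _.
rewrite -(lebesgue_cube y r0) -(setIT (cube y r)) -integral_indic//; last exact: measurable_cube.
rewrite [RHS]muleC -ge0_integralZl//; last 2 first.
- by apply/measurable_EFinP; apply: measurable_indic; exact: measurable_cube.
- by rewrite lee_fin.
apply: eq_integral => x _; rewrite -EFinM /F mulrC /= !indicE; congr (_ * (nat_of_bool _)%:R)%:E.
by apply/idP/idP => /set_mem h; apply/mem_set => i; have := h i; rewrite /= distrC.
Qed.

End cube_integral.

(** * Almost everywhere convergence of the mollifications *)

Section approximate_identity.
Context {R : realType} {N : nat}.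
Local Notation V := 'rV[R]_N.
Local Notation mu := (lebesgue_rV N).
Implicit Types (x y lo hi : V) (r : R).

Definition obox lo hi : set V :=
  [set x | forall i, lo ord0 i < x ord0 i <= hi ord0 i].

Lemma measurable_obox lo hi : measurable (obox lo hi).
Proof.
apply: (measurable_coordwise (P := fun i => [set t | lo ord0 i < t <= hi ord0 i])) => i.
rewrite (_ : [set _ | _] = `]lo ord0 i, hi ord0 i]%classic); first exact: measurable_itv.
by apply/seteqP; split => t /=; rewrite in_itv.
Qed.

Lemma indic_obox lo hi x :
  \1_(obox lo hi) x = \prod_i (\1_(`]lo ord0 i, hi ord0 i]%classic) (x ord0 i)) :> R.
Proof.
rewrite indicE; have [xa|xa] := boolP (x \in obox lo hi).
  rewrite big1// => i _; rewrite indicE mem_set//= in_itv/=.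
  by move: xa => /set_mem; exact.
have /existsNP[i xi] : ~ obox lo hi x by move/mem_set; exact/negP.
by rewrite (bigD1 i)//= indicE memNset ?mul0r//= in_itv/=; exact: xi.
Qed.

Lemma indic_itvE (a b t : R) : \1_(`]a, b]%classic) t = (a < t <= b)%R%:R :> R.
Proof.
rewrite indicE; congr (nat_of_bool _)%:R; apply/idP/idP => [/set_mem|h].
  by rewrite /= in_itv.
by apply/mem_set; rewrite /= in_itv.
Qed.

Lemma measurable_bumpr r : measurable_fun setT (bumpr r : R -> R).
Proof. by apply: continuous_measurable_fun; exact: continuous_bumpr. Qed.

(** The mass that the kernel, as a function of its first point, gives to the box. *)
Definition step_box r lo hi y : R :=
  \prod_i (stepr r (hi ord0 i - y ord0 i) - stepr r (lo ord0 i - y ord0 i)).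

Lemma integral_obox_kern lo hi r y : 0 < r -> (forall i, lo ord0 i <= hi ord0 i) ->
  (\int[mu]_x (\1_(obox lo hi) x * kern r x y)%:E = (step_box r lo hi y)%:E)%E.
Proof.
move=> r0 lohi.
have mb (i : 'I_N) : measurable_fun setT (fun t : R => bumpr r (t - y ord0 i)).
  by apply: (measurableT_comp (measurable_bumpr r)); exact: measurable_funB.
rewrite -(integral_prod_rV (f := fun i t => \1_(`]lo ord0 i, hi ord0 i]%classic) t * bumpr r (t - y ord0 i))).
- by apply: eq_integral => x _; rewrite indic_obox -big_split.
- by move=> i; apply: measurable_funM => //; exact: measurable_indic.
- by move=> i t; rewrite mulr_ge0 ?indicE// bumpr_ge0// ltW.
- move=> i; rewrite -integral_bumpr// [RHS]integral_mkcond.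
  by apply: eq_integral => t _; rewrite restrict_EFin /= patch_indic mulrC.
Qed.

Lemma stepr_mono r a b : 0 < r -> a <= b -> stepr r a <= stepr r b.
Proof.
move=> r0 ab; have := @integral_bumpr R r a b 0 ab; rewrite !subr0 => h.
rewrite -subr_ge0 -lee_fin -h integral_ge0// => t _.
by rewrite lee_fin bumpr_ge0// ltW.
Qed.

Lemma step_box_itv r lo hi y : 0 < r -> (forall i, lo ord0 i <= hi ord0 i) ->
  0 <= step_box r lo hi y <= 1.
Proof.
move=> r0 lohi.
have f0 i : 0 <= stepr r (hi ord0 i - y ord0 i) - stepr r (lo ord0 i - y ord0 i).
  by rewrite subr_ge0 stepr_mono// lerB.
rewrite prodr_ge0//= -[leRHS](expr1n _ N) -[X in _ <= _ ^+ X]card_ord -prodr_const.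
apply: ler_prod => i _; rewrite f0/= lerBlDr.
by rewrite (le_trans (stepr_le1 _ _))// lerDl stepr_ge0.
Qed.

(** At each point, [stepr r] is equal to the indicator of [0, +oo) once [r] is small. Its value 1 at
    0 dictates the half-open shape of [obox], whose indicator is then the limit at every point. *)
Lemma step_box_cvg (r_ : nat -> R) lo hi y :
  (forall j, 0 < r_ j) -> r_ j @[j --> \oo] --> (0 : R) ->
  (forall i, lo ord0 i <= hi ord0 i) ->
  step_box (r_ j) lo hi y @[j --> \oo] --> (\1_(obox lo hi) y : R).
Proof.
move=> r0 rc lohi; apply: cvg_near_cst.
have H t : \forall j \near \oo, stepr (r_ j) t = (0 <= t)%R%:R.
  have [t0|t0] := leP 0 t; first by near=> j; exact: stepr_ge.
  have : \forall j \near \oo, r_ j < - t.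
    by apply: (cvgr_lt _ rc); rewrite oppr_gt0.
  by apply: filterS => j jt; apply: stepr_le => //; lra.
have F := @filter_forall _ 'I_N _ _ (@eventually_filter : Filter (\oo : set_system nat)).
apply: filterS2 (F _ (fun i => H (hi ord0 i - y ord0 i))) (F _ (fun i => H (lo ord0 i - y ord0 i))).
move=> j Hhi Hlo; rewrite indic_obox; apply: eq_bigr => i _.
rewrite Hhi Hlo indic_itvE !subr_ge0.
by have := lohi i; case: (leP (y ord0 i) (hi ord0 i)); case: (leP (y ord0 i) (lo ord0 i)) => /= *; lra.
Unshelve. all: by end_near. Qed.

Section box_average.
Variable w : V -> R.
Hypothesis iw : mu.-integrable setT (EFin \o w).

Let F lo hi r (p : V * V) : \bar R :=
  (\1_(obox lo hi) p.1 * (w p.2 * kern r p.1 p.2))%:E.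

Lemma measurable_kern2 r : measurable_fun setT (fun p : V * V => kern r p.1 p.2).
Proof.
apply: measurable_prod => i _.
apply: (measurableT_comp (measurable_bumpr r)); apply: measurable_funB.
  exact: measurableT_comp (measurable_coord_rV i) measurable_fst.
exact: measurableT_comp (measurable_coord_rV i) measurable_snd.
Qed.

Let mw : measurable_fun setT w.
Proof. by have /integrableP[/measurable_EFinP] := iw. Qed.

Let mF lo hi r : measurable_fun setT (F lo hi r).
Proof.
apply/measurable_EFinP; apply: measurable_funM.
  apply: measurableT_comp measurable_fst.
  by apply: measurable_indic; exact: measurable_obox.
apply: measurable_funM; first exact: measurableT_comp mw measurable_snd.
exact: measurable_kern2.
Qed.

Let F1 lo hi r y : 0 < r -> (forall i, lo ord0 i <= hi ord0 i) ->
  (\int[mu]_x F lo hi r (x, y) = (w y * step_box r lo hi y)%:E)%E.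
Proof.
move=> r0 lohi; rewrite EFinM -integral_obox_kern//.
rewrite -integralZl//; last first.
  apply/integrableP; split.
    apply/measurable_EFinP; apply: measurable_funM.
      by apply: measurable_indic; exact: measurable_obox.
    exact: (measurableT_comp (measurable_kern2 r) (measurable_pair2 y)).
  rewrite (eq_integral (fun x => (\1_(obox lo hi) x * kern r x y)%:E)).
    by rewrite integral_obox_kern// ltry.
  move=> x _; rewrite gee0_abs// lee_fin mulr_ge0 ?kern_ge0 ?indicE//; exact: ltW.
by apply: eq_integral => x _; rewrite -EFinM /F /= mulrCA.
Qed.

Let F2 lo hi r y : 0 < r -> (forall i, lo ord0 i <= hi ord0 i) ->
  (\int[mu]_x `|F lo hi r (x, y)| = (`|w y| * step_box r lo hi y)%:E)%E.
Proof.
move=> r0 lohi; rewrite EFinM -integral_obox_kern//.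
rewrite -ge0_integralZl//; last 2 first.
- apply/measurable_EFinP; apply: measurable_funM.
    by apply: measurable_indic; exact: measurable_obox.
  exact: (measurableT_comp (measurable_kern2 r) (measurable_pair2 y)).
- by move=> x _; rewrite lee_fin mulr_ge0 ?kern_ge0 ?indicE//; exact: ltW.
apply: eq_integral => x _; rewrite -EFinM /F /= mulrCA normrM; congr (_ * _)%:E.
by rewrite ger0_norm// mulr_ge0 ?kern_ge0 ?indicE//; exact: ltW.
Qed.

Let box_average0 lo hi r : 0 < r -> (forall i, lo ord0 i <= hi ord0 i) ->
  mu.-integrable setT (fun x => \int[mu]_y F lo hi r (x, y))%E /\
  (\int[mu]_x \int[mu]_y F lo hi r (x, y) = \int[mu]_y (w y * step_box r lo hi y)%:E)%E.
Proof.
move=> r0 lohi; have /integrableP[_ wf] := iw.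
have iF : (mu \x mu)%E.-integrable setT (F lo hi r).
  apply/(integrable21ltyP mu mu (mF lo hi r)).
  apply: le_lt_trans wf; apply: ge0_le_integral => //.
  - by move=> y _; exact: integral_ge0.
  - under eq_fun do rewrite F2//.
    apply/measurable_EFinP; apply: measurable_funM; first exact: measurableT_comp.
    apply: (measurable_prod_rV (f := fun i t => stepr r (hi ord0 i - t) - stepr r (lo ord0 i - t))) => i.
    have ms c : measurable_fun setT (fun t : R => stepr r (c - t)).
      apply: (measurableT_comp (f := stepr r)); last exact: measurable_funB.
      apply: continuous_measurable_fun => t; apply: differentiable_continuous.
      by apply/derivable1_diffP; have [] := is_derive_stepr r t.
    by apply: measurable_funB; exact: ms.
  - by apply: measurableT_comp => //; exact/measurable_EFinP.
  - move=> y _; rewrite F2// lee_fin ler_piMr//.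
    by have /andP[] := step_box_itv y r0 lohi.
split; first exact: (integrable_fubini_F iF).
rewrite Fubini//; apply: eq_integral => y _; exact: F1.
Qed.

Let mol r x : \bar R := (\int[mu]_y (w y * kern r x y)%:E)%E.

Let mol_patch lo hi r :
  mol r \_ (obox lo hi) = (fun x => \int[mu]_y F lo hi r (x, y))%E.
Proof.
apply/funext => x; rewrite /patch /mol /F; case: ifPn => h.
  by apply: eq_integral => y _; rewrite indicE h mul1r.
by rewrite integral0_eq// => y _; rewrite indicE (negPf h) mul0r.
Qed.

Lemma box_average lo hi r : 0 < r -> (forall i, lo ord0 i <= hi ord0 i) ->
  mu.-integrable (obox lo hi) (mol r) /\
  (\int[mu]_(x in obox lo hi) mol r x = \int[mu]_y (w y * step_box r lo hi y)%:E)%E.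
Proof.
move=> r0 lohi; have [iF EF] := box_average0 r0 lohi; split.
  by apply/(integrable_mkcond _ (measurable_obox lo hi)); rewrite mol_patch.
by rewrite integral_mkcond mol_patch.
Qed.

(** Fubini moves the mollification from [w] to the indicator of the box, where it converges
    boundedly. So averages over boxes converge for every integrable [w]. *)
Lemma box_average_cvg (r_ : nat -> R) lo hi : (forall j, 0 < r_ j) ->
  r_ j @[j --> \oo] --> (0 : R) -> (forall i, lo ord0 i <= hi ord0 i) ->
  (\int[mu]_(x in obox lo hi) mol (r_ j) x)%E @[j --> \oo] -->
  (\int[mu]_(x in obox lo hi) (w x)%:E)%E.
Proof.
move=> r0 rc lohi.
have mlo := measurable_obox lo hi.
have -> : (\int[mu]_(x in obox lo hi) (w x)%:E = \int[mu]_x (w x * \1_(obox lo hi) x)%:E)%E.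
  rewrite integral_mkcond; apply: eq_integral => x _.
  by rewrite restrict_EFin /= patch_indic.
rewrite [X in X @ _ --> _](_ : _ = (fun j => \int[mu]_y (w y * step_box (r_ j) lo hi y)%:E)%E); last first.
  by apply/funext => j; have [] := box_average (r0 j) lohi.
have ms r c : measurable_fun setT (fun t : R => stepr r (c - t)).
  apply: (measurableT_comp (f := stepr r)); last exact: measurable_funB.
  apply: continuous_measurable_fun => t; apply: differentiable_continuous.
  by apply/derivable1_diffP; have [] := is_derive_stepr r t.
have mbox r : measurable_fun setT (step_box r lo hi).
  apply: (measurable_prod_rV (f := fun i t => stepr r (hi ord0 i - t) - stepr r (lo ord0 i - t))) => i.
  by apply: measurable_funB; exact: ms.
have [|||||_ _ +] := @dominated_convergence _ V R mu setT measurableT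
  (fun j y => (w y * step_box (r_ j) lo hi y)%:E) (fun y => (w y * \1_(obox lo hi) y)%:E)
  (fun y => `|w y|%:E).
- by move=> j; apply/measurable_EFinP; apply: measurable_funM.
- by apply/measurable_EFinP; apply: measurable_funM => //; exact: measurable_indic.
- apply: aeW => x _; apply: cvg_EFin; first by near=> j.
  by apply: cvgMr; exact: step_box_cvg.
- exact: (integrable_abse iw).
- apply: aeW => y j _; rewrite abse_EFin lee_fin normrM ler_piMr//.
  by have /andP[s0 s1] := step_box_itv y (r0 j) lohi; rewrite ger0_norm.
- exact.
Unshelve. all: by end_near. Qed.

End box_average.

Definition orthant (t : V) : set V := [set x | forall i, t ord0 i < x ord0 i].

Lemma orthants_sigma : @measurable _ V = <<s range orthant >>.
Proof.
set G := range orthant.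
have sG : sigma_algebra setT <<s G >> by exact: smallest_sigma_algebra.
have mG : G `<=` @measurable _ V.
  move=> _ [t _ <-].
  apply: (measurable_coordwise (P := fun i => [set s | t ord0 i < s])) => i.
  rewrite (_ : [set _ | _] = `]t ord0 i, +oo[%classic); first exact: measurable_itv.
  by apply/seteqP; split => s /=; rewrite in_itv/= andbT.
apply/seteqP; split; last first.
  by apply: smallest_sub => //; exact: sigma_algebra_measurable.
apply: smallest_sub => // A.
rewrite -bigcup_seq => -[i _ [B mB <-]] /=.
have {mB} : (@RGenOInfty.G R).-sigma.-measurable B by rewrite -RGenOInfty.measurableE.
move: B.
apply: (smallest_sub (@sigma_algebra_image _ _ setT (fun v : V => v ord0 i) _ sG)).
move=> _ [t ->]; rewrite /image_set_system /= setTI.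
have [_ _ U] := sG.
(* A half-space is a countable union of orthants: the other coordinates of the corner are sent to
   minus infinity. *)
rewrite (_ : _ @^-1` _ = \bigcup_m [set x : V | forall k, (if k == i then t else - m%:R) < x ord0 k]).
  apply: U => m; apply: sub_sigma_algebra; exists (\row_k (if k == i then t else - m%:R)) => //.
  by apply/seteqP; split => x /= h k; have := h k; rewrite mxE.
apply/seteqP; split => x /=; last first.
  by move=> [m _ /(_ i)]; rewrite /= eqxx in_itv/= andbT.
rewrite in_itv/= andbT => tx.
exists (Num.bound (\sum_k `|x ord0 k|)) => //= k; case: eqP => [->//|_].
rewrite ltrNl; apply: le_lt_trans (ler_norm _) _; rewrite normrN.
apply: le_lt_trans (archi_boundP _); last exact: sumr_ge0.
by rewrite (bigD1 k)//= lerDl sumr_ge0.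
Qed.

(* pi-lambda theorem, for the pi-system of orthants. *)
Lemma ae_eq_obox lo hi (f g : V -> \bar R) : (forall i, lo ord0 i <= hi ord0 i) ->
  mu.-integrable (obox lo hi) f -> mu.-integrable (obox lo hi) g ->
  (forall lo' hi', (forall i, lo' ord0 i <= hi' ord0 i) -> obox lo' hi' `<=` obox lo hi ->
    (\int[mu]_(x in obox lo' hi') f x = \int[mu]_(x in obox lo' hi') g x)%E) ->
  ae_eq mu (obox lo hi) f g.
Proof.
move=> lohi fi gi fg.
have mQ := measurable_obox lo hi.
apply: integral_ae_eq => //; first exact: measurable_int gi.
suff P E : measurable E -> (\int[mu]_(x in E `&` obox lo hi) f x =
    \int[mu]_(x in E `&` obox lo hi) g x)%E.
  by move=> E EQ mE; have := P E mE; rewrite setIidl.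
have fgQ : (\int[mu]_(x in obox lo hi) f x = \int[mu]_(x in obox lo hi) g x)%E.
  exact: fg.
have subi h (A : set V) : measurable A -> A `<=` obox lo hi ->
    mu.-integrable (obox lo hi) h -> mu.-integrable A h.
  by move=> mA AQ; exact: integrableS.
rewrite orthants_sigma; move: E.
apply: (dynkin_induction orthants_sigma).
- move=> _ _ [t _ <-] [t' _ <-]; exists (\row_i Num.max (t ord0 i) (t' ord0 i)) => //.
  apply/esym/seteqP; split => x /=.
    by move=> [h h'] i; rewrite mxE gt_max h h'.
  by move=> h; split => i; have := h i; rewrite mxE gt_max => /andP[].
- by rewrite setTI.
- move=> _ [t _ <-].
  (* The [max] intersects the box with the orthant; the [min] keeps the corners ordered and makes
     the box empty when the orthant misses it. *)
  pose lo' : V := \row_i Num.min (hi ord0 i) (Num.max (lo ord0 i) (t ord0 i)).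
  rewrite (_ : _ `&` _ = obox lo' hi); last first.
    apply/seteqP; split => x /=.
      move=> [tx xQ] i; have /andP[lx xh] := xQ i.
      by rewrite mxE gt_min gt_max lx tx xh orbT.
    move=> h; have K i : (lo ord0 i < x ord0 i <= hi ord0 i) && (t ord0 i < x ord0 i).
      have /andP[] := h i; rewrite mxE gt_min gt_max => /orP[hx|/andP[lx tx]] xh.
        by move: (lt_le_trans hx xh); rewrite ltxx.
      by rewrite lx xh tx.
    by split => i; have /andP[] := K i.
  apply: fg => [i|x xb i]; first by rewrite mxE ge_min lexx.
  have /andP[] := xb i; rewrite mxE gt_min gt_max => /orP[hx|/andP[lx tx]] xh.
    by move: (lt_le_trans hx xh); rewrite ltxx.
  by rewrite lx xh.
- move=> E mE PE.
  have mEQ : measurable (E `&` obox lo hi) by exact: measurableI.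
  have mCQ : measurable (~` E `&` obox lo hi) by apply: measurableI => //; exact: measurableC.
  have QE : obox lo hi = (E `&` obox lo hi) `|` (~` E `&` obox lo hi).
    by rewrite -setIUl setUv setTI.
  have dis : [disjoint E `&` obox lo hi & ~` E `&` obox lo hi].
    by apply/disj_setPS => x [[Ex _] [/= nEx _]].
  have split h : mu.-integrable (obox lo hi) h -> (\int[mu]_(x in obox lo hi) h x =
      \int[mu]_(x in E `&` obox lo hi) h x + \int[mu]_(x in ~` E `&` obox lo hi) h x)%E.
    move=> hi'; rewrite [in LHS]QE integral_setU//.
    by rewrite -QE; exact: measurable_int hi'.
  move: fgQ; rewrite !split// PE => /eqP.
  have fin : (\int[mu]_(x in E `&` obox lo hi) g x)%E \is a fin_num.
    by apply: integrable_fin_num => //; exact: subi.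
  by rewrite eq_le !leeD2lE// -eq_le => /eqP.
- move=> F mF tF PF.
  rewrite setI_bigcupl.
  have sub : \bigcup_k (F k `&` obox lo hi) `<=` obox lo hi by move=> x [k _ []].
  have mU : measurable (\bigcup_k (F k `&` obox lo hi)).
    by apply: bigcup_measurable => k _; exact: measurableI.
  have tU : trivIset setT (fun k => F k `&` obox lo hi).
    by apply: trivIset_setIr.
  rewrite !integral_bigcup//; try exact: subi; try by move=> k; exact: measurableI.
  by apply: eq_eseriesr => k _; exact: PF.
Qed.

(** Convergence and domination are hypotheses here, to be supplied by the sums of the A_j. It
    remains to identify the limit, and its integrals over boxes are those of [w] by dominated
    convergence and [box_average_cvg]. *)
Lemma approximate_identity (w : V -> R) (r_ : nat -> R) lo hi (h : V -> \bar R) :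
  let mol r x := (\int[mu]_y (w y * kern r x y)%:E)%E in
  mu.-integrable setT (EFin \o w) -> (forall j, 0 < r_ j) ->
  r_ j @[j --> \oo] --> (0 : R) -> (forall i, lo ord0 i <= hi ord0 i) ->
  mu.-integrable (obox lo hi) h ->
  {ae mu, forall x, obox lo hi x -> forall j, (`|mol (r_ j) x| <= h x)%E} ->
  {ae mu, forall x, obox lo hi x -> cvgn (fun j => mol (r_ j) x)} ->
  {ae mu, forall x, obox lo hi x -> mol (r_ j) x @[j --> \oo] --> (w x)%:E}.
Proof.
move=> mol iw r0 rc lohi ih molh molc.
have mQ := measurable_obox lo hi.
(* The upper limit is measurable on the whole box and agrees with the limit wherever the latter
   exists. *)
pose v x := limn_esup (fun j => mol (r_ j) x).
have mm j : measurable_fun (obox lo hi) (mol (r_ j)).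
  by have [/measurable_int] := box_average iw (r0 j) lohi.
have mv : measurable_fun (obox lo hi) v by exact: measurable_fun_limn_esup.
have cv : {ae mu, forall x, obox lo hi x -> mol (r_ j) x @[j --> \oo] --> v x}.
  apply: filterS molc => x cx Qx; have c := cx Qx.
  by rewrite /v is_cvg_limn_esupE.
have molh' : {ae mu, forall x j, obox lo hi x -> (`|mol (r_ j) x| <= h x)%E}.
  by apply: filterS molh => x hx j Qx; exact: hx.
have [iv _ _] := dominated_convergence mQ mm mv cv ih molh'.
have vw : ae_eq mu (obox lo hi) v (EFin \o w).
  apply: ae_eq_obox => //; first exact: integrableS iw.
  move=> lo' hi' lohi' sub; have mQ' := measurable_obox lo' hi'.
  have mm' j : measurable_fun (obox lo' hi') (mol (r_ j)) by exact: measurable_funS (mm j).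
  have mv' : measurable_fun (obox lo' hi') v by exact: measurable_funS mv.
  have cv' : {ae mu, forall x, obox lo' hi' x -> mol (r_ j) x @[j --> \oo] --> v x}.
    by apply: filterS cv => x cx /sub.
  have molh'' : {ae mu, forall x j, obox lo' hi' x -> (`|mol (r_ j) x| <= h x)%E}.
    by apply: filterS molh' => x hx j /sub; exact: hx.
  have [_ _ c1] := dominated_convergence mQ' mm' mv' cv' (integrableS mQ mQ' sub ih) molh''.
  have c2 := box_average_cvg iw r0 rc lohi'.
  exact: (cvg_unique _ c1 c2).
apply: filterS2 cv vw => x cx vx Qx.
by have := cx Qx; rewrite (vx Qx).
Qed.

End approximate_identity.

(** * Uniform convergence of the mollifications in L^m *)

Section sequences_tail.
Context {R : realType}.

(** With c = ln (3/2), [flatS_le] at 1 / (c (k+1)) bounds (k+1)^(e+1) by a multiple of (3/2)^(k+1);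
    and 3/2 times 1/2 is still less than 1. *)
Lemma poly_geometric e : exists2 K : R, 0 <= K &
  forall k, k.+1%:R ^+ e * (2^-1) ^+ k <= K * (3 / 4) ^+ k.
Proof.
have c0 : 0 < ln (3 / 2) :> R by rewrite ln_gt0//; lra.
set c := ln _ in c0.
exists (e.+1`!%:R * c^-1 ^+ e.+1 * (3 / 2)) => [|k].
  by rewrite mulr_ge0// mulr_ge0// exprn_ge0// invr_ge0 ltW.
have ck : 0 < (c * k.+1%:R)^-1 by rewrite invr_gt0 mulr_gt0.
have : k.+1%:R ^+ e.+1 <= e.+1`!%:R * c^-1 ^+ e.+1 * (3 / 2) ^+ k.+1.
  have := flatS_le e (c * k.+1%:R)^-1; rewrite /flat ck !invrK expRN.
  rewrite ler_pdivrMr ?expR_gt0// mulrC expRM_natl lnK ?posrE; last by lra.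
  rewrite mulrC exprMn => h.
  rewrite mulrAC -(ler_pM2l (exprn_gt0 e.+1 c0)) (le_trans h)//.
  by rewrite mulrCA -exprMn divff ?gt_eqF// expr1n mulr1 mulrC.
move=> h; have h1 : k.+1%:R ^+ e <= k.+1%:R ^+ e.+1 :> R.
  by rewrite exprS ler_peMl ?exprn_ge0// ler1n.
apply: (@le_trans _ _ (e.+1`!%:R * c^-1 ^+ e.+1 * (3 / 2) ^+ k.+1 * (2^-1) ^+ k)).
  by rewrite ler_wpM2r// ?(le_trans h1)// exprn_ge0.
rewrite [(3 / 2) ^+ k.+1]exprS (_ : 3 / 4 = 3 / 2 * 2^-1); last by lra.
by rewrite [(3 / 2 * 2^-1) ^+ k]exprMn !mulrA.
Qed.

Lemma geometric_sum_le J L : \sum_(k < L) (3 / 4 : R) ^+ (J + k) <= 4 * (3 / 4) ^+ J.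
Proof.
under eq_bigr do rewrite exprD.
rewrite -mulr_sumr mulrC ler_wpM2r ?exprn_ge0//.
suff -> : \sum_(i < L) (3 / 4 : R) ^+ i = 4 - 4 * (3 / 4) ^+ L.
  by rewrite lerBlDr lerDl mulr_ge0// exprn_ge0.
elim: L => [|L IH]; first by rewrite big_ord0 expr0 mulr1 subrr.
by rewrite big_ord_recr/= IH exprS; field.
Qed.

(** Discrete form of d(S^(e+1)) = (e+1) S^e dS: the sum of the first k+1 terms is at most C (k+1),
    so the term a_k increases the power by at most (e+1) (C (k+1))^e a_k. One factor a_k is kept, to
    be integrated later. *)
Lemma expr_sum_le (a : nat -> R) C e L : (forall k, 0 <= a k <= C) ->
  (\sum_(k < L) a k) ^+ e.+1 <= e.+1%:R * C ^+ e * \sum_(k < L) k.+1%:R ^+ e * a k.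
Proof.
move=> aC; have a0 k : 0 <= a k by have /andP[] := aC k.
have C0 : 0 <= C by have /andP[h /(le_trans h)] := aC 0.
elim: L => [|L IH]; first by rewrite !big_ord0 expr0n/= mulr0.
rewrite !big_ord_recr/= mulrDr; set S := \sum_(k < L) a k in IH *.
have S0 : 0 <= S by exact: sumr_ge0.
have SC : S + a L <= C * L.+1%:R.
  rewrite mulr_natr -[X in _ *+ X](card_ord L.+1) -sumr_const -(big_ord_recr L (fun k => a k))/=.
  by apply: ler_sum => k _; have /andP[] := aC k.
rewrite -lerBlDl (le_trans (lerB (lexx _) IH))// subrXX (_ : S + a L - S = a L); last by ring.
apply: (@le_trans _ _ (a L * \sum_(i < e.+1) (C * L.+1%:R) ^+ e)).
  rewrite ler_wpM2l//; apply: ler_sum => i _.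
  apply: (@le_trans _ _ ((S + a L) ^+ (e - i) * (S + a L) ^+ i)).
    rewrite ler_wpM2l ?exprn_ge0// ?addr_ge0//.
    by rewrite lerXn2r ?nnegrE ?addr_ge0// lerDl.
  rewrite -exprD subnK; last by rewrite -ltnS.
  by rewrite lerXn2r ?nnegrE ?addr_ge0// mulr_ge0.
rewrite sumr_const card_ord -(mulr_natl (_ ^+ _)) exprMn.
suff -> : a L * (e.+1%:R * (C ^+ e * L.+1%:R ^+ e)) = e.+1%:R * C ^+ e * (L.+1%:R ^+ e * a L) by [].
by ring.
Qed.

End sequences_tail.

Section tail.
Context {R : realType} {N : nat}.
Local Notation V := 'rV[R]_N.
Local Notation mu := (lebesgue_rV N).
Implicit Types (x y a : V) (r : R).

Definition dyadic (r : R) (j : nat) : R := r / 2 ^+ j.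

Lemma dyadicS r j : dyadic r j.+1 = dyadic r j / 2.
Proof. by rewrite /dyadic exprSr invfM mulrA. Qed.

Lemma dyadic_gt0 r j : 0 < r -> 0 < dyadic r j.
Proof. by move=> r0; rewrite divr_gt0// exprn_gt0. Qed.

Lemma dyadic_le r j : 0 < r -> dyadic r j <= r.
Proof. by move=> r0; rewrite ler_pdivrMr ?exprn_gt0// ler_peMr ?(ltW r0)// exprn_ege1// ler1n. Qed.

Lemma dyadic_cvg r : dyadic r j @[j --> \oo] --> (0 : R).
Proof.
rewrite -[X in _ --> X](mulr0 r); apply: cvgMr.
rewrite (_ : (fun j => (2 ^+ j)^-1) = (fun j => (2^-1 : R) ^+ j)).
  by apply: cvg_expr; rewrite ger0_norm ?invr_ge0// invf_lt1// ltr1n.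
by apply/funext => j; rewrite exprVn.
Qed.

Definition qbox a r : set V := obox (\row_i (a ord0 i - r)) (\row_i (a ord0 i + r)).

Lemma measurable_qbox a r : measurable (qbox a r).
Proof. exact: measurable_obox. Qed.

Lemma qbox_cube a r : qbox a r `<=` cube a r.
Proof.
by move=> x h i; have /andP[] := h i; rewrite !mxE ler_distl => /ltW -> ->.
Qed.

Lemma cube_add a x r s t : cube a r x -> r + s <= t -> cube x s `<=` cube a t.
Proof.
move=> ax rst y xy i; rewrite (_ : _ - _ = (y ord0 i - x ord0 i) + (x ord0 i - a ord0 i)); last by ring.
by rewrite (le_trans (ler_normD _ _))// (le_trans _ rst)// addrC lerD.
Qed.

Variables (Omega : set V) (u : V -> R) (g : 'I_N -> V -> R) (a : V) (r0 C : R).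
Hypotheses (N0 : (0 < N)%N) (oO : open Omega) (L2u : L2 Omega u) (gu : L2_gradient Omega u g).
Hypotheses (r00 : 0 < r0) (C0 : 0 <= C) (aO : cube a (2 * r0) `<=` Omega).
(** The Morrey estimate multiplied by [r]: for N = 2n, r^(N-1) is r times r^(2n-2). *)
Hypothesis gC : forall x r, cube a r0 x -> 0 < r -> r <= 2 * r0 -> cube x r `<=` Omega ->
  (r%:E * \int[mu]_(y in cube x r) (\sum_i g i y ^+ 2)%:E <= (C * r ^+ N.-1)%:E)%E.

Let D := cube a (2 * r0).
Let Q := qbox a r0.
Let mO : measurable Omega := measurable_open_rV oO.
Let mD : measurable D := measurable_cube a (2 * r0).
Let mQ : measurable Q := measurable_qbox a r0.
Let G y := \sum_i `|g i y|.
Let C1 := C + N%:R * 2 ^+ N.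
Let r_ := dyadic r0.

Let G0 y : 0 <= G y. Proof. exact: sumr_ge0. Qed.

Let mg i : measurable_fun Omega (g i). Proof. by have [[]] := gu i. Qed.

Let mG : measurable_fun D G.
Proof.
apply: (measurable_funS mO aO); apply: measurable_sum => i.
exact: measurableT_comp.
Qed.

Let G_le x r : cube a r0 x -> 0 < r -> r <= 2 * r0 -> cube x r `<=` Omega ->
  (\int[mu]_(y in cube x r) (G y)%:E <= (C1 * r ^+ N.-1)%:E)%E.
Proof.
move=> ax rgt0 rr xO; have mx := measurable_cube x r.
have mgx i : measurable_fun (cube x r) (g i) by exact: (measurable_funS mO xO).
under eq_integral do rewrite -sumEFin.
rewrite ge0_integral_sum//; last 1 first.
- by move=> i; apply/measurable_EFinP; exact: measurableT_comp.
(* The weight [r] in [L1_cube_le] balances its two terms: both become O(r^(N-1)). *)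
apply: (@le_trans _ _ (\sum_i (r%:E * \int[mu]_(y in cube x r) (g i y ^+ 2)%:E +
    (r^-1 * (2 * r) ^+ N)%:E))%E).
  by apply: lee_sum => i _; apply: (L1_cube_le mO (mg i)) => //; exact: ltW.
rewrite big_split/= sumEFin sumr_const card_ord -ge0_sume_distrr; last first.
  by move=> i _; apply: integral_ge0 => y _; rewrite lee_fin sqr_ge0.
rewrite -ge0_integral_sum//; last 2 first.
- by move=> i; apply/measurable_EFinP; exact: measurable_funX.
- by move=> i y _; rewrite lee_fin sqr_ge0.
under eq_integral do rewrite sumEFin.
rewrite [C1 * _]mulrDl [(_ + _)%:E in leRHS]EFinD; apply: leeD; first exact: gC.
rewrite lee_fin exprMn -(mulr_natl (_ * _)).
suff -> : r^-1 * (2 ^+ N * r ^+ N) = 2 ^+ N * r ^+ N.-1 by rewrite mulrA.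
by rewrite mulrCA -{2}(prednK N0) exprS mulKf// gt_eqF.
Qed.

Let GD : (\int[mu]_(y in D) (G y)%:E <= (C1 * (2 * r0) ^+ N.-1)%:E)%E.
Proof.
apply: G_le => //; last by rewrite mulr_gt0.
by move=> i; rewrite subrr normr0 ltW.
Qed.

Let sub x r : cube a r0 x -> r <= r0 -> cube x r `<=` D.
Proof. by move=> ax rr; apply: cube_add ax _; rewrite mulr2n mulrDl mul1r lerD2l. Qed.

Let A j x := (((2 * bump_bound / r_ j) ^+ N.-1)%:E * cube_integral G D (r_ j) x)%E.
Let C2 := (2 * bump_bound) ^+ N.-1 * C1.
Let C3 := (2 * bump_bound) ^+ N.-1 * 2 ^+ N * (C1 * (2 * r0) ^+ N.-1).

Let bb0 : 0 <= 2 * bump_bound :> R.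
Proof. by rewrite mulr_ge0// mulr_ge0// sqr_ge0. Qed.

Let C10 : 0 <= C1.
Proof. by rewrite addr_ge0// mulr_ge0// exprn_ge0. Qed.

Let C30 : 0 <= C3.
Proof.
by rewrite /C3 mulr_ge0 ?mulr_ge0 ?exprn_ge0// mulr_ge0// ltW.
Qed.

Let C20 : 0 <= C2.
Proof. by rewrite mulr_ge0 ?exprn_ge0. Qed.

Let r_0 j : 0 < r_ j. Proof. exact: dyadic_gt0. Qed.

Let coef0 j : 0 <= (2 * bump_bound / r_ j) ^+ N.-1.
Proof. by rewrite exprn_ge0// divr_ge0// ltW. Qed.

Let A0 j x : (0 <= A j x)%E.
Proof. by rewrite mule_ge0 ?lee_fin//; exact: cube_integral_ge0. Qed.

Let mA j : measurable_fun setT (A j).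
Proof. by apply: measurable_funeM; exact: measurable_cube_integral. Qed.

Let A_le j x : Q x -> (A j x <= C2%:E)%E.
Proof.
move=> /qbox_cube ax; have rj : r_ j <= r0 by exact: dyadic_le.
have xD := sub ax rj.
rewrite /A cube_integralE//.
apply: (@le_trans _ _ (((2 * bump_bound / r_ j) ^+ N.-1)%:E * (C1 * r_ j ^+ N.-1)%:E)%E).
  apply: lee_wpmul2l; first by rewrite lee_fin.
  apply: G_le => //; last exact: subset_trans aO.
  by rewrite (le_trans rj)// ler_peMl ?ler1n// ltW.
have rN : r_ j ^+ N.-1 != 0 by rewrite expf_neq0// gt_eqF.
rewrite -EFinM lee_fin expr_div_n /C2.
set X := (2 * bump_bound) ^+ N.-1.
suff -> : X / r_ j ^+ N.-1 * (C1 * r_ j ^+ N.-1) = X * C1 by [].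
by field.
Qed.

Let int_A j : (\int[mu]_(x in Q) A j x <= (C3 * r_ j)%:E)%E.
Proof.
apply: (@le_trans _ _ (\int[mu]_x A j x)%E).
  by apply: ge0_subset_integral.
rewrite ge0_integralZl//; last 3 first.
- exact: measurable_cube_integral.
- by move=> x _; exact: cube_integral_ge0.
- by rewrite lee_fin.
rewrite integral_cube_integral//; last exact: ltW.
apply: (@le_trans _ _ (((2 * bump_bound / r_ j) ^+ N.-1)%:E *
    (((2 * r_ j) ^+ N)%:E * (C1 * (2 * r0) ^+ N.-1)%:E))%E).
  apply: lee_wpmul2l; first by rewrite lee_fin.
  by apply: lee_wpmul2l; rewrite // lee_fin exprn_ge0// mulr_ge0// ltW.
rewrite -!EFinM lee_fin expr_div_n [(2 * r_ j) ^+ N]exprMn -{4}(prednK N0) [r_ j ^+ _.+1]exprS /C3.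
set K := C1 * _.
set X := (2 * bump_bound) ^+ N.-1; set Y := 2 ^+ N.
have rN : r_ j ^+ N.-1 != 0 by rewrite expf_neq0// gt_eqF.
suff -> : X / r_ j ^+ N.-1 * (Y * (r_ j * r_ j ^+ N.-1) * K) = X * Y * K * r_ j by [].
by field.
Qed.

Let M j x := mollify Omega u (r_ j) x.

Let diff j x : Q x -> (`|M j.+1 x - M j x|%:E <= A j x)%E.
Proof.
move=> /qbox_cube ax; have rj : r_ j <= r0 by exact: dyadic_le.
have xD := sub ax rj.
rewrite /A cube_integralE// /M /r_ dyadicS.
by apply: (mollify_diff oO L2u gu) => //; exact: subset_trans aO.
Qed.

(** [approximate_identity] wants a function integrable on the whole space. For [x] in [Q] the cubes
    at the dyadic scales stay in [D], so [w] and [u] have the same mollifications there. *)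
Let w := u \_ D.
Let iw : mu.-integrable setT (EFin \o w).
Proof.
rewrite /w -restrict_EFin; apply/(integrable_mkcond _ mD).
apply/integrableP; split.
  by apply/measurable_EFinP; exact: (measurable_funS mO aO L2u.1).
by apply: (L1_cube_lty L2u) => //; rewrite mulr_ge0// ltW.
Qed.

Let ME j x : Q x -> (\int[mu]_y (w y * kern (r_ j) x y)%:E = (M j x)%:E)%E.
Proof.
move=> /qbox_cube ax; have rj : r_ j <= r0 by exact: dyadic_le.
have xD := sub ax rj; have xO := subset_trans xD aO.
have [iu _] := mollify_bound L2u mO (r_0 j) xO.
rewrite /M /mollify /Rintegral fineK; last exact: integrable_fin_num.
rewrite (integral_restrict (subsetT D)); last first.
  by move=> y _ Dy; rewrite /w /patch memNset// mul0r.
rewrite (integral_restrict aO); last first.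
  by move=> y _ Dy; rewrite kern_out ?mulr0// => /xD.
by apply: eq_integral => y Dy; rewrite /w patchT.
Qed.

Let mM j : measurable_fun Q (M j).
Proof.
have [|/measurable_int m _] := @box_average _ _ w iw (\row_i (a ord0 i - r0)) (\row_i (a ord0 i + r0)) _ (r_0 j).
  by move=> i; rewrite !mxE lerBlDr -addrA lerDl addr_ge0 ?ltW.
apply/measurable_EFinP; apply: eq_measurable_fun m => x /set_mem Qx.
by rewrite /= ME.
Qed.

Variables (e : nat) (K : R).
Hypothesis (K0 : 0 <= K).
Hypothesis KP : forall k, k.+1%:R ^+ e * 2^-1 ^+ k <= K * (3 / 4) ^+ k.

(** The weights of [expr_sum_le], enlarged from (k+1)^e to (J+k+1)^e so that [KP] applies at the
    index [J + k]. *)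
Let H J x := (\sum_(k <oo) ((J + k).+1%:R ^+ e)%:E * A (J + k) x)%E.

Let H_term0 J k x : (0 <= ((J + k).+1%:R ^+ e)%:E * A (J + k) x)%E.
Proof. by rewrite mule_ge0// lee_fin exprn_ge0. Qed.

Let mH J : measurable_fun setT (H J).
Proof.
apply: ge0_emeasurable_sum => [k x _ _|k _]; first exact: H_term0.
exact: measurable_funeM.
Qed.

Let int_H J : (\int[mu]_(x in Q) H J x <= (C3 * r0 * K * 4 * (3 / 4) ^+ J)%:E)%E.
Proof.
rewrite integral_nneseries//; last first.
  by move=> k; apply: measurable_funTS; exact: measurable_funeM.
apply: lime_le.
  by apply: is_cvg_nneseries => k _ _; exact: integral_ge0.
apply: nearW => L; rewrite big_mkord.
apply: (@le_trans _ _ (\sum_(k < L) (C3 * r0 * K * (3 / 4) ^+ (J + k))%:E)%E).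
  apply: lee_sum => k _; rewrite ge0_integralZl//; last exact: measurable_funTS.
  apply: (@le_trans _ _ (((J + k).+1%:R ^+ e)%:E * (C3 * r_ (J + k))%:E)%E).
    by apply: lee_wpmul2l; rewrite ?lee_fin ?exprn_ge0.
  rewrite -EFinM lee_fin /r_ /dyadic -exprVn.
  have := KP (J + k); set X := _ ^+ e; set Y := 2^-1 ^+ _ => XY.
  have -> : X * (C3 * (r0 * Y)) = C3 * r0 * (X * Y) by ring.
  by rewrite -[leRHS]mulrA ler_wpM2l// mulr_ge0// ltW.
rewrite sumEFin lee_fin -mulr_sumr -[leRHS]mulrA ler_wpM2l ?geometric_sum_le//.
by apply: mulr_ge0 => //; apply: mulr_ge0 => //; exact: ltW.
Qed.

Section pointwise.
Variable x : V.
Hypothesis Qx : Q x.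
Let al k := fine (A k x).

Let Ax k : A k x = (al k)%:E.
Proof.
rewrite fineK// ge0_fin_numE//; exact: le_lt_trans (A_le k Qx) (ltry _).
Qed.

Let al_itv k : 0 <= al k <= C2.
Proof. by rewrite -!lee_fin -Ax A0 A_le. Qed.

Let al0 k : 0 <= al k. Proof. by have /andP[] := al_itv k. Qed.

Let dal k : `|M k.+1 x - M k x| <= al k.
Proof. by rewrite -lee_fin -Ax diff. Qed.

Let M_sum J L : `|M (J + L) x - M J x| <= \sum_(k < L) al (J + k).
Proof.
elim: L => [|L IH]; first by rewrite addn0 subrr normr0 big_ord0.
rewrite big_ord_recr/= addnS.
by apply: le_trans (ler_distD (M (J + L) x) _ _) _; rewrite addrC lerD.
Qed.

Let wsum_H J L : ((\sum_(k < L) (J + k).+1%:R ^+ e * al (J + k))%:E <= H J x)%E.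
Proof.
apply: (@le_trans _ _ (\sum_(0 <= k < L) ((J + k).+1%:R ^+ e)%:E * A (J + k) x)%E).
  by rewrite big_mkord -sumEFin; apply: lee_sum => k _; rewrite Ax EFinM.
by apply: nneseries_lim_ge => k _ _; exact: H_term0.
Qed.

Let sum_H L : ((\sum_(k < L) al k)%:E <= H 0 x)%E.
Proof.
apply: le_trans (wsum_H 0 L); rewrite lee_fin; apply: ler_sum => k _.
by rewrite add0n ler_peMl// exprn_ege1// ler1n.
Qed.

Let M_pow J L : (((`|M (J + L) x - M J x|) ^+ e.+1)%:E <= (e.+1%:R * C2 ^+ e)%:E * H J x)%E.
Proof.
apply: (@le_trans _ _ ((e.+1%:R * C2 ^+ e)%:E * (\sum_(k < L) (J + k).+1%:R ^+ e * al (J + k))%:E)%E); last first.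
  by apply: lee_wpmul2l; rewrite // lee_fin mulr_ge0// exprn_ge0.
rewrite -EFinM lee_fin.
apply: (@le_trans _ _ ((\sum_(k < L) al (J + k)) ^+ e.+1)).
  by rewrite lerXn2r ?nnegrE// sumr_ge0.
apply: le_trans (expr_sum_le e L (fun k => al_itv (J + k))) _.
rewrite ler_wpM2l ?mulr_ge0 ?exprn_ge0//; apply: ler_sum => k _.
by rewrite ler_wpM2r// lerXn2r ?nnegrE// ler_nat ltnS leq_addl.
Qed.

Lemma mollify_dyadic_dominated j : (`|M j x|%:E <= `|M 0 x|%:E + H 0 x)%E.
Proof.
apply: le_trans (leeD (lexx _) (sum_H j)); rewrite -EFinD lee_fin.
have := M_sum 0 j; rewrite add0n => h.
by rewrite -lerBlDl (le_trans _ h)// lerB_dist.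
Qed.

Lemma mollify_dyadic_cvg : (H 0 x < +oo)%E -> cvgn (fun j => M j x).
Proof.
move=> Hoo.
have c : cvgn (series (telescope (fun j => M j x))).
  apply: normed_cvg; apply: (@series_le_cvg _ _ al) => [k|//|k|]; first exact: normr_ge0.
    exact: dal.
  apply: nondecreasing_is_cvgn.
    by apply: nondecreasing_series => k _ _.
  exists (fine (H 0 x)) => _ [L _ <-].
  rewrite -lee_fin fineK ?ge0_fin_numE//; last by apply: nneseries_ge0 => k _ _; exact: H_term0.
  by rewrite /series/= big_mkord.
rewrite (_ : (fun j => M j x) = (fun j => series (telescope (fun j => M j x)) j + M 0 x)).
  by apply: is_cvgD => //; exact: is_cvg_cst.
by apply/funext => j; rewrite telescopeK subrK.
Qed.

Lemma mollify_dyadic_limit_le J : M j x @[j --> \oo] --> u x ->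
  ((`|u x - M J x| ^+ e.+1)%:E <= (e.+1%:R * C2 ^+ e)%:E * H J x)%E.
Proof.
move=> cM.
have c1 : M (J + L) x @[L --> \oo] --> u x.
  by under eq_fun do rewrite addnC; move: cM; rewrite -(cvg_shiftn J (fun j => M j x)).
have c2 : `|M (J + L) x - M J x| @[L --> \oo] --> `|u x - M J x|.
  by apply: cvg_norm; apply: cvgB => //; exact: cvg_cst.
have c3 : `|M (J + L) x - M J x| ^+ e.+1 @[L --> \oo] --> `|u x - M J x| ^+ e.+1.
  exact: (continuous_cvg _ (@exprn_continuous R e.+1 _) c2).
have c4 : (`|M (J + L) x - M J x| ^+ e.+1)%:E @[L --> \oo] --> (`|u x - M J x| ^+ e.+1)%:E.
  by apply: cvg_EFin => //; exact: nearW.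
by apply: (cvge_le _ c4); apply: nearW => L; exact: M_pow.
Qed.

End pointwise.

(** By [int_H], [H 0] is integrable, hence finite almost everywhere; it provides both the
    convergence and, added to |M_0 u|, the dominating function. *)
Let mollify_dyadic_ae_cvg : {ae mu, forall x, Q x -> M j x @[j --> \oo] --> u x}.
Proof.
have lohi i : (\row_i (a ord0 i - r0)) ord0 i <= (\row_i (a ord0 i + r0)) ord0 i.
  by rewrite !mxE lerBlDr -addrA lerDl addr_ge0 ?ltW.
have iH : mu.-integrable Q (H 0).
  apply/integrableP; split; first exact: measurable_funTS.
  under eq_integral do rewrite gee0_abs ?nneseries_ge0//.
  exact: le_lt_trans (int_H 0) (ltry _).
have iM : mu.-integrable Q (fun x => `|M 0 x|%:E).
  have [im _] := box_average iw (r_0 0) lohi.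
  apply: (eq_integrable mQ _ _ _ (integrable_abse im)) => x /set_mem Qx.
  by rewrite /= ME.
have ih : mu.-integrable Q (fun x => `|M 0 x|%:E + H 0 x)%E by exact: integrableD.
have h1 : {ae mu, forall x, Q x -> forall j,
    (`|\int[mu]_y (w y * kern (r_ j) x y)%:E| <= `|M 0 x|%:E + H 0 x)%E}.
  by apply: aeW => x Qx j; rewrite ME// abse_EFin mollify_dyadic_dominated.
have h2 : {ae mu, forall x, Q x -> cvgn (fun j => \int[mu]_y (w y * kern (r_ j) x y)%:E)%E}.
  apply: filterS (integrable_ae mQ iH) => x Hx Qx.
  under eq_fun do rewrite ME//.
  have /mollify_dyadic_cvg c : (H 0 x < +oo)%E by rewrite ltey_eq Hx.
  by apply: (cvgP (limn (fun j => M j x))%:E); apply: cvg_EFin; [exact: nearW|exact: c].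
apply: filterS (approximate_identity iw r_0 (dyadic_cvg r0) lohi ih h1 h2) => x cx Qx.
have := cx Qx; under eq_fun do rewrite ME//.
rewrite /w patchT; last first.
  by apply/mem_set; apply: (cubeS _ (qbox_cube Qx)); rewrite ler_peMl ?ler1n// ltW.
by move=> /fine_cvgP[_].
Qed.

Lemma mollify_tail J :
  measurable_fun Q (mollify Omega u (dyadic r0 J)) /\
  (\int[mu]_(x in Q) (`|u x - mollify Omega u (dyadic r0 J) x| ^+ e.+1)%:E <=
  (e.+1%:R * C2 ^+ e * (C3 * r0 * K * 4) * (3 / 4) ^+ J)%:E)%E.
Proof.
rewrite -[in leRHS]mulrA; split; first exact: mM.
have mu_ : measurable_fun Q u.
  apply: (measurable_funS mO _ L2u.1); apply: subset_trans aO => x /qbox_cube.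
  apply: cubeS.
  by rewrite ler_peMl ?ler1n// ltW.
apply: (@le_trans _ _ (\int[mu]_(x in Q) ((e.+1%:R * C2 ^+ e)%:E * H J x))%E).
  apply: ae_ge0_le_integral => //.
  - apply/measurable_EFinP; apply: measurable_funX; apply: measurableT_comp => //.
    by apply: measurable_funB => //; exact: mM.
  - by move=> x _; rewrite mule_ge0 ?lee_fin ?mulr_ge0 ?exprn_ge0//; apply: nneseries_ge0 => k _ _; exact: H_term0.
  - by apply: measurable_funeM; exact: measurable_funTS.
  - by apply: filterS mollify_dyadic_ae_cvg => x cx Qx; apply: mollify_dyadic_limit_le; [exact: Qx|exact: cx].
rewrite ge0_integralZl ?lee_fin ?mulr_ge0 ?exprn_ge0//; last 2 first.
- exact: measurable_funTS.
- by move=> x _; apply: nneseries_ge0 => k _ _; exact: H_term0.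
rewrite [X in (_ <= X)%E]EFinM; apply: lee_wpmul2l; last exact: int_H.
by rewrite lee_fin mulr_ge0// exprn_ge0.
Qed.

End tail.

(** The point is the order of the quantifiers: [K] is fixed before [Omega], [u], [g] and [a]. *)
Lemma mollify_uniform_tail (R : realType) N e (r0 C : R) : (0 < N)%N -> 0 < r0 -> 0 <= C ->
  exists K : R, forall (Omega : set 'rV[R]_N) u g a, open Omega -> L2 Omega u ->
    L2_gradient Omega u g -> cube a (2 * r0) `<=` Omega ->
    (forall x r, cube a r0 x -> 0 < r -> r <= 2 * r0 -> cube x r `<=` Omega ->
      (r%:E * \int[lebesgue_rV N]_(y in cube x r) (\sum_i g i y ^+ 2)%:E <=
      (C * r ^+ N.-1)%:E)%E) ->
    forall J, measurable_fun (qbox a r0) (mollify Omega u (dyadic r0 J)) /\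
      (\int[lebesgue_rV N]_(x in qbox a r0)
         (`|u x - mollify Omega u (dyadic r0 J) x| ^+ e.+1)%:E <=
       (K * (3 / 4) ^+ J)%:E)%E.
Proof.
move=> N0 r00 C0; have [K K0 KP] := @poly_geometric R e.
eexists => Omega u g a oO L2u gu aO gC J.
have [m le] := mollify_tail N0 oO L2u gu r00 C0 aO gC K0 KP J.
by split => //; exact: le.
Qed.

(** * Local convergence of the sequence *)

Lemma cvge0_near (R : realType) (f : nat -> \bar R) : (forall k, 0 <= f k)%E ->
  f @ \oo --> 0%E <-> (forall e : R, 0 < e -> \forall k \near \oo, (f k <= e%:E)%E).
Proof.
move=> f0; split=> [/fine_cvgP[ff fc] e e0|h].
  apply: filterS2 ff (cvgr_le _ fc _ e0) => k fk.
  by rewrite -lee_fin fineK.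
apply/fine_cvgP; split.
  apply: filterS (h 1 ltr01) => k fk.
  by rewrite ge0_fin_numE// (le_lt_trans fk)// ltry.
apply/cvgr0Pnorm_le => e e0; apply: filterS (h e e0) => k fk.
by rewrite ger0_norm ?fine_ge0// -lee_fin fineK// ge0_fin_numE// (le_lt_trans fk)// ltry.
Qed.

Section controlled.
Context {R : realType} {n : nat}.
Local Notation V := 'rV[R]_(n + n).
Local Notation mu := (lebesgue_rV (n + n)).
Variable Omega : set V.
Hypotheses (n0 : (0 < n)%N) (oO : open Omega).

(** A bound on the star norm with a dominating current and a gradient actually chosen; one number
    serves for the mass and for the squared L^2 norm. *)
Definition controlled (M : R) (v : V -> R) := exists T g,
  [/\ is_current11 Omega T, closed_current Omega T, positive_current Omega T,
     (mass Omega T <= M%:E)%E &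
     [/\ L2 Omega v, (\int[mu]_(x in Omega) (v x ^+ 2)%:E <= M%:E)%E,
        L2_gradient Omega v g &
        positive_current Omega (fun j k f => T j k f - dudbaru Omega g j k f)]].

Lemma controlled_le M M' v : M <= M' -> controlled M v -> controlled M' v.
Proof.
move=> MM' [T [g [cT dT pT mT [L2v vM gv dom]]]].
exists T, g; split => //; first by rewrite (le_trans mT)// lee_fin.
by split => //; rewrite (le_trans vM)// lee_fin.
Qed.

Lemma mass_ge0 T : is_current11 Omega T -> (0 <= mass Omega T)%E.
Proof.
move=> cT.
have t0 : test_function Omega (fun=> 0) by apply/test_funP; exact: test_fun0.
apply: ereal_sup_ubound; exists (fun=> 0); first by split => // x; rewrite lexx ler01.
rewrite big1 ?mulr0// => j _.
have lin : linear_on_test Omega (T j j).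
  by move=> a f h /test_funP tf /test_funP th; have [+ _] := cT j j; exact.
by rewrite (linear_on_test0 lin).
Qed.

Lemma W12star_controlled v : W12star Omega v -> exists M, controlled M v.
Proof.
move=> [[L2v _] [T [cT dT pT mT [g gv dom]]]].
have m0 := mass_ge0 cT.
have v0 : (0 <= \int[mu]_(x in Omega) (v x ^+ 2)%:E)%E.
  by apply: integral_ge0 => x _; rewrite lee_fin sqr_ge0.
exists (fine (mass Omega T) + fine (\int[mu]_(x in Omega) (v x ^+ 2)%:E)), T, g.
split => //.
  by rewrite -[leLHS]fineK ?ge0_fin_numE// lee_fin lerDl fine_ge0.
split => //; have [_ vf] := L2v.
by rewrite -[leLHS]fineK ?ge0_fin_numE// lee_fin lerDr fine_ge0.
Qed.

(** The infimum in [star_norm] need not be attained; the extra 1 leaves room for a current of nearly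
    minimal mass. *)
Lemma star_norm_controlled v M : W12star Omega v -> (star_norm Omega v <= M%:E)%E ->
  controlled (M ^+ 2 + 1) v.
Proof.
move=> [[L2v _] _] vM.
set I := (\int[mu]_(x in Omega) (v x ^+ 2)%:E)%E.
set m := ereal_inf [set mass Omega T | T in dominating Omega v].
have I0 : (0 <= I)%E by apply: integral_ge0 => x _; rewrite lee_fin sqr_ge0.
have m0 : (0 <= m)%E.
  by apply: le_ereal_inf_tmp => _ [T [cT _ _ _ _] <-]; exact: mass_ge0.
have Im : (I + m <= (M ^+ 2)%:E)%E.
  have M0 : 0 <= M by rewrite -lee_fin (le_trans _ vM)// sqrte_ge0.
  rewrite -lee_sqrt ?lee_fin ?sqr_ge0//.
  by apply: le_trans vM _; rewrite EFin_expe sqrte_sqr gee0_abs// lee_fin.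
have : (m < (M ^+ 2 + 1)%:E)%E.
  apply: (@le_lt_trans _ _ (M ^+ 2)%:E); last by rewrite lte_fin ltrDl.
  by apply: le_trans Im; rewrite leeDr.
move=> /ereal_inf_lt[_ [T [cT dT pT mT [g gv dom]] <-] TM].
exists T, g; split => //; first exact: ltW.
split => //; apply: (@le_trans _ _ (M ^+ 2)%:E); last by rewrite lee_fin lerDl.
by apply: le_trans Im; rewrite leeDl.
Qed.

Lemma controlled_uniform_tail e M (r0 : R) : 0 < r0 -> 0 <= M ->
  exists K : R, forall a v, cube a ((1 + 4 * (n + n)%:R) * r0) `<=` Omega ->
    controlled M v ->
    forall J, measurable_fun (qbox a r0) (mollify Omega v (dyadic r0 J)) /\
      (\int[mu]_(x in qbox a r0)
         (`|v x - mollify Omega v (dyadic r0 J) x| ^+ e.+1)%:E <=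
       (K * (3 / 4) ^+ J)%:E)%E.
Proof.
move=> r00 M0.
have N0 : (0 < n + n)%N by rewrite addn_gt0 n0.
pose N : R := (n + n)%:R.
have N1 : 1 <= N by rewrite ler1n.
(* [morrey] is needed for radii up to [2 * r0], that is, N (2 r0)^2 <= d^2 / 2, which holds since N
   >= 1. Cubes of radius [d] about points of [cube a r0] fit in the cube of radius (1 + 4N) r0 of
   the statement. *)
pose d := 4 * N * r0.
have d0 : 0 < d by rewrite mulr_gt0// mulr_gt0// ltr0n.
pose C := 8 * M * expR 2 * 2 ^+ n * (N / d ^+ 2) ^+ n.-1.
have C0 : 0 <= C.
  rewrite mulr_ge0 ?exprn_ge0// ?divr_ge0 ?sqr_ge0// mulr_ge0 ?exprn_ge0//.
  by rewrite mulr_ge0 ?expR_ge0// mulr_ge0.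
have [K KP] := mollify_uniform_tail e N0 r00 C0.
exists K => a v aO [T [g [cT dT pT mT [L2v vM gv dom]]]].
apply: (KP _ _ g) => //.
  by apply: subset_trans aO; apply: cubeS; rewrite ler_pM2r//; rewrite -/N; lra.
move=> x r ax r_0 rr xO.
have xdO : cube x d `<=` Omega.
  apply: subset_trans aO; apply: cube_add ax _.
  by rewrite -/N mulrDl mul1r.
have rd : N * r ^+ 2 <= d ^+ 2 / 2.
  apply: (@le_trans _ _ (N * (2 * r0) ^+ 2)).
    by rewrite ler_wpM2l ?lerXn2r ?nnegrE ?mulr_ge0 ?(ltW r_0) ?(ltW r00)// (le_trans ler01).
  have -> : d ^+ 2 / 2 = N * (2 * r0) ^+ 2 * (2 * N) by rewrite /d; field.
  by rewrite ler_peMr// ?mulr_ge0 ?sqr_ge0//; lra.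
have := morrey oO cT pT dT gv dom n0 d0 r_0 rd xdO mT; rewrite -/N => h.
apply: (@le_trans _ _ (r%:E * (8 * M * expR 2 * 2 ^+ n * (N * r ^+ 2 / d ^+ 2) ^+ n.-1)%:E)%E).
  by apply: lee_wpmul2l; rewrite ?lee_fin ?(ltW r_0).
rewrite -EFinM lee_fin (mulrAC N) [(N / d ^+ 2 * r ^+ 2) ^+ n.-1]exprMn -exprM.
rewrite (_ : (n + n).-1 = (2 * n.-1).+1); last first.
  by rewrite -(prednK n0) addSn addnS/= mul2n addnn.
set X := (N / d ^+ 2) ^+ n.-1.
rewrite /C -/X exprS.
have -> : r * (8 * M * expR 2 * 2 ^+ n * (X * r ^+ (2 * n.-1))) =
  8 * M * expR 2 * 2 ^+ n * X * (r * r ^+ (2 * n.-1)) by ring.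
exact: lexx.
Qed.

Lemma mollify_bounded M (a : V) (r r0 : R) : 0 < r -> r <= r0 -> cube a (2 * r0) `<=` Omega ->
  exists B : R, forall v, controlled M v -> forall x, cube a r0 x ->
    mu.-integrable Omega (fun y => (v y * kern r x y)%:E) /\
    `|mollify Omega v r x| <= B.
Proof.
move=> r_0 rr aO; have mO := measurable_open_rV oO.
exists ((bump_bound / r) ^+ (n + n) * (M + (2 * r) ^+ (n + n))).
move=> v [T [g [_ _ _ _ [L2v vM _ _]]]] x ax.
have xO : cube x r `<=` Omega.
  by apply: subset_trans aO; apply: cube_add ax _; lra.
have [i le] := mollify_bound L2v mO r_0 xO; split => //.
rewrite -lee_fin; apply: le_trans le _.
rewrite EFinM; apply: lee_wpmul2l.
  by rewrite lee_fin exprn_ge0// divr_ge0 ?(ltW r_0)// mulr_ge0// sqr_ge0.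
apply: le_trans (L1_cube_le mO L2v.1 (ltW r_0) ltr01 xO) _.
rewrite mul1e invr1 mul1r EFinD leeD2r//; apply: le_trans vM.
apply: ge0_subset_integral => //; first exact: measurable_cube.
  by apply/measurable_EFinP; apply: measurable_funX; exact: L2v.1.
by move=> y _; rewrite lee_fin sqr_ge0.
Qed.

Lemma expr_add3_le (x y z : R) m : 0 <= x -> 0 <= y -> 0 <= z ->
  (x + y + z) ^+ m <= 3 ^+ m * (x ^+ m + y ^+ m + z ^+ m).
Proof.
move=> x0 y0 z0.
(* Here [t] stands for the largest of the three numbers. *)
have H t : 0 <= t -> x <= t -> y <= t -> z <= t ->
    t ^+ m <= x ^+ m + y ^+ m + z ^+ m -> 
    (x + y + z) ^+ m <= 3 ^+ m * (x ^+ m + y ^+ m + z ^+ m).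
  move=> t0 xt yt zt tm; apply: (@le_trans _ _ ((3 * t) ^+ m)).
    by rewrite lerXn2r ?nnegrE ?addr_ge0 ?mulr_ge0//; lra.
  by rewrite exprMn ler_wpM2l// exprn_ge0.
have [xy|/ltW yx] := leP x y; have [yz|/ltW zy] := leP y z.
- by apply: (H z) => //; [exact: le_trans yz|rewrite lerDr addr_ge0 ?exprn_ge0].
- by apply: (H y) => //; rewrite -addrA addrCA lerDl addr_ge0 ?exprn_ge0.
- have [xz|/ltW zx] := leP x z.
    by apply: (H z) => //; rewrite lerDr addr_ge0 ?exprn_ge0.
  by apply: (H x) => //; rewrite -addrA lerDl addr_ge0 ?exprn_ge0.
- by apply: (H x) => //; [exact: le_trans zy _|rewrite -addrA lerDl addr_ge0 ?exprn_ge0].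
Qed.

Lemma integral_expr3_le (Q : set V) (f f' g' g : V -> R) m : measurable Q ->
  measurable_fun Q f -> measurable_fun Q f' -> measurable_fun Q g' -> measurable_fun Q g ->
  (\int[mu]_(x in Q) (`|f x - g x| ^+ m)%:E <= (3 ^+ m)%:E *
    (\int[mu]_(x in Q) (`|f x - f' x| ^+ m)%:E + \int[mu]_(x in Q) (`|f' x - g' x| ^+ m)%:E +
     \int[mu]_(x in Q) (`|g x - g' x| ^+ m)%:E))%E.
Proof.
move=> mQ mf mf' mg' mg.
have mm (h k : V -> R) : measurable_fun Q h -> measurable_fun Q k ->
    measurable_fun Q (fun x => (`|h x - k x| ^+ m)%:E).
  move=> mh mk; apply/measurable_EFinP; apply: measurable_funX.
  by apply: measurableT_comp => //; exact: measurable_funB.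
have m0 (h k : V -> R) x : Q x -> (0 <= (`|h x - k x| ^+ m)%:E)%E by rewrite lee_fin exprn_ge0.
rewrite -!ge0_integralD//; try exact: mm; last 2 first.
- by move=> x Qx; rewrite adde_ge0// m0.
- by apply: emeasurable_funD; exact: mm.
rewrite -ge0_integralZl ?lee_fin ?exprn_ge0//; last 2 first.
- by apply: emeasurable_funD; [apply: emeasurable_funD|]; exact: mm.
- by move=> x Qx; rewrite !adde_ge0// m0.
apply: ge0_le_integral => //.
- exact: mm.
- by apply: measurable_funeM; apply: emeasurable_funD; [apply: emeasurable_funD|]; exact: mm.
- move=> x Qx; rewrite -!EFinD -EFinM lee_fin.
  apply: le_trans (expr_add3_le m (normr_ge0 _) (normr_ge0 _) (normr_ge0 _)).
  rewrite lerXn2r ?nnegrE ?addr_ge0// (distrC (g x)).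
  rewrite (le_trans (ler_distD (g' x) _ _))// lerD2r.
  exact: ler_distD.
Qed.

Section sequence.
Variables (u_ : nat -> V -> R) (u : V -> R) (M : R).
Hypotheses (M0 : 0 <= M) (u_M : forall k, controlled M (u_ k)) (uM : controlled M u).
Hypothesis u_cvg : cvg_distribution Omega u_ u.
Variables (a : V) (r0 : R).
Hypotheses (r00 : 0 < r0) (aO : cube a ((1 + 4 * (n + n)%:R) * r0) `<=` Omega).

Let Q := qbox a r0.
Let mQ : measurable Q := measurable_qbox a r0.

Let aO2 : cube a (2 * r0) `<=` Omega.
Proof.
have N1 : 1 <= (n + n)%:R :> R by rewrite ler1n addn_gt0 n0.
by apply: subset_trans aO; apply: cubeS; rewrite ler_pM2r//; lra.
Qed.

Let QO : Q `<=` Omega.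
Proof.
apply: subset_trans aO2; apply: subset_trans (@qbox_cube _ _ a r0) _.
by apply: cubeS; rewrite ler_peMl ?ler1n// ltW.
Qed.

Let mv v : controlled M v -> measurable_fun Q v.
Proof.
move=> [T [g [_ _ _ _ [[mv _] _ _ _]]]].
exact: (measurable_funS (measurable_open_rV oO) QO mv).
Qed.

Let muQ : (mu Q < +oo)%E.
Proof.
have mc := measurable_cube a r0.
have E : mu (cube a r0) = _ := lebesgue_cube a (ltW r00).
have le : (mu Q <= mu (cube a r0))%E by apply: le_measure; rewrite ?inE//; exact: qbox_cube.
by apply: le_lt_trans le _; rewrite E ltry.
Qed.

Lemma mollify_Lm_cvg m J :
  (\int[mu]_(x in Q) (`|mollify Omega (u_ k) (dyadic r0 J) x -
     mollify Omega u (dyadic r0 J) x| ^+ m.+1)%:E)%E @[k --> \oo] --> 0%E.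
Proof.
(* Supplies the measurability of the mollifications. *)
have [K tail] := controlled_uniform_tail 0 r00 M0.
have rJ0 : 0 < dyadic r0 J by exact: dyadic_gt0.
have rJ : dyadic r0 J <= r0 by exact: dyadic_le.
have [B BP] := mollify_bounded M rJ0 rJ aO2.
have mm v : controlled M v -> measurable_fun Q (mollify Omega v (dyadic r0 J)).
  by move=> cv; have [] := tail a v aO cv J.
pose f k x := `|mollify Omega (u_ k) (dyadic r0 J) x - mollify Omega u (dyadic r0 J) x| ^+ m.+1.
have := @dominated_cvg _ V R mu Q mQ (fun k x => (f k x)%:E) (cst 0%E) (cst ((2 * B) ^+ m.+1)%:E).
rewrite integral0; apply => //.
- move=> k; apply/measurable_EFinP; apply: measurable_funX.
  by apply: measurableT_comp => //; apply: measurable_funB; exact: mm.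
- move=> x Qx; apply: cvg_EFin; first exact: nearW.
  have xO : cube x (dyadic r0 J) `<=` Omega.
    by apply: subset_trans aO2; apply: cube_add (qbox_cube Qx) _; lra.
  (* The kernel centred at [x] is a test function, so convergence of distributions is pointwise
     convergence of the mollifications. *)
  have c1 := u_cvg ((test_funP _ _).2 (test_kern rJ0 xO)).
  have c2 : `|mollify Omega (u_ k) (dyadic r0 J) x - mollify Omega u (dyadic r0 J) x| @[k --> \oo] --> (0 : R).
    rewrite -(@normr0 _ R) -(subrr (mollify Omega u (dyadic r0 J) x)); apply: cvg_norm.
    by apply: cvgB; [exact: c1|exact: cvg_cst].
  have := continuous_cvg _ (@exprn_continuous R m.+1 _) c2.
  by rewrite expr0n; exact.
- apply/integrableP; split; first exact: measurable_cst.
  by rewrite integral_cst//= lte_mul_pinfty.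
- move=> k x Qx; rewrite /f /= lee_fin normrX normr_id.
  have [_ b1] := BP _ (u_M k) x (qbox_cube Qx); have [_ b2] := BP _ uM x (qbox_cube Qx).
  have B0 : 0 <= B by exact: le_trans b1.
  rewrite lerXn2r ?nnegrE ?mulr_ge0//.
  by rewrite (le_trans (ler_normB _ _))// mulr2n mulrDl mul1r lerD.
Qed.

Lemma local_Lm_cvg m :
  (\int[mu]_(x in Q) (`|u_ k x - u x| ^+ m.+1)%:E)%E @[k --> \oo] --> 0%E.
Proof.
have [K tail] := controlled_uniform_tail m r00 M0.
apply/cvge0_near => [k|e e0].
  by apply: integral_ge0 => x _; rewrite lee_fin exprn_ge0.
(* Three terms, each at most [d], and the factor [3 ^+ m.+1] of [integral_expr3_le]. *)
pose d := e / (3 * 3 ^+ m.+1).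
have d0 : 0 < d by rewrite divr_gt0// mulr_gt0// exprn_gt0.
have [J KJ] : exists J, K * (3 / 4) ^+ J <= d.
  have q1 : `|3 / 4 : R| < 1 by rewrite ger0_norm; lra.
  have h := cvgr_le _ (cvg_geometric K q1) _ d0.
  by have [J _ /(_ J (leqnn J))] := h; exists J.
have /cvge0_near/(_ d d0) mid := mollify_Lm_cvg m J.
apply: filterS (mid _) => [k midk|k].
  have [mk tk] := tail a _ aO (u_M k) J; have [mu_ tu] := tail a _ aO uM J.
  apply: le_trans (integral_expr3_le _ mQ (mv (u_M k)) mk mu_ (mv uM)) _.
  apply: (@le_trans _ _ ((3 ^+ m.+1)%:E * (d%:E + d%:E + d%:E))%E).
    apply: lee_wpmul2l; first by rewrite lee_fin exprn_ge0.
    have Kd : ((K * (3 / 4) ^+ J)%:E <= d%:E)%E by rewrite lee_fin.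
    by apply: leeD (le_trans tu Kd); exact: leeD (le_trans tk Kd) midk.
  rewrite -!EFinD -EFinM lee_fin /d le_eqVlt; apply/orP; left; apply/eqP.
  by field; rewrite expf_neq0.
by apply: integral_ge0 => x _; rewrite lee_fin exprn_ge0.
Qed.

Lemma local_Lm_finite m v : controlled M v ->
  (\int[mu]_(x in Q) (`|v x| ^+ m.+1)%:E < +oo)%E.
Proof.
move=> vM; have [K tail] := controlled_uniform_tail m r00 M0.
have [mm t] := tail a v aO vM 0.
have rJ0 : 0 < dyadic r0 0 by exact: dyadic_gt0.
have rJ : dyadic r0 0 <= r0 by exact: dyadic_le.
have [B BP] := mollify_bounded M rJ0 rJ aO2.
(* With both comparison functions 0 the third term vanishes; the first is the tail at [J = 0], and
   the second is bounded because the mollification is. *)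
have := integral_expr3_le m.+1 mQ (mv vM) mm (measurable_cst (0 : R)) (measurable_cst (0 : R)).
under eq_integral do rewrite subr0.
move=> /le_lt_trans; apply.
rewrite lte_mul_pinfty ?lee_fin ?exprn_ge0//.
rewrite [X in (_ + _ + X)%E]integral0_eq ?adde0; last first.
  by move=> x _; rewrite subrr normr0 expr0n.
rewrite lte_add_pinfty//; first exact: le_lt_trans t (ltry _).
apply: (@le_lt_trans _ _ (\int[mu]_(x in Q) (`|B| ^+ m.+1)%:E)%E).
  apply: ge0_le_integral => //.
  - apply/measurable_EFinP; apply: measurable_funX; apply: measurableT_comp => //.
    by apply: measurable_funB => //; exact: measurable_cst.
  - move=> x Qx; have [_ b] := BP _ vM x (qbox_cube Qx).
    by rewrite lee_fin subr0 lerXn2r ?nnegrE// (le_trans b)// ler_norm.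
by rewrite integral_cst//= lte_mul_pinfty// lee_fin exprn_ge0.
Qed.

End sequence.

End controlled.

(** * From boxes to compact sets, and from integer to real exponents *)

Section cover.
Context {R : realType} {N : nat}.
Local Notation V := 'rV[R]_N.
Local Notation mu := (lebesgue_rV N).

(** The first power dominates for t <= 1 and the power m + 1 for t >= 1; real exponents are thus
    reduced to integer ones. *)
Lemma powR_le_expr (t p : R) m : 0 <= t -> 1 <= p -> p <= m.+1%:R ->
  t `^ p <= t ^+ 1 + t ^+ m.+1.
Proof.
move=> t0 p1 pm; have [t1|/ltW t1] := leP t 1.
  apply: (@le_trans _ _ t); last by rewrite expr1 lerDl exprn_ge0.
  move: t0; rewrite le_eqVlt => /orP[/eqP <-|t0].
    by rewrite powR0// gt_eqF// (lt_le_trans ltr01).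
  by apply: ge1r_powR => //; rewrite t0.
apply: (@le_trans _ _ (t ^+ m.+1)); last by rewrite lerDr exprn_ge0.
by rewrite -powR_mulrn// ler_powR.
Qed.

(** The estimates on a box involve the function on a larger concentric cube, so it is the cube
    enlarged by [c] that must fit in [Omega]; the radius therefore varies with the centre. *)
Lemma qbox_cover (Omega K : set V) (c : R) : open Omega -> compact K -> K `<=` Omega -> 0 < c ->
  exists (s : seq V) (r : V -> R),
    (forall x, x \in s -> 0 < r x /\ cube x (c * r x) `<=` Omega) /\
    (forall y, K y -> exists2 x, x \in s & qbox x (r x) y).
Proof.
move=> oO cK KO c0.
have H (x : V) : exists r : R, 0 < r /\ (Omega x -> cube x (c * r) `<=` Omega).
  have [Ox|nOx] := pselect (Omega x); last by exists 1.
  have /nbhs_ballP[e /= e0 xe] := open_nbhs_nbhs (conj oO Ox).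
  exists (e / (2 * c)); split; first by rewrite divr_gt0// mulr_gt0.
  move=> _ y; have -> : c * (e / (2 * c)) = e / 2 by field; rewrite gt_eqF.
  rewrite cubeE /=; last by rewrite divr_ge0// ltW.
  move=> xy; apply: xe; rewrite -ball_normE /= distrC (le_lt_trans xy)//.
  by rewrite ltr_pdivrMr// ltr_pMr// ltr1n.
have [r rP] := choice H.
move: cK; rewrite compact_cover => /(_ _ K (fun x => (ball x (r x))^°)).
case=> [x _|x Kx|s sK Ks].
- exact: open_interior.
- exists x => //; rewrite /interior; apply: nbhsx_ballx; exact: (rP x).1.
exists (finmap.enum_fset s), r; split=> [x xs|y /Ks[x /= xs /interior_subset]].
  have [r0 rO] := rP x; split => //; apply: rO; apply: KO.
  by have := sK _ xs; rewrite inE.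
rewrite -ball_normE /= => xy; exists x => // i; rewrite !mxE.
have h : `|x ord0 i - y ord0 i| < r x.
  have := ler_coord_norm (x - y) i; rewrite !mxE => /le_lt_trans; exact.
by move: h; rewrite ltr_distl => /andP[h1 h2]; apply/andP; split; lra.
Qed.

Let powR_cover_setT (K : set V) (w : V -> R) (s : seq V) (r : V -> R) p m :
  measurable_fun setT w -> measurable K ->
  (forall y, K y -> exists2 x, x \in s & qbox x (r x) y) ->
  1 <= p -> p <= m.+1%:R ->
  (\int[mu]_x (`|(w \_ K) x| `^ p)%:E <=
   \sum_(x <- s) (\int[mu]_(y in qbox x (r x)) (`|w y| ^+ 1)%:E +
     \int[mu]_(y in qbox x (r x)) (`|w y| ^+ m.+1)%:E))%E.
Proof.
move=> mw mK Ks p1 pm.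
have mq x := measurable_qbox x (r x).
have mwx e : measurable_fun setT (fun y => (`|w y| ^+ e)%:E).
  by apply/measurable_EFinP; apply: measurable_funX; exact: measurableT_comp.
pose h (y : V) : \bar R := ((`|w y| ^+ 1)%:E + (`|w y| ^+ m.+1)%:E)%E.
have h0 y : (0 <= h y)%E by rewrite adde_ge0 ?lee_fin ?exprn_ge0.
have mh : measurable_fun setT h by exact: emeasurable_funD.
have mhx x : measurable_fun setT (h \_ (qbox x (r x))).
  exact: ((measurable_restrictT h (mq x)).1 (measurable_funTS mh)).
have hx0 x y : (0 <= (h \_ (qbox x (r x))) y)%E by rewrite /patch; case: ifP.
apply: (@le_trans _ _ (\int[mu]_y \sum_(x <- s) (h \_ (qbox x (r x))) y)%E).
  apply: ge0_le_integral => //.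
  - apply/measurable_EFinP.
    have mwK : measurable_fun setT (w \_ K) := (measurable_restrictT w mK).1 (measurable_funTS mw).
    have mn : measurable_fun setT (fun y => `|(w \_ K) y|) by exact: measurableT_comp.
    exact: (measurableT_comp (measurable_powR p) mn).
  - exact: emeasurable_sum.
  - move=> y _; rewrite /patch; case: ifPn => [/set_mem Ky|_]; last first.
      have p0 : p != 0 by rewrite gt_eqF// (lt_le_trans ltr01).
      by rewrite normr0 powR0// sume_ge0// => x _; case: ifP.
    have [x xs xy] := Ks y Ky.
    rewrite (big_rem x)//= mem_set//; apply: (@le_trans _ _ (h y)).
      by rewrite /h -EFinD lee_fin; exact: powR_le_expr.
    by rewrite leeDl// sume_ge0// => z _; case: ifP.
rewrite ge0_integral_sum//; apply: lee_sum => x _.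
rewrite -integral_mkcond ge0_integralD//; try exact: measurable_funTS.
Qed.

Lemma powR_cover (Omega K : set V) (w : V -> R) (s : seq V) (r : V -> R) p m :
  measurable Omega -> measurable_fun Omega w -> measurable K -> K `<=` Omega ->
  (forall x, x \in s -> qbox x (r x) `<=` Omega) ->
  (forall y, K y -> exists2 x, x \in s & qbox x (r x) y) ->
  1 <= p -> p <= m.+1%:R ->
  (\int[mu]_x (`|(w \_ K) x| `^ p)%:E <=
   \sum_(x <- s) (\int[mu]_(y in qbox x (r x)) (`|w y| ^+ 1)%:E +
     \int[mu]_(y in qbox x (r x)) (`|w y| ^+ m.+1)%:E))%E.
Proof.
move=> mO mw mK KO sO Ks p1 pm.
(* Extension by 0 gives measurability on the whole space and changes nothing on the boxes. *)
have mw' : measurable_fun setT (w \_ Omega) := (measurable_restrictT w mO).1 mw.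
have wE y : Omega y -> (w \_ Omega) y = w y by move=> Oy; rewrite /patch mem_set.
have := powR_cover_setT mw' mK Ks p1 pm.
rewrite (_ : (w \_ Omega) \_ K = w \_ K); last first.
  by apply/funext => y; rewrite /patch; case: ifPn => // /set_mem/KO/mem_set ->.
move=> /le_trans; apply; rewrite big_seq [leRHS]big_seq; apply: lee_sum => x xs.
have E e : (\int[mu]_(y in qbox x (r x)) (`|(w \_ Omega) y| ^+ e)%:E =
    \int[mu]_(y in qbox x (r x)) (`|w y| ^+ e)%:E)%E.
  by apply: eq_integral => y /set_mem/(sO x xs)/wE ->.
by rewrite !E.
Qed.

End cover.

Section local_convergence.
Context {R : realType} {n : nat}.
Local Notation V := 'rV[R]_(n + n).
Local Notation mu := (lebesgue_rV (n + n)).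
Variable Omega : set V.
Hypotheses (n0 : (0 < n)%N) (oO : open Omega).
Variables (p : R) (p1 : 1 <= p).

Let mO : measurable Omega := measurable_open_rV oO.

(** The enlargement that [controlled_uniform_tail] asks for. *)
Let c : R := 1 + 4 * (n + n)%:R.

Let c1 : 1 <= c. Proof. by rewrite lerDl mulr_ge0. Qed.

Let c0 : 0 < c. Proof. exact: lt_le_trans c1. Qed.

Let m := Num.bound p.

Let pm : p <= m.+1%:R.
Proof.
apply: (@le_trans _ _ m%:R); last by rewrite ler_nat.
by apply/ltW/archi_boundP; rewrite (le_trans ler01).
Qed.

Let p0 : p != 0. Proof. by rewrite gt_eqF// (lt_le_trans ltr01). Qed.

Let qbox_sub x r : 0 < r -> cube x (c * r) `<=` Omega -> qbox x r `<=` Omega.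
Proof.
move=> r0 xO; apply: subset_trans (@qbox_cube _ _ x r) _; apply: subset_trans xO.
by apply: cubeS; rewrite ler_peMl// ltW.
Qed.

Let LpE K w : Lp_norm_on K p w = ((\int[mu]_x (`|(w \_ K) x| `^ p)%:E) `^ p^-1)%E.
Proof. by rewrite /Lp_norm_on unlock. Qed.

Lemma controlled_Lploc M v : 0 <= M -> controlled Omega M v -> Lploc Omega p v.
Proof.
move=> M0 vM; have mv : measurable_fun Omega v.
  by case: vM => [T [g [_ _ _ _ [[]]]]].
split=> // K cK KO; rewrite LpE poweR_lty//.
have [s [r [rP sP]]] := qbox_cover oO cK KO c0.
have sO x : x \in s -> qbox x (r x) `<=` Omega.
  by move=> /rP[r0]; exact: qbox_sub.
apply: le_lt_trans (powR_cover mO mv (measurable_compact_rV cK) KO sO sP p1 pm) _.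
rewrite big_seq; apply: lte_sum_pinfty => x /rP[r0 xO].
by rewrite lte_add_pinfty//; exact: (local_Lm_finite n0 oO M0 r0 xO).
Qed.

Lemma controlled_cvg_Lp M u_ u K : 0 <= M -> (forall k, controlled Omega M (u_ k)) ->
  controlled Omega M u -> cvg_distribution Omega u_ u -> compact K -> K `<=` Omega ->
  Lp_norm_on K p (u_ k \- u) @[k --> \oo] --> 0%E.
Proof.
move=> M0 u_M uM u_cvg cK KO.
have mv v : controlled Omega M v -> measurable_fun Omega v by case=> [T [g [_ _ _ _ [[]]]]].
have [s [r [rP sP]]] := qbox_cover oO cK KO c0.
have sO x : x \in s -> qbox x (r x) `<=` Omega.
  by move=> /rP[r0]; exact: qbox_sub.
pose S k := (\sum_(x <- s) (\int[mu]_(y in qbox x (r x)) (`|(u_ k \- u) y| ^+ 1)%:E +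
     \int[mu]_(y in qbox x (r x)) (`|(u_ k \- u) y| ^+ m.+1)%:E))%E.
have i0 e k x : (0 <= \int[mu]_(y in qbox x (r x)) (`|(u_ k \- u) y| ^+ e)%:E)%E.
  by apply: integral_ge0 => y _; rewrite lee_fin exprn_ge0.
have S0 k : (0 <= S k)%E by apply: sume_ge0 => x _; rewrite adde_ge0.
have Sc : S k @[k --> \oo] --> 0%E.
  have h : (fun k => \sum_(x <- s | x \in s) (\int[mu]_(y in qbox x (r x)) (`|(u_ k \- u) y| ^+ 1)%:E +
      \int[mu]_(y in qbox x (r x)) (`|(u_ k \- u) y| ^+ m.+1)%:E)%E) @ \oo -->
      (\sum_(x <- s | x \in s) (0 + 0))%E.
    apply: cvg_nnesum => x xs; first by apply: nearW => k; rewrite adde_ge0.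
    have [r0 xO] := rP x xs.
    by apply: cvgeD => //; exact: (local_Lm_cvg n0 oO M0 u_M uM u_cvg r0 xO).
  have s0 : (\sum_(x <- s | x \in s) (0 + 0) = 0 :> \bar R)%E.
    by rewrite big1// => x _; rewrite adde0.
  move: h; rewrite s0; apply: cvg_trans; apply: near_eq_cvg; apply: nearW => k.
  by rewrite /S [RHS]big_seq.
apply/cvge0_near => [k|e e0]; first exact: Lnorm_ge0.
(* The norm is a p-th root, so the integral has to be made smaller than the p-th power of [e]. *)
have ep0 : 0 < e `^ p by rewrite powR_gt0.
apply: filterS (((cvge0_near S0).1 Sc) _ ep0) => k Sk.
have mw : measurable_fun Omega (u_ k \- u) by apply: measurable_funB; exact: mv.
have le := powR_cover mO mw (measurable_compact_rV cK) KO sO sP p1 pm.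
rewrite LpE; apply: (@le_trans _ _ ((e `^ p)%:E `^ p^-1)%E).
  apply: gt0_ler_poweR; rewrite ?in_itv/= ?leey ?andbT.
  - by rewrite invr_ge0 (le_trans ler01).
  - by apply: integral_ge0 => y _; rewrite lee_fin powR_ge0.
  - by rewrite lee_fin ltW.
  - exact: le_trans le Sk.
by rewrite poweR_EFin -powRrM divff// powRr1// ltW.
Qed.

End local_convergence.

Theorem corollary1p5 (R : realType) (n : nat) (n_gt0 : (0 < n)%N)
    (Omega : set 'rV[R]_(n + n)) (domain_Omega : domain Omega)
    (u_ : nat -> 'rV[R]_(n + n) -> R) (u : 'rV[R]_(n + n) -> R)
    (u_W12star : forall k, W12star Omega (u_ k))
    (u_bounded : star_bounded Omega u_)
    (uW12star : W12star Omega u)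
    (u_cvg : cvg_distribution Omega u_ u) (p : R) (p_ge1 : 1 <= p) :
  cvg_Lploc Omega p u_ u.
Proof.
have [oO _ _] := domain_Omega.
have [M1 M1P] := u_bounded.
have [M2 M2P] := W12star_controlled uW12star.
(* One constant for the sequence and for its limit; the sign of [M2] is unknown, whence the absolute
   value. *)
pose M := M1 ^+ 2 + 1 + `|M2|.
have M0 : 0 <= M by rewrite !addr_ge0 ?sqr_ge0.
have u_M k : controlled Omega M (u_ k).
  by apply: controlled_le (star_norm_controlled (u_W12star k) (M1P k)); rewrite lerDl.
have uM : controlled Omega M u.
  apply: controlled_le M2P; apply: le_trans (ler_norm _) _.
  by rewrite lerDr addr_ge0 ?sqr_ge0.
split=> [k||K cK KO].
- exact: controlled_Lploc M0 (u_M k).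
- exact: controlled_Lploc M0 uM.
- exact: (controlled_cvg_Lp n_gt0 oO p_ge1 M0 u_M uM u_cvg cK KO).
Qed.
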